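(* Let $(\mathbb V,\operatorname{dist})$ be a Polish, perfect and ultrahomogeneous metric space. Then the set $$\mathcal{DS}^{SH}_{\operatorname{Iso}}(\mathbb V)=\{\tilde f\in\mathcal{DS}_{\operatorname{Iso}}(\mathbb V): f\text{ is conjugate to the Special Homeomorphism}\}$$ is a dense $G_\delta$ subset of $\mathcal{DS}_{\operatorname{Iso}}(\mathbb V)$, where $\mathcal{DS}_{\operatorname{Iso}}(\mathbb V)$ carries the quotient topology.
   Context: A topological space is Polish if it is separable and admits a compatible complete metric; it is perfect if it has no isolated points. A Cantor space is a (nonempty) compact, perfect, totally disconnected metric space. An isometry is a surjective distance-preserving map. A metric space $\mathbb V$ is ultrahomogeneous if every isometry $\varphi:A\to B$ between compact subsets $A,B$ of $\mathbb V$ extends to an isometry $\varphi':\mathbb V\to\mathbb V$. For a metric space $(N,\operatorname{dist})$, $\mathcal K(N)$ is the set of nonempty compact subsets of $N$, with the Hausdorff distance. On $\mathbb V^2=\mathbb V\times\mathbb V$ use the max-metric $\operatorname{dist}_2((a,b),(c,d))=\max\{\operatorname{dist}(a,c),\operatorname{dist}(b,d)\}$, and let $\pi_1,\pi_2:\mathbb V^2\to\mathbb V$ be the coordinate projections. Define $\mathcal{DS}(\mathbb V)=\{f\in\mathcal K(\mathbb V^2):\pi_1(f)=\pi_2(f)\}$, with metric $\mathrm{D_H}$ the Hausdorff distance on $\mathcal K(\mathbb V^2)$ associated to $\operatorname{dist}_2$. For $f\in\mathcal{DS}(\mathbb V)$ put $M(f)=\pi_1(f)=\pi_2(f)$. Functions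 are identified with their graphs. On $\mathcal{DS}(\mathbb V)$ define $f\sim g$ if there is an isometry $\varphi:M(f)\to M(g)$ with $\varphi^{-1}g\varphi=f$, i.e. $(x,y)\in f\iff(\varphi(x),\varphi(y))\in g$ for all $x,y\in M(f)$ (isometric conjugacy). Let $\mathcal{DS}_{\operatorname{Iso}}(\mathbb V)=\mathcal{DS}(\mathbb V)/\sim$ with the quotient topology, and let $\tilde f$ denote the class of $f$. Two homeomorphisms $f:X\to X$ and $g:Y\to Y$ are (topologically) conjugate if there is a homeomorphism $\varphi:X\to Y$ with $g\varphi=\varphi f$. Special Homeomorphism: for a Cantor space $K$, let $H(K)$ be the group of homeomorphisms of $K$ with the $C^0$ (uniform convergence) topology, which is Polish. By a theorem of Kechris and Rosendal (see also Akin, Glasner and Weiss), there is a conjugacy class in $H(K)$ that is a dense $G_\delta$ subset of $H(K)$; by the Baire category theorem it is unique. The Special Homeomorphism is any element of this class (well defined up to topological conjugacy, and independent of $K$). Thus ''$f$ is conjugate to the Special Homeomorphism'' means that $f$ is (the graph of) a homeomorphism of a Cantor space $M(f)$ onto itself that is topologically conjugate to such an element; this property depends only on $\tilde f$. *)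

(* Defs.v *)
From HB Require Import structures.
From mathcomp Require Import all_boot all_order all_algebra.
From mathcomp Require Import generic_quotient.
From mathcomp Require Import all_classical all_reals all_analysis.
From mathcomp Require Import borel_hierarchy.

Set Implicit Arguments.
Unset Strict Implicit.
Unset Printing Implicit Defensive.

Import Order.TTheory GRing.Theory Num.Theory.
Import numFieldTopology.Exports numFieldNormedType.Exports.

Local Open Scope classical_set_scope.
Local Open Scope ring_scope.
Local Open Scope quotient_scope.

Section polish.
Context (R : realType) (T : topologicalType).
Implicit Types d : T -> T -> R.

Definition is_metric d :=
  [/\ forall x y, 0 <= d x y,
      forall x y, d x y = 0 <-> x = y,
      forall x y, d x y = d y x &
      forall x y z, d x z <= d x y + d y z].

Definition compatible_metric d :=
  forall (x : T) (A : set T),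
    nbhs x A <-> exists2 e : R, 0 < e & [set y | d x y < e] `<=` A.

Definition cauchy_for d (u : nat -> T) :=
  forall e : R, 0 < e ->
    exists N, forall m n, (N <= m)%N -> (N <= n)%N -> d (u m) (u n) < e.

Definition complete_metric d :=
  forall u : nat -> T, cauchy_for d u -> exists l : T, u @ \oo --> l.

Definition separable := exists2 D : set T, countable D & dense D.

(* The complete metric need not be the given one when T is a metric space. *)
Definition polish :=
  separable /\
  exists d, [/\ is_metric d, compatible_metric d & complete_metric d].

End polish.

Section maps.

Definition homeomorphism {X Y : topologicalType} (A : set X) (B : set Y)
    (f : X -> Y) :=
  exists g : Y -> X,
    [/\ {within A, continuous f}, {within B, continuous g},
        set_fun A B f, set_fun B A g &
        {in A, cancel f g} /\ {in B, cancel g f}].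

Definition isometry {R : realType} {X Y : metricType R} (A : set X) (B : set Y)
    (f : X -> Y) :=
  f @` A = B /\ forall x y, A x -> A y -> mdist (f x) (f y) = mdist x y.

Definition ultrahomogeneous {R : realType} (V : metricType R) :=
  forall (A B : set V) (f : V -> V), compact A -> compact B ->
    isometry A B f ->
    exists f' : V -> V, isometry [set: V] [set: V] f' /\ {in A, f' =1 f}.

Definition cantor_set {X : topologicalType} (A : set X) :=
  [/\ A !=set0, compact A, perfect_set A & totally_disconnected A].

End maps.

Section prod_metric.
Context {R : realType} {U V : metricType R}.

Definition prod_dist (p q : U * V) : R :=
  Num.max (mdist p.1 q.1) (mdist p.2 q.2).

Let prod_dist_ge0 p q : 0 <= prod_dist p q.
Proof. by rewrite le_max mdist_ge0. Qed.

Let prod_dist_positivity p q : prod_dist p q = 0 -> p = q.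
Proof.
case: p q => [a b] [c d] h.
have : prod_dist (a, b) (c, d) <= 0 by rewrite h.
rewrite ge_max /= => /andP[h1 h2].
by congr pair; apply: (@mdist_positivity R); apply/eqP;
  rewrite eq_le mdist_ge0 andbT.
Qed.

Let ballE_prod_dist p e : ball p e = [set q | prod_dist p q < e].
Proof.
apply/seteqP; split=> q /=; rewrite /prod_dist gt_max {1}/ball/= /prod_ball/=
  !ballEmdist.
  by move=> [] /= -> ->.
by move=> /andP[].
Qed.

HB.instance Definition _ := @PseudoMetric_isMetric.Build R (U * V)%type
  prod_dist prod_dist_ge0 prod_dist_positivity ballE_prod_dist.

End prod_metric.

Section hausdorff.
Context {R : realType} {N : metricType R}.
Implicit Types (A B C : set N) (x y : N).

Definition dist_to A x : R := inf [set mdist x a | a in A].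

Definition hausdorff_dist A B : R :=
  Num.max (sup [set dist_to B a | a in A]) (sup [set dist_to A b | b in B]).

Lemma dist_to_has_inf A x : A !=set0 -> has_inf [set mdist x a | a in A].
Proof.
move=> [a Aa]; split; first by exists (mdist x a), a.
by exists 0 => _ [b _ <-]; exact: mdist_ge0.
Qed.

Lemma dist_to_ge0 A x : 0 <= dist_to A x.
Proof.
have [->|/set0P A0] := eqVneq A set0; first by rewrite /dist_to image_set0 inf0.
apply: lb_le_inf; first by have [] := dist_to_has_inf x A0.
by move=> _ [b _ <-]; exact: mdist_ge0.
Qed.

Lemma dist_to_le A x a : A a -> dist_to A x <= mdist x a.
Proof.
by move=> Aa; apply: ge_inf; [exists 0 => _ [b _ <-]; exact: mdist_ge0|exists a].
Qed.

Lemma dist_to_lt A x (e : R) : A !=set0 -> dist_to A x < e ->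
  exists2 a, A a & mdist x a < e.
Proof.
move=> A0 xe; have e0 : 0 < e - dist_to A x by rewrite subr_gt0.
have [_ [a Aa <-]] := inf_adherent e0 (dist_to_has_inf x A0).
by rewrite /dist_to addrC subrK; exists a.
Qed.

Lemma mdist_continuous x : continuous (mdist x : N -> R).
Proof.
move=> y; apply/cvgrPdist_lt => e e0.
have := nbhsx_ballx y e e0; rewrite ballEmdist.
apply: filterS => z /= yz; apply: le_lt_trans yz.
rewrite ler_norml lerBlDr lerBrDr.
by rewrite [X in - X + _]metric_sym addrC lerBlDr addrC [mdist z y]metric_sym
  [leRHS]addrC metric_triangle [X in _ <= X + _]metric_sym addrC
  metric_triangle.
Qed.

Lemma dist_to_has_sup A B : compact A -> A !=set0 -> B !=set0 ->
  has_sup [set dist_to B a | a in A].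
Proof.
move=> cA [a0 Aa0] [b0 Bb0]; split; first by exists (dist_to B a0), a0.
have cd : compact (mdist b0 @` A).
  by apply: continuous_compact => //; apply: continuous_subspaceT;
    exact: mdist_continuous.
have [M [_ hM]] := compact_bounded cd.
exists (M + 1) => _ [a Aa <-]; rewrite (le_trans (dist_to_le a Bb0))//.
rewrite metric_sym (le_trans (ler_norm _))//.
by apply: (hM (M + 1)); [rewrite ltrDl|exists a].
Qed.

Lemma hausdorff_dist_sym A B : hausdorff_dist A B = hausdorff_dist B A.
Proof. exact: maxC. Qed.

Lemma dist_to_hausdorff A B a : compact A -> B !=set0 -> A a ->
  dist_to B a <= hausdorff_dist A B.
Proof.
move=> cA B0 Aa; rewrite le_max; apply/orP; left.
apply: ub_le_sup; last by exists a.
by have [] := @dist_to_has_sup A B cA _ B0; first by exists a.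
Qed.

Lemma hausdorff_dist_le A B (e : R) : A !=set0 -> B !=set0 ->
  (forall a, A a -> dist_to B a <= e) -> (forall b, B b -> dist_to A b <= e) ->
  hausdorff_dist A B <= e.
Proof.
move=> [a Aa] [b Bb] AB BA; rewrite ge_max; apply/andP; split.
  by apply: ge_sup => [|_ [x Ax <-]]; [exists (dist_to B a), a|exact: AB].
by apply: ge_sup => [|_ [x Bx <-]]; [exists (dist_to A b), b|exact: BA].
Qed.

Lemma dist_to_eq0 A x : closed A -> A !=set0 -> dist_to A x <= 0 -> A x.
Proof.
move=> cA A0 x0; apply: cA => U; rewrite -filter_from_ballE => -[e /= e0 eU].
have [a Aa xa] := dist_to_lt A0 (le_lt_trans x0 e0).
by exists a; split=> //; apply: eU; rewrite ballEmdist.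
Qed.

Lemma dist_to_triangle A B C a : compact A -> compact B ->
    B !=set0 -> C !=set0 -> A a ->
  dist_to C a <= hausdorff_dist A B + hausdorff_dist B C.
Proof.
move=> cA cB B0 C0 Aa; apply/ler_addgt0Pr => e e0.
have [|b Bb ab] := @dist_to_lt B a (hausdorff_dist A B + e / 2) B0.
  by rewrite (le_lt_trans (dist_to_hausdorff cA B0 Aa))// ltrDl divr_gt0.
have [|c Cc bc] := @dist_to_lt C b (hausdorff_dist B C + e / 2) C0.
  by rewrite (le_lt_trans (dist_to_hausdorff cB C0 Bb))// ltrDl divr_gt0.
rewrite (le_trans (dist_to_le a Cc))// (le_trans (metric_triangle a b c))//.
by rewrite [in leRHS](splitr e) addrACA lerD// ltW.
Qed.

End hausdorff.

Definition compacts {R : realType} (N : metricType R) : Type :=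
  set_type [set A : set N | A !=set0 /\ compact A].

Section compacts_metric.
Context {R : realType} {N : metricType R}.
Implicit Types A B C : compacts N.

HB.instance Definition _ := Choice.on (compacts N).

Definition compacts_dist A B : R := hausdorff_dist (\val A) (\val B).

Let neq0 A : \val A !=set0. Proof. by have [] := set_mem (valP A). Qed.

Let cpt A : compact (\val A). Proof. by have [] := set_mem (valP A). Qed.

Let dist_le A B (e : R) :
  (forall a, \val A a -> dist_to (\val B) a <= e) ->
  (forall b, \val B b -> dist_to (\val A) b <= e) -> compacts_dist A B <= e.
Proof. by move=> AB BA; apply: hausdorff_dist_le. Qed.

Let dist_ge0 A B : 0 <= compacts_dist A B.
Proof.
have [a Aa] := neq0 A.
apply: (le_trans (dist_to_ge0 (\val B) a)).
by apply: dist_to_hausdorff => //; apply: cpt.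
Qed.

Let distxx A : compacts_dist A A = 0.
Proof.
apply/eqP; rewrite eq_le dist_ge0 andbT.
by apply: dist_le => a Aa; rewrite -(mdistxx a); exact: dist_to_le.
Qed.

Let dist_sym A B : compacts_dist A B = compacts_dist B A.
Proof. exact: hausdorff_dist_sym. Qed.

Let dist_eq0 A B : compacts_dist A B = 0 -> A = B.
Proof.
move=> AB0; apply: val_inj.
have closedc C : closed (\val C).
  by apply: compact_closed; [exact: metric_hausdorff|exact: cpt].
apply/seteqP; split=> x xA; apply: dist_to_eq0 => //.
  by rewrite -AB0; apply: dist_to_hausdorff => //; exact: cpt.
by rewrite -AB0 dist_sym; apply: dist_to_hausdorff => //; exact: cpt.
Qed.

Let dist_triangle B A C :
  compacts_dist A C <= compacts_dist A B + compacts_dist B C.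
Proof.
apply: dist_le => x xA; first by apply: dist_to_triangle => //; exact: cpt.
rewrite addrC (dist_sym A) (dist_sym B).
by apply: dist_to_triangle => //; exact: cpt.
Qed.

HB.instance Definition _ := @isMetric.Build R (compacts N)
  compacts_dist distxx dist_eq0 dist_sym dist_triangle.

End compacts_metric.

Section dynamical_systems.
Context {R : realType} (V : metricType R).

(* set_type carries the initial topology of its inclusion, so DS is
   topologized by the Hausdorff metric of compacts (V * V). *)
Definition DS : Type :=
  set_type [set f : compacts (V * V)%type |
    fst @` (\val f : set (V * V)) = snd @` (\val f : set (V * V))].

HB.instance Definition _ := Topological.on DS.

Definition graph (f : DS) : set (V * V) := \val (\val f).

Definition M (f : DS) : set V := fst @` graph f.

(* phi is a total map of which only the restriction to M f matters. *)
Definition iso_conj (f g : DS) : bool :=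
  `[< exists phi : V -> V, isometry (M f) (M g) phi /\
        forall x y, M f x -> M f y ->
          graph f (x, y) <-> graph g (phi x, phi y) >].

Lemma iso_conj_refl : reflexive iso_conj.
Proof.
move=> f; apply/asboolP; exists id; split=> //.
by split=> //; rewrite image_id.
Qed.

Let iso_conj_symW f g : iso_conj f g -> iso_conj g f.
Proof.
move=> /asboolP[phi [[imphi isophi] fg]].
have [[p _] _] := set_mem (valP (\val f)).
have psiP y : exists x, M g y -> M f x /\ phi x = y.
  have [|ngy] := pselect (M g y); last by exists p.1.
  by rewrite -imphi => -[x fx <-]; exists x.
pose psi y := sval (cid (psiP y)).
have psiE y (gy : M g y) : M f (psi y) /\ phi (psi y) = y.
  exact: (svalP (cid (psiP y))) gy.
apply/asboolP; exists psi; split; last first.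
  move=> x y gx gy; have [fx ex] := psiE _ gx; have [fy ey] := psiE _ gy.
  by rewrite (fg _ _ fx fy) ex ey.
split; last first.
  move=> x y gx gy; have [fx ex] := psiE _ gx; have [fy ey] := psiE _ gy.
  by rewrite -isophi// ex ey.
apply/seteqP; split=> [_ [y /psiE[? _] <-]//|x fx].
have gx : M g (phi x) by rewrite -imphi; exists x.
exists (phi x) => //; apply: (@mdist_positivity R).
by have [fpx e] := psiE _ gx; rewrite -isophi// e mdistxx.
Qed.

Lemma iso_conj_sym : symmetric iso_conj.
Proof. by move=> f g; apply/idP/idP; exact: iso_conj_symW. Qed.

Lemma iso_conj_trans : transitive iso_conj.
Proof.
move=> g f h /asboolP[phi [[imphi isophi] fg]] /asboolP[psi [[impsi isopsi] gh]].
have Mphi x : M f x -> M g (phi x) by move=> fx; rewrite -imphi; exists x.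
apply/asboolP; exists (psi \o phi); split; last first.
  by move=> x y fx fy; rewrite fg// gh//; exact: Mphi.
split; first by rewrite -image_comp imphi impsi.
by move=> x y fx fy /=; rewrite isopsi ?isophi//; exact: Mphi.
Qed.

Canonical iso_conj_equiv :=
  EquivRel iso_conj iso_conj_refl iso_conj_sym iso_conj_trans.

Definition DS_Iso := quotient_topology {eq_quot iso_conj_equiv}.

End dynamical_systems.

(* The domain and codomain keep the topology of K; only the set of maps is
   given that of uniform convergence. *)
Definition homeo_group {R : realType} (K : metricType R) : Type :=
  set_type [set h : {uniform K -> K} |
    @homeomorphism K K [set: K] [set: K] h].

Section special_homeomorphism.
Context {R : realType} (K : metricType R).

HB.instance Definition _ := Topological.on (homeo_group K).

Definition homeo_fun (h : homeo_group K) : K -> K := \val h.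

Definition conj_class (h : homeo_group K) : set (homeo_group K) :=
  [set k | exists u : homeo_group K,
    homeo_fun k \o homeo_fun u = homeo_fun u \o homeo_fun h].

(* By the Baire category theorem at most one conjugacy class is a dense Gdelta,
   so this says that h lies in it. *)
Definition special (h : homeo_group K) :=
  dense (conj_class h) /\ Gdelta (conj_class h).

End special_homeomorphism.

Section theorem_set.
Context {R : realType} (V : metricType R).

(* All Cantor spaces are homeomorphic, so the choice of K is immaterial. *)
Definition conj_to_special (f : DS V) :=
  cantor_set (M f) /\
  exists F : V -> V,
    [/\ homeomorphism (M f) (M f) F,
        graph f = [set p | M f p.1 /\ p.2 = F p.1] &
        exists (K : metricType R) (h : homeo_group K) (phi : V -> K),
          [/\ cantor_set [set: K], special h,
              homeomorphism (M f) [set: K] phi &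
              forall x, M f x -> homeo_fun h (phi x) = phi (F x)]].

Definition DS_Iso_SH : set (DS_Iso V) :=
  [set \pi_(DS_Iso V) f | f in [set f : DS V | conj_to_special f]].

End theorem_set.

Arguments DS_Iso_SH {R} V _.

(* Main.v *)
(**
  A homeomorphism [h] of a Cantor space [K] is called rich if [K] has arbitrarily fine
  clopen partitions whose transition graph under [h] is a disjoint union of copies of one
  dumbbell (a cycle, a bar, a second cycle) whose cycle length has a prescribed divisor,
  and such that over each cycle there is a nonempty invariant clopen set.

  Two rich homeomorphisms are conjugate by a back-and-forth argument. A common dumbbell
  labelling of [h] and [h'] is refined for [h] by richness; to transport the refinement
  to [h'] one takes a much finer dumbbell partition for [h']. Up to a time shift, each of
  its components runs over a coarse dumbbell in one of three ways: crossing it, or winding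
  around one of its cycles. It can be mapped onto any component of the refinement of the
  same kind, and there are enough components of each kind because [K] is perfect and the
  invariant clopen sets keep splitting.

  Richness at a given scale is open, and dense among the homeomorphisms of [K] since every
  edge of a finite graph without dead ends lies on a walk that is eventually periodic in
  both directions. Hence, by Baire, the rich homeomorphisms form a dense Gdelta conjugacy
  class, and "special" means "rich". Richness of scale 1/m is moreover an open and
  isometry-invariant condition on an arbitrary closed relation, as is being 1/m-close to
  the graph of a bijection, so the isometry classes of the special systems form a Gdelta.
  For density, a system is approximated by a finite relation on a net, which is realized
  by a homeomorphism of a union of small Cantor sets, and that one by a rich one.
*)
Require Import Defs.
From HB Require Import structures.
From mathcomp Require Import all_boot all_order all_algebra.
From mathcomp Require Import generic_quotient.
From mathcomp Require Import all_classical all_reals all_analysis.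
From mathcomp Require Import borel_hierarchy.
From mathcomp Require Import zify lra.

Set Implicit Arguments.
Unset Strict Implicit.
Unset Printing Implicit Defensive.

Import Order.TTheory GRing.Theory Num.Theory.
Import numFieldTopology.Exports numFieldNormedType.Exports.

(** * Dumbbell graphs *)

Section dumbbell.
Local Open Scope ring_scope.
Variable N : nat.
Hypothesis N0 : (0 < N)%N.

(** Rigidity in time shapes the argument. Every edge of a dumbbell raises the vertex number by one
    modulo [N]. A winding walk may therefore be shifted by multiples of [N], but a crossing walk has
    no freedom, since it meets the vertex [N] at exactly one time. A component of one labelling can
    be laid over a component of another only if the shift imposed by the crossing time sends cycles
    into cycles. This forces the crossing time to lie deep inside the longer bar, which is achieved
    by labels fine enough to control many iterates of the map and of its inverse. The prescribed
    divisor of the cycle length makes long cycles wrap evenly around short ones.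

    A second constraint comes from the quotient: a Gdelta set of classes needs conditions that are,
    scale by scale, both open and invariant. Hence they are stated for relations, one scale at a
    time, and with a positive slack. *)

Definition phase (t : int) : nat := `|(t %% N)%Z|%N.

(* The dumbbell on the vertices 0, ..., 4N-1: a left cycle 0, ..., N-1, a bar, and a right
   cycle 3N, ..., 4N-1. *)
Definition dedge (a b : nat) : Prop :=
  (b = a.+1 /\ b < 4 * N)%N \/ (a.+1 = N /\ b = 0%N)
    \/ (a.+1 = 4 * N /\ b = 3 * N)%N.

(* The bi-infinite walk that crosses the dumbbell, leaving the left cycle at time N. *)
Definition clock (t : int) : nat :=
  if t < N%:Z then phase t
  else if t < (3 * N)%N%:Z then `|t|%N else (3 * N + phase t)%N.

Lemma phaseE t : (phase t)%:Z = (t %% N)%Z.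
Proof. by rewrite /phase gez0_abs// modz_ge0//; lia. Qed.

Lemma phase_lt t : (phase t < N)%N.
Proof. by have := phaseE t; have := @ltz_pmod t N; lia. Qed.

Lemma phaseDM t k : phase (t + k * N%:Z) = phase t.
Proof. by rewrite /phase addrC modzMDl. Qed.

Lemma phase_id t : 0 <= t < N%:Z -> phase t = `|t|%N.
Proof. by move=> /andP[t0 tN]; rewrite /phase modz_small// t0/=; lia. Qed.

Lemma phaseS t : ((phase t).+1 = N /\ phase (t + 1) = 0)%N \/
  ((phase t).+1 < N /\ phase (t + 1) = (phase t).+1)%N.
Proof.
have pE := phaseE t; have pl := phase_lt t.
have -> : phase (t + 1) = phase ((phase t)%:Z + 1).
  by rewrite [t in LHS](divz_eq t N%:Z) -pE -addrA addrC phaseDM.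
move: (phase t) pl => p pl.
have [e|ne] : (p.+1 = N)%N \/ (p.+1 < N)%N by lia.
  left; split => //; have -> : p%:Z + 1 = 0 + 1 * N%:Z by lia.
  by rewrite phaseDM phase_id; lia.
by right; split => //; rewrite phase_id; lia.
Qed.

Lemma clock_left t : t < N%:Z -> clock t = phase t.
Proof. by rewrite /clock => ->. Qed.

Lemma clock_right t : (3 * N)%N%:Z <= t -> clock t = (3 * N + phase t)%N.
Proof. by rewrite /clock => h; rewrite ifF ?ifF//; lia. Qed.

Lemma clock_id t : 0 <= t < (4 * N)%N%:Z -> clock t = `|t|%N.
Proof.
move=> /andP[t0 tN]; rewrite /clock; case: ifP => t1.
  by rewrite phase_id// t0.
case: ifP => // t2.
have -> : t = (t - 3 * N%:Z) + 3 * N%:Z by lia.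
by rewrite phaseDM phase_id; lia.
Qed.

Lemma clock_phase t : phase (clock t)%:Z = phase t.
Proof.
rewrite /clock; case: ifP => t1; first by rewrite phase_id; have := phase_lt t; lia.
case: ifP => t2; first by congr phase; lia.
have -> : (3 * N + phase t)%N%:Z = (phase t)%:Z + 3 * N%:Z by lia.
by rewrite phaseDM phase_id; have := phase_lt t; lia.
Qed.

Lemma clock_edge t : dedge (clock t) (clock (t + 1)).
Proof.
have pl := phase_lt t; have pS := phaseS t.
have [t1|t1] := ltP (t + 1) N%:Z.
  rewrite !clock_left//; last by lia.
  by move: (phase t) (phase (t + 1)) pl pS => a b; rewrite /dedge; lia.
have [t2|t2] := ltP t (3 * N)%N%:Z.
  by rewrite !clock_id /dedge; lia.
rewrite !clock_right//; last by lia.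
by move: (phase t) (phase (t + 1)) pl pS => a b; rewrite /dedge; lia.
Qed.

Lemma clock_lt t : (clock t < 4 * N)%N.
Proof. by have := phase_lt t; rewrite /clock; case: ifP => ?; [|case: ifP]; lia. Qed.

Lemma clockDM t (k : nat) : t + k%:Z * N%:Z < N%:Z -> clock (t + k%:Z * N%:Z) = clock t.
Proof. by move=> h; rewrite !clock_left ?phaseDM//; nia. Qed.

Lemma clockBM t (k : nat) : (3 * N)%N%:Z <= t -> clock (t + k%:Z * N%:Z) = clock t.
Proof. by move=> h; rewrite !clock_right ?phaseDM//; nia. Qed.

Lemma dedge_clock a b : dedge a b ->
  exists t : int, [/\ -1 <= t < (4 * N)%N%:Z, clock t = a & clock (t + 1) = b].
Proof.
move=> ab; have [aN|aN] := pselect (a.+1 = N /\ b = 0%N).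
  (* The edge that closes the left cycle is crossed at time -1, hence the lower bound in the range
     of [t]. *)
  exists (-1); split; [by lia| |by rewrite clock_id; lia].
  have -> : -1 = (N.-1)%:Z + -1 * N%:Z by lia.
  rewrite clock_left ?phaseDM ?phase_id; lia.
have [aM|aM] := pselect (a.+1 = (4 * N)%N /\ b = (3 * N)%N).
  exists a%:Z; split; [by lia|by rewrite clock_id; lia|].
  rewrite clock_right; last by lia.
  have -> : a%:Z + 1 = 0 + 4 * N%:Z by lia.
  by rewrite phaseDM phase_id; lia.
exists a%:Z; move: ab; rewrite /dedge => ab.
by split; [lia|rewrite clock_id; lia|rewrite clock_id; lia].
Qed.

(** The first vertex of the bar is visited only once, so it serves as a time marker for crossing
    walks. *)
Lemma clock_bar t : clock t = N -> t = N%:Z.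
Proof. by rewrite /clock; have := phase_lt t; case: ifP => ?; [|case: ifP]; lia. Qed.

(** Both cycles have length [N] and start at multiples of [N], so the vertex number modulo [N]
    advances like time. *)
Lemma dedge_phase a b : dedge a b -> phase b%:Z = phase (a%:Z + 1).
Proof.
case/dedge_clock => t [_ <- <-]; rewrite clock_phase.
have := phaseS (clock t)%:Z; have := phaseS t; rewrite clock_phase; lia.
Qed.

(* The walks on the dumbbell up to a time shift: crossing, or staying in the left or in
   the right cycle. *)
Definition line (s : nat) (t : int) : nat :=
  match s with 0 => clock t | 1 => phase t | _ => (3 * N + phase t)%N end.

Lemma line_congr s (a b : int) : (a = b %[mod N%:Z])%Z -> (0 < s)%N ->
  line s a = line s b.
Proof. by move: s => [|[|s]]// e _ /=; rewrite /phase e. Qed.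

(** The phase ties the walk to time. A walk through [N] is determined, because vertices up to [N]
    have one predecessor and vertices from [N] on have one successor. A walk avoiding [N] can
    neither leave the left cycle nor be in the bar, where it could be traced back to [N]. *)
Lemma walk_class (w : int -> nat) : (forall t, dedge (w t) (w (t + 1))) ->
  exists s b, (s < 3)%N /\ forall t, w t = line s (t + b).
Proof.
move=> wE.
have fwd (P : int -> Prop) t0 : P t0 -> (forall t, P t -> P (t + 1)) ->
    forall k : nat, P (t0 + k%:Z).
  move=> P0 PS; elim=> [|k IH]; first by rewrite addr0.
  by have -> : t0 + k.+1%:Z = t0 + k%:Z + 1; [lia|exact: PS].
have bwd (P : int -> Prop) t0 : P t0 -> (forall t, P (t + 1) -> P t) ->
    forall k : nat, P (t0 - k%:Z).
  move=> P0 PS; elim=> [|k IH]; first by rewrite subr0.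
  by apply: PS; have -> : t0 - k.+1%:Z + 1 = t0 - k%:Z by lia.
have all (P : int -> Prop) t0 : P t0 -> (forall t, P t -> P (t + 1)) ->
    (forall t, P (t + 1) -> P t) -> forall t, P t.
  move=> P0 PS PB t; have [t0t|tt0] := leP t0 t.
    by have -> : t = t0 + `|t - t0|%N%:Z; [lia|exact: fwd].
  by have -> : t = t0 - `|t - t0|%N%:Z; [lia|exact: bwd].
have wp : forall t, phase (w t) = phase (t + (w 0)%:Z).
  apply: (all _ 0) => [|t IH|t]; first by rewrite add0r.
    rewrite (dedge_phase (wE t)) addrAC; have := phaseS (w t)%:Z.
    have := phaseS (t + (w 0)%:Z); rewrite IH.
    by move: (phase _) (phase _) (phase _) => p q r; lia.
  rewrite (dedge_phase (wE t)) addrAC; have := phaseS (w t)%:Z.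
  have := phaseS (t + (w 0)%:Z).
  by move: (phase _) (phase _) (phase _) (phase _) => p q r v; lia.
have [[t0 wt0]|nobar] := pselect (exists t, w t = N).
  exists 0%N, (N%:Z - t0); split => //=.
  have f (k : nat) : w (t0 + k%:Z) = clock (N%:Z + k%:Z).
    elim: k => [|k IH]; first by rewrite !addr0 wt0 clock_id; lia.
    have := wE (t0 + k%:Z); have := clock_edge (N%:Z + k%:Z).
    rewrite IH -!addrA; have -> : (k%:Z + 1 = k.+1%:Z) by lia.
    suff : (N <= clock (N%:Z + k%:Z))%N.
      by move: (clock _) (clock _) (w _) => p q r; rewrite /dedge; lia.
    by rewrite /clock ifF; [case: ifP|]; lia.
  have g (k : nat) : w (t0 - k%:Z) = clock (N%:Z - k%:Z).
    elim: k => [|k IH]; first by rewrite !subr0 wt0 clock_id; lia.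
    have := wE (t0 - k.+1%:Z); have := clock_edge (N%:Z - k.+1%:Z).
    have -> : (t0 - k.+1%:Z + 1 = t0 - k%:Z) by lia.
    have -> : (N%:Z - k.+1%:Z + 1 = N%:Z - k%:Z) by lia.
    rewrite IH.
    suff : (clock (N%:Z - k%:Z) <= N)%N.
      by move: (clock _) (clock _) (w _) => p q r; rewrite /dedge; lia.
    rewrite /clock; case: ifP => h1; first by have := phase_lt (N%:Z - k%:Z); lia.
    by rewrite ifT; lia.
  move=> t; have [t0t|tt0] := leP t0 t.
    have -> : t = t0 + `|t - t0|%N%:Z by lia.
    by rewrite f; congr clock; lia.
  have -> : t = t0 - `|t - t0|%N%:Z by lia.
  by rewrite g; congr clock; lia.
have nb t : w t <> N by move=> e; apply: nobar; exists t.
have [[t1 wt1]|noleft] := pselect (exists t, (w t < N)%N).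
  exists 1%N, (w 0)%:Z; split=> //= t.
  suff lt : (w t < N)%N by rewrite -wp phase_id; lia.
  apply: (all (fun t => (w t < N)%N) t1) => // u.
    have := wE u; have := nb (u + 1).
    by move: (w _) (w _) => p q; rewrite /dedge; lia.
  by have := wE u; move: (w _) (w _) => p q; rewrite /dedge; lia.
exists 2%N, (w 0)%:Z; split=> //= t.
have nl u : (N < w u)%N.
  have : ~ (w u < N)%N by move=> h; apply: noleft; exists u.
  by have := nb u; lia.
have nm u : (3 * N <= w u)%N.
  rewrite leqNgt; apply/negP => lt.
  have [n] := ubnP (w u); elim: n => // n IH in u lt *.
  move=> wn; have := wE (u - 1); have := IH (u - 1).
  rewrite subrK; have := nl (u - 1); have := nl u.
  by move: (w _) (w _) lt wn => p q; rewrite /dedge; lia.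
have wl : (w t < 4 * N)%N.
  have := wE (t - 1); rewrite subrK.
  by move: (w _) (w _) => p q; rewrite /dedge; lia.
have := nm t; rewrite -wp; move: (w t) wl => p wl pl.
have -> : p%:Z = (p%:Z - 3 * N%:Z) + 3 * N%:Z by lia.
by rewrite phaseDM phase_id; lia.
Qed.

End dumbbell.

(** * Covering a short dumbbell by a longer one *)

Section cover.
Local Open Scope ring_scope.
Variables (N2 N3 : nat) (a : int).
Hypotheses (N20 : (0 < N2)%N) (N23 : (N2 %| N3)%N) (N2lt : (N2 < N3)%N).
Hypothesis aR : 3 * N2%:Z - 3 * N3%:Z <= a <= N2%:Z - N3%:Z.

(** The bounds on [a] put the left cycle of the long dumbbell before time [N2] and its right cycle
    from time [3 * N2] on, where [clock N2] has period [N2]. As [N2] divides [N3], the two closing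
    edges are then sent to edges. *)
Lemma cover_edge (t u : nat) : dedge N3 t u ->
  dedge N2 (clock N2 (t%:Z + a)) (clock N2 (u%:Z + a)).
Proof.
have [k kE] := dvdnP N23.
have kZ : N3%:Z = k%:Z * N2%:Z by rewrite kE; lia.
move=> [[-> _]|[[tN ->]|[tN ->]]].
- by have -> : t.+1%:Z + a = t%:Z + a + 1; [lia|exact: clock_edge].
- have -> : t%:Z + a = (a - 1) + k%:Z * N2%:Z by lia.
  rewrite clockDM//; last by lia.
  by have -> : 0%:Z + a = a - 1 + 1; [lia|exact: clock_edge].
- rewrite -(@clockBM N2 N20 ((3 * N3)%N%:Z + a) k); last by lia.
  by have -> : (3 * N3)%N%:Z + a + k%:Z * N2%:Z = t%:Z + a + 1; [lia|exact: clock_edge].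
Qed.

(** Every edge is crossed at some time from -1 to [4 * N2 - 1], and [N2 < N3] with the bounds on [a]
    keeps these times inside the shifted range of the long dumbbell. *)
Lemma cover_surj v w : dedge N2 v w -> exists t u : nat,
  [/\ dedge N3 t u, clock N2 (t%:Z + a) = v & clock N2 (u%:Z + a) = w].
Proof.
move=> /(dedge_clock N20)[t [tR <- <-]].
exists `|t - a|%N, `|t - a|.+1; split; [by rewrite /dedge; lia|congr clock; lia|congr clock; lia].
Qed.

End cover.

(** By the pigeonhole principle an orbit becomes periodic within [#|X|] steps, with a period
    dividing the factorial. The same [N] serves all maps and points, and [k.+1] supplies the
    prescribed divisor. *)
Lemma iter_fact_period (X : finType) (f : X -> X) (k : nat) (x : X) :
  let N := ((#|X|)`! * k.+1)%N in iter (N + N) f x = iter N f x.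
Proof.
move=> N.
have /injectivePn[i [j ij fij]] : ~~ injectiveb (fun i : 'I_#|X|.+1 => iter i f x).
  by apply/negP => /injectiveP /leq_card; rewrite card_ord ltnn.
wlog lij : i j ij fij / (i < j)%N.
  move=> H; have [lt|gt|/val_inj e] := ltngtP i j; first exact: (H i j).
    by apply: (H j i) => //; rewrite eq_sym.
  by rewrite e eqxx in ij.
have per t r : (i <= t)%N -> iter (t + r * (j - i)) f x = iter t f x.
  move=> it; elim: r => [|r IH]; first by rewrite addn0.
  have -> : (t + r.+1 * (j - i) = (t + r * (j - i) - i) + j)%N.
    by rewrite mulSn; move: (r * _)%N => q; lia.
  rewrite iterD -fij -iterD; rewrite subnK//; last by rewrite (leq_trans it)// leq_addr.
have /dvdnP[q qE] : (j - i %| N)%N.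
  by apply: dvdn_mulr; apply: dvdn_fact; have := ltn_ord j; lia.
rewrite {2}qE per//.
apply: (@leq_trans #|X|); first by have := ltn_ord j; lia.
apply: (@leq_trans (#|X|)`!); last by rewrite leq_pmulr.
by case: #|X| => // n; rewrite factS leq_pmulr// fact_gt0.
Qed.

(** * Metric compactness *)

Local Open Scope classical_set_scope.
Local Open Scope ring_scope.

Section metric_compactness.
Context {R : realType}.

Definition invS (n : nat) : R := n.+1%:R^-1.

Lemma invS_gt0 n : 0 < invS n.
Proof. by rewrite invr_gt0. Qed.

Lemma invS_small (e : R) : 0 < e -> exists n, invS n < e.
Proof.
move=> e0; exists (Num.truncn e^-1).
by rewrite invf_plt ?posrE// truncnS_gt.
Qed.

Lemma invS_le (m n : nat) : (m <= n)%N -> invS n <= invS m.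
Proof. by move=> mn; rewrite lef_pV2 ?posrE// ler_nat. Qed.

Definition seqcompact {V : metricType R} (A : set V) :=
  forall u : nat -> V, (forall n, A (u n)) ->
    exists2 l, A l & forall e : R, 0 < e -> forall N,
      exists2 n, (N <= n)%N & mdist (u n) l < e.

Lemma nbhs_mdistP {V : metricType R} (x : V) (U : set V) :
  nbhs x U <-> exists2 e : R, 0 < e & forall y, mdist x y < e -> U y.
Proof.
rewrite -filter_from_ballE; split=> -[e e0 eU]; exists e => //.
  by move=> y xy; apply: eU; rewrite ballEmdist.
by move=> y; rewrite ballEmdist; exact: eU.
Qed.

Lemma compact_seqcompact {V : metricType R} (A : set V) :
  compact A -> seqcompact A.
Proof.
move=> cA u uA.
have [|l [Al cl]] := cA (u @ \oo) _; first by exists 0%N => // n _ /=; exact: uA.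
exists l => // e e0 N.
have [] := cl (u @` [set n | (N <= n)%N]) (ball l e).
- by exists N => // n /= Nn; exists n.
- exact: nbhsx_ballx.
by move=> _ [[n /= Nn <-]]; rewrite ballEmdist /= metric_sym; exists n.
Qed.

Lemma seqcompact_net {V : metricType R} (A : set V) (e : R) :
  seqcompact A -> 0 < e -> exists s : seq V,
    (forall y, y \in s -> A y) /\
    forall x, A x -> exists2 y, y \in s & mdist x y < e.
Proof.
move=> cA e0; apply: contrapT => H.
have step (s : {s : seq V | forall y, y \in s -> A y}) :
    exists x, A x /\ forall y, y \in sval s -> e <= mdist x y.
  apply: contrapT => Hs; apply: H; exists (sval s); split; first exact: (svalP s).
  move=> x Ax; apply: contrapT => xs; apply: Hs; exists x; split=> // y ys.
  by rewrite leNgt; apply/negP => xy; apply: xs; exists y.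
have [f fP] := choice step.
have pf s : forall y, y \in f s :: sval s -> A y.
  by move=> y; rewrite inE => /orP[/eqP ->|]; [exact: (fP s).1|exact: (svalP s)].
pose g s : {s : seq V | forall y, y \in s -> A y} := exist _ _ (pf s).
have nilP : forall y, y \in ([::] : seq V) -> A y by [].
pose S n := iter n g (exist _ _ nilP).
have SP n m : (n < m)%N -> f (S n) \in sval (S m).
  elim: m => // m IH; rewrite ltnS leq_eqVlt => /orP[/eqP <-|/IH h];
    by rewrite /= inE ?eqxx// h orbT.
have [l Al lP] := cA (fun n => f (S n)) (fun n => (fP (S n)).1).
have [|n _ n1] := lP (e / 2) _ 0%N; first by lra.
have [|m nm m1] := lP (e / 2) _ n.+1; first by lra.
have := (fP (S m)).2 _ (SP _ _ nm); have := metric_triangle (f (S m)) l (f (S n)).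
by rewrite [mdist l _]metric_sym; lra.
Qed.

(** This is the Lebesgue number lemma, for a relation [Q] so that it yields uniform continuity as
    well as positive gaps between clopen pieces. *)
Lemma seqcompact_unif {V : metricType R} (A : set V) (Q : V -> V -> Prop) :
  seqcompact A ->
  (forall x, A x -> exists2 e : R, 0 < e &
     forall y z, A y -> A z -> mdist x y < e -> mdist x z < e -> Q y z) ->
  exists2 e : R, 0 < e & forall y z, A y -> A z -> mdist y z < e -> Q y z.
Proof.
move=> cA H; apply: contrapT => nQ.
have step (n : nat) : exists p : V * V,
    [/\ A p.1, A p.2, mdist p.1 p.2 < invS n & ~ Q p.1 p.2].
  apply: contrapT => h; apply: nQ; exists (invS n) => //; first exact: invS_gt0.
  move=> y z Ay Az yz.
  by apply: contrapT => nq; apply: h; exists (y, z).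
have [u uP] := choice step.
have [|l Al lP] := cA (fst \o u); first by move=> n; have [] := uP n.
have [e e0 eQ] := H l Al.
have [|N eN] := @invS_small (e / 2); first by lra.
have [|n Nn nl] := lP (e / 2) _ N; first by lra.
have [A1 A2 d12] := uP n; apply; apply: eQ => //; rewrite /= in nl.
  by rewrite metric_sym; lra.
have := metric_triangle l (u n).1 (u n).2; rewrite [mdist l (u n).1]metric_sym.
by have := invS_le Nn; lra.
Qed.

Definition mcontinuous_on {V W : metricType R} (A : set V) (f : V -> W) :=
  forall x, A x -> forall e : R, 0 < e -> exists2 r : R, 0 < r &
    forall y, A y -> mdist x y < r -> mdist (f x) (f y) < e.

Definition ucontinuous_on {V W : metricType R} (A : set V) (f : V -> W) :=
  forall e : R, 0 < e -> exists2 r : R, 0 < r &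
    forall x y, A x -> A y -> mdist x y < r -> mdist (f x) (f y) < e.

Lemma seqcompact_ucontinuous {V W : metricType R} (A : set V) (f : V -> W) :
  seqcompact A -> mcontinuous_on A f -> ucontinuous_on A f.
Proof.
move=> cA cf e e0.
apply: (seqcompact_unif (Q := fun y z => mdist (f y) (f z) < e)) cA _ => x Ax.
have [|r r0 rP] := cf x Ax (e / 2); first by lra.
exists r => // y z Ay Az xy xz.
have := metric_triangle (f y) (f x) (f z); rewrite [mdist (f y) (f x)]metric_sym.
by have := rP y Ay xy; have := rP z Az xz; lra.
Qed.

Lemma ucontinuous_on_mcontinuous {V W : metricType R} (A : set V) (f : V -> W) :
  ucontinuous_on A f -> mcontinuous_on A f.
Proof. by move=> uf x Ax e /uf[r r0 rP]; exists r => // y Ay; exact: rP. Qed.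

Lemma within_mcontinuousP {V W : metricType R} (A : set V) (f : V -> W) :
  {within A, continuous f} <-> mcontinuous_on A f.
Proof.
rewrite subspace_continuousP; split=> cf x Ax.
  move=> e e0; have := cf x Ax (ball (f x) e) (nbhsx_ballx _ _ e0).
  rewrite /= => /nbhs_mdistP[r r0 rP]; exists r => // y Ay xy.
  by have := rP y xy Ay; rewrite ballEmdist.
move=> U /nbhs_mdistP[e e0 eU]; have [r r0 rP] := cf x Ax e e0.
by apply/nbhs_mdistP; exists r => // y xy Ay; apply: eU; exact: rP.
Qed.

Lemma mcontinuousTP {V W : metricType R} (f : V -> W) :
  continuous f <-> mcontinuous_on [set: V] f.
Proof.
split=> cf.
  by apply/within_mcontinuousP; exact: continuous_subspaceT.
move=> x U /nbhs_mdistP[e e0 eU]; have [r r0 rP] := cf x I e e0.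
by apply/nbhs_mdistP; exists r => // y xy; apply: eU; exact: rP.
Qed.

Lemma perfect_metricP {V : metricType R} (A : set V) : perfect_set A <->
  closed A /\ forall x, A x -> forall e : R, 0 < e ->
    exists y, [/\ A y, y != x & mdist x y < e].
Proof.
split=> [[cA lA]|[cA H]]; split => //.
  move=> x; rewrite -{1}lA => lx e e0.
  have [y [yx Ay xy]] := lx _ (nbhsx_ballx x e e0).
  by exists y; split => //; rewrite ballEmdist in xy.
apply/seteqP; split=> x.
  rewrite [X in X x -> _]/limit_point /= => lx; apply: cA => U /lx[y [_ Ay Uy]].
  by exists y.
by move=> Ax U /nbhs_mdistP[e e0 eU]; have [y [Ay yx /eU Uy]] := H x Ax e e0; exists y.
Qed.

End metric_compactness.

(** * Zero-dimensional compact spaces *)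

(** The choice is made once per value of [r]; labels obtained in this way inherit local constancy
    from [r]. *)
Lemma factor_choice (A B C : Type) (r : A -> B) (Q : A -> C -> Prop) :
  (forall x, exists t, forall y, r y = r x -> Q y t) ->
  exists q : A -> C, (forall x, Q x (q x)) /\ forall x y, r x = r y -> q x = q y.
Proof.
move=> H.
have H' (b : {b : B | exists x, r x = b}) : exists t, forall y, r y = sval b -> Q y t.
  by have [x <-] := svalP b; exact: H.
have [f fP] := choice H'.
pose i x : {b : B | exists x, r x = b} := exist _ (r x) (ex_intro _ x erefl).
exists (f \o i); split=> [x|x y xy]; first exact: fP.
by congr f; exact: eq_exist.
Qed.

Lemma choice2 (A B : Type) (P Q : A -> B -> Prop) :
  (forall x, exists2 y, P x y & Q x y) ->
  exists f : A -> B, forall x, P x (f x) /\ Q x (f x).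
Proof.
move=> H; have H' x : exists y, P x y /\ Q x y by have [y] := H x; exists y.
by have [f fP] := choice H'; exists f.
Qed.

Section locally_constant.
Context {R : realType}.

Definition loc_const {V : metricType R} {T : Type} (c : V -> T) :=
  exists2 d : R, 0 < d & forall x y, mdist x y < d -> c x = c y.

Definition finer_than {V : metricType R} {T : Type} (e : R) (c : V -> T) :=
  forall x y, c x = c y -> mdist x y < e.

Definition zero_dim (V : metricType R) := forall e : R, 0 < e ->
  exists T (c : V -> T), loc_const c /\ finer_than e c.

Definition no_isolated (V : metricType R) := forall (x : V) (e : R), 0 < e ->
  exists2 y, y != x & mdist x y < e.

Lemma loc_const_comp {V : metricType R} {T T' : Type} (f : T -> T') (c : V -> T) :
  loc_const c -> loc_const (f \o c).
Proof. by move=> [d d0 cd]; exists d => // x y /cd /= ->. Qed.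

Lemma loc_const_pair {V : metricType R} {T T' : Type} (c : V -> T) (c' : V -> T') :
  loc_const c -> loc_const c' -> loc_const (fun x => (c x, c' x)).
Proof.
move=> [d d0 cd] [d' d'0 cd']; exists (Num.min d d'); first by rewrite lt_min d0.
by move=> x y; rewrite lt_min => /andP[/cd -> /cd' ->].
Qed.

Lemma loc_const_factor {V : metricType R} {T T' : Type} (c : V -> T) (c' : V -> T') :
  loc_const c -> (forall x y, c x = c y -> c' x = c' y) -> loc_const c'.
Proof. by move=> [d d0 cd] H; exists d => // x y /cd /H. Qed.

Lemma loc_const_fin {V : metricType R} {T : Type} (I : finType) (c : I -> V -> T) :
  (forall i, loc_const (c i)) -> loc_const (fun x => c^~ x).
Proof.
move=> H; have [d dP] := choice2 H.
exists (\big[Num.min/1]_i d i).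
  by apply: lt_bigmin => // i _; have [] := dP i.
move=> x y xy; apply: funext => i; have [_ h] := dP i; apply: h.
by apply: lt_le_trans xy _; exact: bigmin_le.
Qed.

(** * Chains of small steps and connectedness *)

Section chains.
Context {V : metricType R}.

(* Impredicative reachability: [y] lies in every set containing [x] that is closed under
   steps shorter than [d]. *)
Definition chain (d : R) (x y : V) := forall P : V -> Prop,
  P x -> (forall a b, P a -> mdist a b < d -> P b) -> P y.

Lemma chain_refl d x : chain d x x. Proof. by move=> P. Qed.

Lemma chain_trans d y x z : chain d x y -> chain d y z -> chain d x z.
Proof. by move=> xy yz P Px PS; apply: yz => //; exact: xy. Qed.

Lemma chain_step d x y : mdist x y < d -> chain d x y.
Proof. by move=> xy P Px PS; exact: PS xy. Qed.

Lemma chain_sym d x y : chain d x y -> chain d y x.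
Proof.
move=> xy; apply: (xy (fun z => chain d z x)); first exact: chain_refl.
by move=> a b ax ab; apply: chain_trans ax; apply: chain_step; rewrite metric_sym.
Qed.

Lemma chain_le d e x y : d <= e -> chain d x y -> chain e x y.
Proof.
move=> de xy P Px PS; apply: xy => // a b Pa ab; apply: PS Pa _.
exact: lt_le_trans de.
Qed.

Hypotheses (cV : seqcompact [set: V]) (tV : totally_disconnected [set: V]).

Lemma limit_chain (l z : V) (u : nat -> V) : (forall n, chain (invS n) l (u n)) ->
  (forall e : R, 0 < e -> forall N, exists2 n, (N <= n)%N & mdist (u n) z < e) ->
  forall d, 0 < d -> chain d l z.
Proof.
move=> lu uz d d0; have [N Nd] := invS_small d0.
have [n Nn unz] := uz d d0 N.
apply: (chain_trans (y := u n)); last exact: chain_step.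
by apply: chain_le (lu n); exact: le_trans (invS_le Nn) (ltW Nd).
Qed.

(** A proper relatively clopen part [B] would be separated from its complement by some [e]. A chain
    of short steps leaving [B] then stops at a distance between [e / 3] and [2 * (e / 3)] from [B];
    a cluster point of such stops lies in the set and within [e] of [B], hence in [B], but also away
    from [B]. *)
Lemma connected_chain (l : V) : connected [set z | forall d, 0 < d -> chain d l z].
Proof.
pose Q := [set z | forall d, 0 < d -> chain d l z]; rewrite -/Q.
move=> B [b Bb] [W oW BW] [C cC BC].
have Ql z (u : nat -> V) : (forall n, Q (u n)) ->
    (forall e : R, 0 < e -> forall N, exists2 n, (N <= n)%N & mdist (u n) z < e) -> Q z.
  by move=> uQ uz; apply: limit_chain uz => n; apply: uQ; exact: invS_gt0.
have cQ : seqcompact Q.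
  by move=> u uQ; have [//|z _ uz] := @cV u; exists z => //; exact: Ql uz.
have BQ : B `<=` Q by rewrite BW; exact: subIsetl.
have [|e e0 eP] := seqcompact_unif (Q := fun y z => B y -> B z) cQ.
  move=> x Qx; have [Bx|nBx] := pselect (B x).
    have : nbhs x W by apply: open_nbhs_nbhs; split => //; move: Bx; rewrite BW => -[].
    move=> /nbhs_mdistP[e e0 eW]; exists e => // y z Qy Qz _ /eW Wz _.
    by rewrite BW.
  have : nbhs x (~` C).
    apply: open_nbhs_nbhs; split; first exact: closed_openC.
    by move=> Cx; apply: nBx; rewrite BC.
  move=> /nbhs_mdistP[e e0 eO]; exists e => // y z _ _ /eO Cy _.
  by rewrite BC => -[_ /Cy].
apply/seteqP; split=> // b' Qb'; apply: contrapT => nBb'.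
have step (n : nat) : exists z, [/\ chain (invS n) b z,
    (exists2 a, B a & mdist a z < 2 * (e / 3)) & forall a, B a -> e / 3 <= mdist a z].
  apply: contrapT => nz.
  have ch : chain (Num.min (invS n) (e / 3)) b b'.
    have c0 : 0 < Num.min (invS n) (e / 3) by rewrite lt_min invS_gt0/=; lra.
    by apply: (chain_trans (y := l)); [apply: chain_sym; apply: (BQ b)|apply: Qb'].
  have [a Ba ab'] : exists2 a, B a & mdist a b' < e / 3; last first.
    by apply: nBb'; apply: (eP a) => //; [exact: BQ|lra].
  have := ch (fun y => chain (invS n) b y /\ exists2 a, B a & mdist a y < e / 3).
  case=> //; first by split; [exact: chain_refl|exists b => //; rewrite mdistxx; lra].
  move=> x y [bx [a Ba ax]]; rewrite lt_min => /andP[xy1 xy2].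
  have by_ : chain (invS n) b y by apply: chain_trans bx _; exact: chain_step.
  split => //; apply: contrapT => na; apply: nz; exists y; split => //.
    by exists a => //; have := metric_triangle a x y; lra.
  by move=> a' Ba'; rewrite leNgt; apply/negP => h; apply: na; exists a'.
have [u uP] := choice step.
have [//|z _ uz] := @cV u.
have Qz : Q z.
  move=> d d0; apply: (chain_trans (y := b)); first exact: (BQ b).
  by apply: limit_chain d0 => //; [move=> n; have [] := uP n|exact: uz].
have [|n _ nz] := uz (e / 3) _ 0%N; first by lra.
have [_ [a Ba an] far] := uP n.
have Bz : B z.
  apply: (eP a) => //; first exact: BQ.
  by have := metric_triangle a (u n) z; lra.
by have := far z Bz; rewrite metric_sym; lra.
Qed.

(** Otherwise pairs at distance at least [e], linked by ever shorter steps, cluster at two points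
    linked by all step lengths. These lie in one connected component, so they coincide. *)
Lemma chain_small (e : R) : 0 < e ->
  exists2 d, 0 < d & forall x y, chain d x y -> mdist x y < e.
Proof.
move=> e0; apply: contrapT => H.
have step n : exists p : V * V, chain (invS n) p.1 p.2 /\ e <= mdist p.1 p.2.
  apply: contrapT => h; apply: H; exists (invS n); first exact: invS_gt0.
  move=> x y xy; rewrite ltNge; apply/negP => exy.
  by apply: h; exists (x, y).
have [u uP] := choice step.
have [//|l _ lP] := @cV (fst \o u).
have [k kP] := choice2 (fun n => lP _ (invS_gt0 n) n).
have [//|m _ mP] := @cV (snd \o u \o k).
have lm : forall d, 0 < d -> chain d l m.
  apply: limit_chain mP => n /=.
  apply: (chain_trans (y := (u (k n)).1)).
    by apply: chain_step; rewrite metric_sym; have [] := kP n.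
  by apply: chain_le (uP (k n)).1; apply: invS_le; have [] := kP n.
have : connected_component [set: V] l m.
  by exists [set z | forall d, 0 < d -> chain d l z] => //; split => //;
    [move=> d _; exact: chain_refl|exact: connected_chain].
rewrite tV// => /= ml; rewrite ml in mP.
have [N Ne] : exists N, invS N < e / 2 by apply: invS_small; lra.
have [|n Nn nm] := mP (e / 2) _ N; first by lra.
rewrite /= in nm; have [_ /= kl] := kP n; have := @invS_le R _ _ Nn.
have := metric_triangle (u (k n)).1 l (u (k n)).2.
by have := (uP (k n)).2; rewrite [mdist l _]metric_sym; lra.
Qed.

Lemma totally_disconnected_zero_dim : zero_dim V.
Proof.
move=> e /chain_small[d d0 dP]; exists (set V), (chain d); split.
  exists d => // x y xy; apply/seteqP; split=> z /=; apply: chain_trans.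
    by apply: chain_step; rewrite metric_sym.
  exact: chain_step.
by move=> x y xy; apply: dP; rewrite xy; exact: chain_refl.
Qed.

End chains.

Lemma open_mball {V : metricType R} (x : V) (e : R) : open (ball x e).
Proof.
rewrite ballEmdist openE => y /= xy; apply/nbhs_mdistP.
exists (e - mdist x y); first by lra.
by move=> z yz /=; have := metric_triangle x y z; lra.
Qed.

(** A connected subset of [A] with two label values would be split by the open [d]-neighbourhoods of
    two of its parts. *)
Lemma cantor_set_intro {V : metricType R} (A : set V) : A !=set0 -> compact A ->
  (forall x, A x -> forall e : R, 0 < e -> exists y, [/\ A y, y != x & mdist x y < e]) ->
  (forall e : R, 0 < e -> exists T (c : V -> T),
     (exists2 d : R, 0 < d & forall x y, A x -> A y -> mdist x y < d -> c x = c y) /\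
     forall x y, A x -> A y -> c x = c y -> mdist x y < e) ->
  cantor_set A.
Proof.
move=> A0 cA pA zA; split => //.
  by apply/perfect_metricP; split => //; apply: compact_closed => //; exact: metric_hausdorff.
move=> x Ax; apply/seteqP; split=> [y [B [Bx BA cB] By]|_ ->]; last exact: connected_component_refl.
apply: contrapT => /eqP yx; have xy0 : 0 < mdist x y by rewrite mdist_gt0 eq_sym.
have [T [c [[d d0 cd] cm]]] := zA _ xy0.
pose N := \bigcup_(z in [set z | B z /\ c z = c x]) (ball z d).
pose N' := \bigcup_(z in [set z | B z /\ c z <> c x]) (ball z d).
have oN : open N by apply: bigcup_open => z _; exact: open_mball.
have oN' : open N' by apply: bigcup_open => z _; exact: open_mball.
have BN : B `&` N = B.
  apply: cB; first by exists x; split => //; exists x => //; exact: ballxx.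
    by exists N.
  exists (~` N'); first exact: open_closedC.
  apply/seteqP; split=> z [Bz].
    move=> [w [Bw cw]]; rewrite ballEmdist => /= wz; split=> //; case=> w' [Bw' cw'].
    rewrite ballEmdist => /= wz'; apply: cw'.
    by rewrite (cd w' z) -?(cd w z)//; exact: BA.
  move=> nz; split => //; exists z; last exact: ballxx.
  by split => //; apply: contrapT => cz; apply: nz; exists z => //; exact: ballxx.
have : (B `&` N) y by rewrite BN.
move=> [_ [w [Bw cw]]]; rewrite ballEmdist => /= wy.
have xyc : c x = c y by rewrite -cw; apply: cd => //; exact: BA.
by have := cm x y (BA _ Bx) (BA _ By) xyc; rewrite ltxx.
Qed.

End locally_constant.

(** * Maps between labelled Cantor spaces *)

(** Coding finite labels by numbers lets all stages of a back-and-forth share one label type. *)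
Definition fin_index (I : finType) (i : I) : nat := enum_rank i.

Lemma fin_index_inj (I : finType) : injective (@fin_index I).
Proof. by move=> i j /ord_inj /enum_rank_inj. Qed.

Section cantor_maps.
Context {R : realType} {K : metricType R}.
Hypothesis cK : seqcompact [set: K].

Definition same_image (T : Type) (c c' : K -> T) :=
  (forall x, exists y, c' y = c x) /\ (forall y, exists x, c x = c' y).

Definition uhomeo (u : K -> K) := exists v : K -> K,
  [/\ ucontinuous_on [set: K] u, ucontinuous_on [set: K] v,
      cancel u v & cancel v u].

Lemma finite_label (T : Type) (c : K -> T) : loc_const c ->
  exists (I : finType) (q : K -> I),
    (forall i, exists x, q x = i) /\ (forall x y, q x = q y <-> c x = c y).
Proof.
move=> [d d0 cd]; have [s [_ sP]] := seqcompact_net cK d0.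
have [rep [repc repE]] := @factor_choice K T K c (fun x y => c x = c y)
  (fun x => ex_intro _ x (fun y e => e)).
have reps x : rep x \in [seq rep y | y <- s].
  have [y ys xy] := sP x I; apply/mapP; exists y => //; apply: repE; exact: cd.
exists (seq_sub [seq rep y | y <- s]), (fun x => SeqSub (reps x)).
split=> [[z zs]|x y].
  by have /mapP[y ys zE] := zs; exists y; apply: val_inj.
split=> [[e]|xy]; first by rewrite (repc x) e -repc.
by apply: val_inj; exact: repE.
Qed.

(** The cells [c' n = c n x] are nonempty, closed and decreasing in [n], so compactness provides
    [u x]; fineness makes it unique. The inverse arises from the symmetric argument, hence
    [half]. *)
Lemma limit_homeo (T : Type) (c c' : nat -> K -> T) :
  (forall n, loc_const (c n)) -> (forall n, loc_const (c' n)) ->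
  (forall n, same_image (c n) (c' n)) ->
  (forall n x y, c n.+1 x = c' n.+1 y -> c n x = c' n y) ->
  (forall e : R, 0 < e -> exists n, finer_than e (c n)) ->
  (forall e : R, 0 < e -> exists n, finer_than e (c' n)) ->
  exists2 u, uhomeo u & forall n x, c' n (u x) = c n x.
Proof.
have half (d d' : nat -> K -> T) :
  (forall n, loc_const (d n)) -> (forall n, loc_const (d' n)) ->
  (forall n, same_image (d n) (d' n)) ->
  (forall n x y, d n.+1 x = d' n.+1 y -> d n x = d' n y) ->
  (forall e : R, 0 < e -> exists n, finer_than e (d' n)) ->
  exists2 u, ucontinuous_on [set: K] u & forall n x, d' n (u x) = d n x.
  move=> ld ld' dd' comp md'.
  have ex x : exists y, forall n, d' n y = d n x.
    have [u uP] := choice (fun n => (dd' n).1 x).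
    have upE n k : d' n (u (n + k)%N) = d n x.
      elim: k n => [|k IH] n; first by rewrite addn0.
      by apply/esym; apply: comp; rewrite addnS -addSn IH.
    have [//|y _ yP] := @cK u; exists y => n.
    have [e e0 eP] := ld' n; have [m nm my] := yP e e0 n.
    by rewrite -(eP _ _ my) -(subnKC nm).
  have [u uP] := choice ex; exists u => // e e0.
  have [n nP] := md' e e0; have [r r0 rP] := ld n.
  by exists r => // x y _ _ xy; apply: nP; rewrite !uP; exact: rP.
move=> lc lc' cc' comp mc mc'.
have [u uu uP] := half c c' lc lc' cc' comp mc'.
have [v uv vP] : exists2 v, ucontinuous_on [set: K] v & forall n y, c n (v y) = c' n y.
  apply: half => // [n|n x y e]; first by have [h1 h2] := cc' n; split.
  by apply/esym; apply: comp.
have eqP_ (d : nat -> K -> T) x y : (forall e : R, 0 < e -> exists n, finer_than e (d n)) ->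
    (forall n, d n x = d n y) -> x = y.
  move=> md xy; apply/eqP; apply: contraT; rewrite -mdist_gt0 => /md[n].
  by move=> /(_ x y (xy n)); rewrite ltxx.
exists u => //; exists v; split=> // x; [apply: (eqP_ c)|apply: (eqP_ c')] => // n.
  by rewrite vP uP.
by rewrite uP vP.
Qed.

Lemma back_and_forth (T : Type) (S : (K -> T) -> (K -> T) -> Prop) (c0 c0' : K -> T) :
  S c0 c0' ->
  (forall c c', S c c' -> [/\ loc_const c, loc_const c' & same_image c c']) ->
  (forall c c' (e : R), S c c' -> 0 < e -> exists d d', [/\ S d d',
     forall x y, d x = d' y -> c x = c' y & finer_than e d]) ->
  (forall c c' (e : R), S c c' -> 0 < e -> exists d d', [/\ S d d',
     forall x y, d x = d' y -> c x = c' y & finer_than e d']) ->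
  exists u, uhomeo u /\ exists c c' : nat -> K -> T,
    [/\ c 0%N = c0, c' 0%N = c0', forall n, S (c n) (c' n),
        forall n x, c' n (u x) = c n x &
        forall e : R, 0 < e -> exists n, finer_than e (c n) /\ finer_than e (c' n)].
Proof.
move=> S0 SP forth back.
have step (p : {p : (K -> T) * (K -> T) | S p.1 p.2} * nat) :
    exists q : {p : (K -> T) * (K -> T) | S p.1 p.2} * nat,
    [/\ q.2 = p.2.+1,
      forall x y, (sval q.1).1 x = (sval q.1).2 y -> (sval p.1).1 x = (sval p.1).2 y,
      finer_than (invS p.2) (sval q.1).1 & finer_than (invS p.2) (sval q.1).2].
  case: p => -[[c c'] /= Scc'] n /=.
  have [d [d' [Sd dc md]]] := forth c c' _ Scc' (invS_gt0 n).
  have [g [g' [Sg gd mg]]] := back d d' _ Sd (invS_gt0 n).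
  have [_ _ [gg' g'g]] := SP _ _ Sg.
  exists (exist (fun p => S p.1 p.2) (g, g') Sg, n.+1); split => //= [x y /gd/dc//|x y xy].
  (* The backward refinement keeps the fineness of [d]: points with equal [g] share a partner [z],
     through which their [d] labels agree. *)
  apply: md; have [z zE] := gg' x.
  by rewrite (gd x z) ?zE// (gd y z) ?zE.
have [f fP] := choice step.
pose st n := iter n f (exist (fun p => S p.1 p.2) (c0, c0') S0, 0%N).
have st2 n : (st n).2 = n by elim: n => //= n IH; have [-> _ _ _] := fP (st n); rewrite IH.
pose c n := (sval (st n).1).1; pose c' n := (sval (st n).1).2.
have Sc n : S (c n) (c' n) by exact: (svalP (st n).1).
have fin e : 0 < e -> exists n, finer_than e (c n) /\ finer_than e (c' n).
  move=> /invS_small[n ne]; exists n.+1.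
  have [_ _ m m'] := fP (st n); rewrite st2 in m m'.
  by split=> x y xy; apply: lt_trans ne; [exact: m|exact: m'].
have [||||||u uu uP] := @limit_homeo T c c'.
- by move=> n; have [] := SP _ _ (Sc n).
- by move=> n; have [] := SP _ _ (Sc n).
- by move=> n; have [] := SP _ _ (Sc n).
- by move=> n x y; have [_ h _ _] := fP (st n); exact: h.
- by move=> e /fin[n [? _]]; exists n.
- by move=> e /fin[n [_ ?]]; exists n.
by exists u; split => //; exists c, c'; split.
Qed.

Hypotheses (zK : zero_dim K) (pK : no_isolated K).

Lemma avoid_seq (x : K) (e : R) (s : seq K) : 0 < e ->
  exists2 y, y \notin s & mdist x y < e.
Proof.
move=> e0; suff [y [r [r0 xy ys]]] : exists y r, [/\ 0 < r, mdist x y + r <= e &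
    forall z, z \in s -> r <= mdist y z].
  exists y; last by lra.
  by apply/negP => /ys; rewrite mdistxx; lra.
elim: s => [|z s [y [r [r0 xyr ys]]]].
  by exists x, e; split; rewrite ?mdistxx//; lra.
have [zy|zy] := eqVneq y z; last first.
  exists y, (Num.min r (mdist y z)); split.
  - by rewrite lt_min r0 mdist_gt0.
  - have : Num.min r (mdist y z) <= r by rewrite ge_min lexx.
    by lra.
  - by move=> w; rewrite inE ge_min => /orP[/eqP ->|/ys ->]; rewrite ?lexx ?orbT.
have [y' y'y yy'] := pK y r0.
have yy'0 : 0 < mdist y y' by rewrite mdist_gt0 eq_sym.
pose t := Num.min (r - mdist y y') (mdist y y').
have t0 : 0 < t by rewrite lt_min yy'0 andbT; lra.
have t1 : t <= r - mdist y y' by rewrite ge_min lexx.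
have t2 : t <= mdist y y' by rewrite ge_min lexx orbT.
exists y', t; split => // [|w].
  by have := metric_triangle x y y'; lra.
rewrite inE -zy => /orP[/eqP ->|/ys h]; first by rewrite metric_sym.
by have := metric_triangle y y' w; lra.
Qed.

(** Without isolated points there are distinct [a i] with [p (a i) = lam i]. A partition fine enough
    to separate them gives the cell of [a i] the label [i], and the remaining cells any admissible
    label. *)
Lemma split_label (X : Type) (p : K -> X) (I : finType) (lam : I -> X) :
  loc_const p -> (forall i, exists x, p x = lam i) -> (forall x, exists i, lam i = p x) ->
  exists q : K -> I, [/\ loc_const q, forall x, lam (q x) = p x & forall i, exists x, q x = i].
Proof.
move=> [d d0 pd] lamp plam.
have [a [ap ainj]] : exists a : I -> K, (forall i, p (a i) = lam i) /\ injective a.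
  suff [a [ap ainj]] : exists a : I -> K, (forall i, p (a i) = lam i) /\
      {in enum I &, injective a}.
    by exists a; split => // i j; apply: ainj; rewrite mem_enum.
  elim: (enum I) (enum_uniq I) => [_|i s IH /= /andP[is_ us]].
    by have [a aP] := choice lamp; exists a.
  have [a [ap ainj]] := IH us; have [x xp] := lamp i.
  have [y ys xy] := avoid_seq x [seq a j | j <- s] d0.
  exists (fun j => if j == i then y else a j); split=> [j|j k].
    by case: eqP => [->|//]; rewrite -(pd _ _ xy).
  rewrite !inE; case: eqP => [-> _|ji /= js]; case: eqP => [-> _|ki /= ks] //.
  - by move=> e; case/negP: ys; rewrite e map_f.
  - by move=> e; case/negP: ys; rewrite -e map_f.
  - exact: ainj.
pose D (ij : I * I) : R := if ij.1 == ij.2 then 1 else mdist (a ij.1) (a ij.2).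
pose e := Num.min d (\big[Num.min/1]_ij D ij).
have e0 : 0 < e.
  rewrite lt_min d0; apply: lt_bigmin => // -[i j] _; rewrite /D /=.
  by case: eqVneq => // ij; rewrite mdist_gt0; apply: contra_neq ij; exact: ainj.
have [T [r [lr mr]]] := zK e0.
have rp x y : r x = r y -> p x = p y.
  by move=> /mr xy; apply: pd; apply: lt_le_trans xy _; rewrite ge_min lexx.
have ra i j : r (a i) = r (a j) -> i = j.
  move=> /mr h; apply/eqP; apply: contraT => ij.
  have : e <= D (i, j) by rewrite ge_min bigmin_le// orbT.
  by rewrite /D /= (negbTE ij); lra.
have [|q [qP qr]] := @factor_choice K T I r
   (fun x i => lam i = p x /\ forall j, r (a j) = r x -> i = j).
  move=> x; have [[i ix]|nx] := pselect (exists i, r (a i) = r x).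
    exists i => y yx; split; first by rewrite -ap; apply: rp; rewrite ix.
    by move=> j jy; apply: ra; rewrite ix -yx.
  have [i ix] := plam x; exists i => y yx; split; first by rewrite ix; apply: rp.
  by move=> j jy; case: nx; exists j; rewrite jy.
exists q; split=> [|x|i]; first exact: loc_const_factor lr qr.
  by have [] := qP x.
by exists (a i); have [_ h] := qP (a i); exact: h.
Qed.

(** Only one side is made fine; the other imitates it, each cell of [c'] being split into as many
    nonempty pieces as the corresponding cell of [c]. *)
Lemma refine_labels (c c' : K -> nat) (e : R) : loc_const c -> loc_const c' ->
  same_image c c' -> 0 < e ->
  exists d d' : K -> nat, [/\ loc_const d, loc_const d', same_image d d',
    forall x y, d x = d' y -> c x = c' y & finer_than e d].
Proof.
move=> lc lc' [cc' c'c] e0; have [T [r [lr mr]]] := zK e0.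
have [I [q [qs qE]]] := finite_label (loc_const_pair lc lr).
have [lam lamP] : exists lam : I -> nat, forall x, lam (q x) = c x.
  have [a aP] := choice qs; exists (c \o a) => x /=.
  by have /qE[] := aP (q x).
have [q' [lq' q'c' q's]] : exists q' : K -> I,
    [/\ loc_const q', forall x, lam (q' x) = c' x & forall i, exists x, q' x = i].
  apply: split_label => // [i|x].
    by have [x <-] := qs i; rewrite lamP; have [y yx] := cc' x; exists y.
  by have [y <-] := c'c x; exists (q y).
exists (@fin_index I \o q), (@fin_index I \o q'); split.
- apply: loc_const_comp; apply: loc_const_factor (loc_const_pair lc lr) _.
  by move=> x y; apply qE.
- exact: loc_const_comp.
- by split=> x; [have [y yE] := q's (q x)|have [y yE] := qs (q' x)];
    exists y; rewrite /= yE.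
- by move=> x y /= /fin_index_inj xy; rewrite -lamP -q'c' xy.
- by move=> x y /= /fin_index_inj /qE[_]; exact: mr.
Qed.

(** This is the uniqueness of the Cantor set relative to a clopen partition. *)
Lemma match_labels (X : Type) (p p' : K -> X) : loc_const p -> loc_const p' ->
  same_image p p' -> exists2 u, uhomeo u & forall x, p' (u x) = p x.
Proof.
move=> lp lp' [pp' p'p].
have [I [q [qs qE]]] := finite_label lp.
have [a aP] := choice qs.
have pE x : p (a (q x)) = p x by apply qE.
have [q' [lq' q'p q's]] : exists q' : K -> I,
    [/\ loc_const q', forall x, p (a (q' x)) = p' x & forall i, exists x, q' x = i].
  apply: (@split_label X p' I (p \o a)) => // [i|x]; first exact: pp'.
  by have [y <-] := p'p x; exists (q y); exact: pE.
pose S (c c' : K -> nat) := [/\ loc_const c, loc_const c', same_image c c' &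
  forall x y, c x = c' y -> p x = p' y].
have [|c c' []//|c c' e [lc lc' cc' cp] e0|c c' e [lc lc' [c1 c2] cp] e0|] :=
   @back_and_forth nat S (@fin_index I \o q) (@fin_index I \o q').
- split.
  + by apply: loc_const_comp; apply: loc_const_factor lp _ => x y; apply qE.
  + exact: loc_const_comp.
  + by split=> x; [have [y yE] := q's (q x)|have [y yE] := qs (q' x)];
      exists y; rewrite /= yE.
  + by move=> x y /= /fin_index_inj xy; rewrite -pE -q'p xy.
- have [d [d' [ld ld' dd' dc md]]] := refine_labels lc lc' cc' e0.
  by exists d, d'; split => //; split => // x y /dc; exact: cp.
- have [d [d' [ld ld' [d1 d2] dc md]]] := refine_labels lc' lc (conj c2 c1) e0.
  exists d', d; split => //; last by move=> x y /esym/dc/esym.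
  by split => // x y /esym/dc/esym; exact: cp.
move=> u [uu [c [c' [c0 c0' Sc cu _]]]]; exists u => // x.
by have [_ _ _ h] := Sc 0%N; apply/esym; apply: h; rewrite cu.
Qed.

Lemma realize_relation (I : finType) (E : I -> I -> Prop) (p : K -> I) :
  loc_const p -> (forall i, exists x, p x = i) ->
  (forall i, exists j, E i j) -> (forall j, exists i, E i j) ->
  exists h, [/\ uhomeo h, forall x, E (p x) (p (h x)) &
    forall i j, E i j -> exists x, p x = i /\ p (h x) = j].
Proof.
move=> lp ps E1 E2; pose J := {ij : I * I | `[< E ij.1 ij.2 >]}.
have mkJ i j : E i j -> exists2 k : J, (val k).1 = i & (val k).2 = j.
  by move=> ij; exists (exist _ (i, j) (asboolT ij)).
have [q [lq qp qs]] : exists q : K -> J,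
    [/\ loc_const q, forall x, (val (q x)).1 = p x & forall k, exists x, q x = k].
  apply: (@split_label I p J (fun k => (val k).1)) => // x.
  by have [j /mkJ[k <- _]] := E1 (p x); exists k.
have [q' [lq' q'p q's]] : exists q : K -> J,
    [/\ loc_const q, forall x, (val (q x)).2 = p x & forall k, exists x, q x = k].
  apply: (@split_label I p J (fun k => (val k).2)) => // x.
  by have [j /mkJ[k _ <-]] := E2 (p x); exists k.
have [|u uu uE] := match_labels lq lq'.
  by split=> x; [have [y yE] := q's (q x)|have [y yE] := qs (q' x)]; exists y.
exists u; split => // [x|i j /mkJ[k <- <-]].
  by rewrite -(qp x) -(q'p (u x)) uE; exact: (asboolW (valP (q x))).
by have [x xk] := qs k; exists x; rewrite -qp -q'p uE xk.
Qed.

End cantor_maps.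

(** * Homeomorphisms with rich dumbbell labellings *)

Definition uedge (n N : nat) (v w : nat * nat) : Prop :=
  [/\ (v.1 < n)%N, w.1 = v.1 & dedge N v.2 w.2].

Lemma uedge_clock n N j t : (0 < N)%N -> (j < n)%N ->
  uedge n N (j, clock N t) (j, clock N (t + 1)).
Proof. by move=> N0 jn; split => //; exact: clock_edge. Qed.

Lemma uedge_lt n N v w : uedge n N v w ->
  [/\ (v.1 < n)%N, (v.2 < 4 * N)%N, (w.1 < n)%N & (w.2 < 4 * N)%N].
Proof. by move=> [vn wv]; rewrite /dedge wv => h; split => //; lia. Qed.

Section dumbbell_labels.
Context {R : realType} {K : metricType R}.

Definition exact_label (T : Type) (h : K -> K) (E : T -> T -> Prop) (c : K -> T) :=
  (forall x, E (c x) (c (h x))) /\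
  forall v w, E v w -> exists x, c x = v /\ c (h x) = w.

Definition dumbbell (h : K -> K) (n N : nat) (c : K -> nat * nat) :=
  [/\ (0 < N)%N, loc_const c & exact_label h (uedge n N) c].

Definition on_side (N : nat) (right : bool) (t : nat) : bool :=
  if right then (3 * N <= t)%N else (t < N)%N.

Definition loops (h : K -> K) (n N : nat) (c : K -> nat * nat) :=
  forall i, (i < n)%N -> forall right : bool, exists U : K -> bool,
  [/\ loc_const U, forall x, U (h x) = U x, exists x, U x &
      forall x, U x -> (c x).1 = i /\ on_side N right (c x).2].

(* Modelled on the characterization of the special homeomorphism by Bernardes and Darji. *)
Definition rich (h : K -> K) := forall (e : R) (m : nat), 0 < e -> (0 < m)%N ->
  exists n N c, [/\ dumbbell h n N c, loops h n N c, (m %| N)%N & finer_than e c].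

Lemma dumbbell_lt h n N c x : dumbbell h n N c -> ((c x).1 < n)%N /\ ((c x).2 < 4 * N)%N.
Proof. by move=> [_ _ [cE _]]; have [] := uedge_lt (cE x). Qed.

Lemma dumbbell_cell h n N c j t : dumbbell h n N c -> (j < n)%N ->
  exists x, c x = (j, clock N t) /\ c (h x) = (j, clock N (t + 1)).
Proof. by move=> [N0 _ [_ cS]] jn; apply: cS; exact: uedge_clock. Qed.

(** Invariance carries the value of [U] along the path from vertex 0 through all vertices of a
    component. *)
Lemma invariant_comp (T : Type) h n N c (U : K -> T) : dumbbell h n N c ->
  (forall x, U (h x) = U x) -> (forall x y, c x = c y -> U x = U y) ->
  forall x y, (c x).1 = (c y).1 -> U x = U y.
Proof.
move=> dc Uh cU x y xy; have [N0 _ _] := dc.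
have [xn _] := dumbbell_lt x dc.
have [z [zE _]] := dumbbell_cell 0 dc xn.
suff H w : (c w).1 = (c x).1 -> U w = U z by rewrite (H x)// (H y).
have [_] := dumbbell_lt w dc.
have : exists a, (c w).2 = a by exists (c w).2.
move=> [a]; elim: a => [|a IH] in w *.
  move=> wa _ wx; apply: cU; rewrite zE (surjective_pairing (c w)) wa wx clock_id//.
  by lia.
move=> wa; rewrite wa => aN wx.
have [v [vE hvE]] := dumbbell_cell a%:Z dc xn.
rewrite !clock_id in vE hvE; [|lia..].
rewrite -(IH v); [|by rewrite vE /=; lia|by rewrite vE /=; lia|by rewrite vE].
rewrite -(Uh v); apply: cU; rewrite hvE (surjective_pairing (c w)) wa wx.
by congr pair; lia.
Qed.

Definition comp_class (N N2 : nat) (rho : nat * nat -> nat * nat) (j : nat)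
    (i s : nat) (b : int) :=
  forall t, rho (j, clock N2 t) = (i, line N s (t + b)).

Lemma classify_comp h n N c n2 N2 d rho : dumbbell h n N c -> dumbbell h n2 N2 d ->
  (forall x, rho (d x) = c x) -> forall j, (j < n2)%N ->
  exists i s b, [/\ (i < n)%N, (s < 3)%N & comp_class N N2 rho j i s b].
Proof.
move=> dc dd rd j jn; have [N0 _ [cE _]] := dc.
pose w t := (rho (j, clock N2 t)).2.
have E t : uedge n N (rho (j, clock N2 t)) (rho (j, clock N2 (t + 1))).
  by have [x [<- <-]] := dumbbell_cell t dd jn; rewrite !rd.
have [|s [b [s3 wE]]] := @walk_class N N0 w; first by move=> t; have [] := E t.
exists (rho (j, clock N2 0)).1, s, b; split => //; first by have [] := E 0.
move=> t; rewrite [LHS]surjective_pairing -/(w t) wE; congr pair.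
have H (u : int) : (rho (j, clock N2 (u + 1))).1 = (rho (j, clock N2 u)).1 by have [] := E u.
have [k [->|->]] : exists k : nat, t = k%:Z \/ t = - k%:Z by exists `|t|%N; lia.
  elim: k => // k <-; have := H k%:Z.
  by have -> : k%:Z + 1 = k.+1%:Z by lia.
elim: k => // k <-; have := H (- k.+1%:Z).
by have -> : - k.+1%:Z + 1 = - k%:Z; [lia|move=> ->].
Qed.

Lemma line_inj_side N s i t : (0 < N)%N -> (s < 3)%N -> (i < 3)%N -> (0 < i)%N ->
  on_side N (i != 1%N) (line N s t) -> s = 0%N \/ s = i.
Proof.
move=> N0; have := phase_lt N0 t; case: s => [|[|[|s]]]// h _; case: i => [|[|[|i]]]//= _ _;
  rewrite /on_side/=; lia.
Qed.

Lemma bar_class N s t : (0 < N)%N -> line N s t = N -> s = 0%N /\ t = N%:Z.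
Proof.
move=> N0; case: s => [/(clock_bar N0)//|[|s]] /=; have := phase_lt N0 t; lia.
Qed.

(** An invariant clopen set splits without end. In a fine rich labelling the component of the last
    point has two disjoint loops; that point is replaced by one point in each loop, told apart by
    the invariant label [2 * iota + L]. *)
Lemma invariant_points h (U : K -> bool) : rich h ->
  loc_const U -> (forall x, U (h x) = U x) -> (exists x, U x) ->
  forall k, exists (iota : K -> nat) (p : nat -> K), [/\ loc_const iota,
    forall x, iota (h x) = iota x, forall q, U (p q) &
    forall q r, (q <= k)%N -> (r <= k)%N -> iota (p q) = iota (p r) -> q = r].
Proof.
move=> rh lU Uh [x0 Ux0]; elim=> [|k [iota [p [li ih Up pi]]]].
  exists (fun=> 0%N), (fun=> x0); split => //; first by exists 1.
  by move=> q r; lia.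
have [e e0 eP] := loc_const_pair lU li.
have [n [N [c [dc lc _ mc]]]] := rh e 1%N e0 isT.
have cU x y : c x = c y -> U x = U y by move=> /mc/eP[].
have ci x y : c x = c y -> iota x = iota y by move=> /mc/eP[].
have [jn _] := dumbbell_lt (p k) dc; have [N0 _ _] := dc.
have [L [lL Lh [y Ly] Lc]] := lc _ jn false.
have [L' [lL' Lh' [z Lz] Lc']] := lc _ jn true.
have [yj yN] := Lc _ Ly; have [zj zN] := Lc' _ Lz.
have nLz : L z = false.
  by apply/negP => /Lc[_]; move: zN; rewrite /on_side; lia.
have iy : iota y = iota (p k) by apply: (invariant_comp dc ih ci).
have iz : iota z = iota (p k) by apply: (invariant_comp dc ih ci).
have Uy : U y by rewrite (invariant_comp dc Uh cU yj).
have Uz : U z by rewrite (invariant_comp dc Uh cU zj).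
exists (fun x => (2 * iota x + L x)%N).
exists (fun q => if (q < k)%N then p q else if q == k then y else z); split.
- exact: (loc_const_comp (fun v : nat * bool => (2 * v.1 + v.2)%N) (loc_const_pair li lL)).
- by move=> x; rewrite ih Lh.
- by move=> q; case: ifP => // _; case: ifP.
move=> q r qk rk.
have Ly' : L y = true by [].
have half a b (s t : bool) : (2 * a + s = 2 * b + t)%N -> a = b /\ s = t.
  by case: s t => -[]; lia.
case: ltnP => qk'; case: ltnP => rk' /half[].
- by move=> e1 _; apply: pi e1; lia.
- move=> e1 _; have : iota (p q) = iota (p k) by rewrite e1; case: ifP.
  by move=> /pi; lia.
- move=> e1 _; have : iota (p k) = iota (p r) by rewrite -e1; case: ifP.
  by move=> /pi; lia.
move=> _; case: eqVneq => qE; case: eqVneq => rE; rewrite ?Ly' ?nLz//; lia.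
Qed.

(** These points ensure enough components of each class in any fine labelling [d]. For crossings
    they are distinct points of the cell [(i, N)]: two of them in one component would sit at the
    same crossing time, hence in one small cell. For windings they are taken in a loop, separated by
    an invariant label. *)
Lemma class_points h n N c i s k : no_isolated K -> rich h ->
  dumbbell h n N c -> loops h n N c -> (i < n)%N -> (s < 3)%N ->
  exists (p : nat -> K) (e : R), 0 < e /\
    forall n3 N3 d rho, dumbbell h n3 N3 d -> finer_than e d ->
    (forall x, rho (d x) = c x) ->
    (forall q, (q <= k)%N -> forall i' s' b, (s' < 3)%N ->
       comp_class N N3 rho (d (p q)).1 i' s' b -> i' = i /\ s' = s) /\
    (forall q r, (q <= k)%N -> (r <= k)%N -> (d (p q)).1 = (d (p r)).1 -> q = r).
Proof.
move=> pK rh dc lc i_n s3; have [N0 [dl dl0 dlP] [cE cS]] := dc.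
have [->|s0] := eqVneq s 0%N.
  have [x [xN _]] := dumbbell_cell N%:Z dc i_n; rewrite (clock_id N0) in xN; last by lia.
  have [p [pd pi]] : exists p : nat -> K, (forall q, mdist x (p q) < dl) /\
      forall q r, (q <= k)%N -> (r <= k)%N -> p q = p r -> q = r.
    elim: k => [|k [p [pd pi]]].
      by exists (fun=> x); split=> [q|q r]; [rewrite mdistxx|lia].
    have [y ys xy] := avoid_seq pK x [seq p q | q <- iota 0 k.+1] dl0.
    have yp q : (q <= k)%N -> p q <> y.
      by move=> qk e; move/negP: ys; apply; rewrite -e map_f// mem_iota; lia.
    exists (fun q => if (q <= k)%N then p q else y); split=> [q|q r]; first by case: ifP.
    case: (leqP q k) => qk; case: (leqP r k) => rk h1 h2; first exact: pi.
    - by move=> /yp; case.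
    - by move=> /esym /yp; case.
    - by lia.
  have pc q : c (p q) = (i, N).
    by rewrite -xN; apply/esym; exact: dlP.
  pose D (qr : 'I_k.+1 * 'I_k.+1) : R :=
    if qr.1 == qr.2 then 1 else mdist (p qr.1) (p qr.2).
  have D0 : 0 < \big[Num.min/1]_qr D qr.
    apply: lt_bigmin => // -[q r] _; rewrite /D /=; case: eqVneq => // qr.
    rewrite mdist_gt0; apply: contra_neq qr => /pi qr; apply: val_inj; apply: qr;
      by rewrite -ltnS ltn_ord.
  exists p, (\big[Num.min/1]_qr D qr); split=> // n3 N3 d rho dd md rd.
  have bar q i' s' b : comp_class N N3 rho (d (p q)).1 i' s' b ->
      [/\ i' = i, s' = 0%N & ((d (p q)).2)%:Z + b = N%:Z].
    have [N30 _ _] := dd; move=> /(_ ((d (p q)).2)%:Z); rewrite (clock_id N30); last first.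
      by have [] := dumbbell_lt (p q) dd; lia.
    rewrite absz_nat -surjective_pairing rd pc => -[-> /esym/(bar_class N0)[-> ->]].
    by [].
  split=> [q qk i' s' b _ /bar[]//|q r qk rk qr].
  have [jn _] := dumbbell_lt (p q) dd.
  have [i' [s' [b [_ _ cl]]]] := classify_comp dc dd rd jn.
  have [_ _ e1] := bar _ _ _ _ cl; rewrite qr in cl; have [_ _ e2] := bar _ _ _ _ cl.
  have /md : d (p q) = d (p r).
    by rewrite (surjective_pairing (d (p q))) (surjective_pairing (d (p r))) qr;
      congr pair; lia.
  have [qr'|qr'] := eqVneq q r; first by [].
  have : \big[Num.min/1]_qr D qr <= D (inord q, inord r) by exact: bigmin_le.
  have neq : (@inord k q == inord r) = false.
    by apply/negP => /eqP /(congr1 val); rewrite /= !inordK; [move/eqP: qr'|lia|lia].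
  by rewrite /D /= neq !inordK ?ltnS// => h1 /(le_lt_trans h1); rewrite ltxx.
have [U [lU Uh Ux Uc]] := lc i i_n (s != 1%N).
have [iota [p [li ih Up pi]]] := invariant_points rh lU Uh Ux k.
have [e e0 eP] := loc_const_pair lU li.
exists p, e; split => // n3 N3 d rho dd md rd.
have dU x y : d x = d y -> U x = U y by move=> /md/eP[].
have di x y : d x = d y -> iota x = iota y by move=> /md/eP[].
split=> [q qk i' s' b s'3 cl|q r qk rk qr]; last first.
  by apply: pi => //; exact: (invariant_comp dd ih di).
have UU t : (rho ((d (p q)).1, clock N3 t)).1 = i /\
    on_side N (s != 1%N) (rho ((d (p q)).1, clock N3 t)).2.
  have [jn _] := dumbbell_lt (p q) dd.
  have [x [xE _]] := dumbbell_cell t dd jn.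
  rewrite -xE rd; apply: Uc.
  by rewrite (invariant_comp dd Uh dU (y := p q))// xE.
split; first by have [] := UU 0; rewrite cl.
have sd t : on_side N (s != 1%N) (line N s' t).
  by have [_] := UU (t - b); rewrite cl /= subrK.
have [s'0|//] : s' = 0%N \/ s' = s by apply: (line_inj_side N0 s'3 s3 _ (sd 0)); lia.
(* A crossing walk would pass the vertex [N], which lies on neither side. *)
have := sd N%:Z; rewrite s'0 /= (clock_id N0); last by lia.
by rewrite /on_side absz_nat; case: ifP; lia.
Qed.

End dumbbell_labels.

(** * Refinement of labellings *)

Lemma factor_fun (A B C : Type) (r : A -> B) (c : A -> C) (c0 : C) :
  (forall x y, r x = r y -> c x = c y) -> exists rho : B -> C, forall x, rho (r x) = c x.
Proof.
move=> H; have ex (b : B) : exists t, forall x, r x = b -> c x = t.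
  have [[x <-]|nx] := pselect (exists x, r x = b); first by exists (c x) => y /H.
  by exists c0 => x xb; case: nx; exists x.
by have [rho rhoP] := choice ex; exists rho => x; rewrite -(rhoP (r x) x).
Qed.

Section refinement.
Context {R : realType} {K : metricType R}.

Lemma loc_const_ucontinuous (T : Type) (h : K -> K) (c : K -> T) :
  ucontinuous_on [set: K] h -> loc_const c -> loc_const (c \o h).
Proof.
by move=> uh [d d0 cd]; have [r r0 rP] := uh d d0; exists r => // x y xy; apply: cd; exact: rP.
Qed.

Lemma loc_const_iter (T : Type) (h : K -> K) (c : K -> T) (M : nat) :
  ucontinuous_on [set: K] h -> loc_const c ->
  loc_const (fun x (k : 'I_M.+1) => c (iter k h x)).
Proof.
move=> uh lc; apply: loc_const_fin => -[k kM] /=.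
elim: k {kM} => [|k IH]; first exact: lc.
have -> : (fun x => c (iter k.+1 h x)) = (fun x => c (iter k h x)) \o h.
  by apply: funext => x; rewrite iterSr.
exact: loc_const_ucontinuous.
Qed.

(* Membership of [f^k x] in [P] depends only on the cell of [x], so [P] can be pulled
   back along the path [v] to the common first cell and pushed forward along [w]. *)
Lemma path_transport (T : Type) (f : K -> K) (E : T -> T -> Prop) (c : K -> T)
    (P : K -> Prop) (M : nat) :
  (forall v w, E v w -> exists x, c x = v /\ c (f x) = w) ->
  (forall k x y, (k <= M)%N -> c x = c y -> P (iter k f x) -> P (iter k f y)) ->
  forall (v w : nat -> T) r, (r <= M)%N -> v 0%N = w 0%N ->
  (forall k, E (v k) (v k.+1)) -> (forall k, E (w k) (w k.+1)) ->
  (forall x, c x = v r -> P x) -> forall x, c x = w r -> P x.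
Proof.
move=> ES sat v w r rM vw0 vE wE vP.
have A j : (j <= r)%N -> forall x, c x = v (r - j)%N -> P (iter j f x).
  elim: j => [|j IH] jr x xv; first by apply: vP; rewrite xv subn0.
  have [z [zv fz]] := ES _ _ (vE (r - j.+1)%N).
  apply: (sat _ z); [by lia|by rewrite zv|rewrite iterSr; apply: IH; first by lia].
  by rewrite fz; congr v; lia.
have B j : (j <= r)%N -> forall x, c x = w j -> P (iter (r - j) f x).
  elim: j => [|j IH] jr x xw.
    by apply: A; rewrite ?subn0// subnn vw0.
  have [z [zw fz]] := ES _ _ (wE j).
  apply: (sat _ (f z)); [by lia|by rewrite fz|rewrite -iterSr].
  by have -> : (r - j.+1).+1 = (r - j)%N; [lia|apply: IH => //; lia].
by move=> x xw; have := B r (leqnn r) x xw; rewrite subnn.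
Qed.

(** If the crossing time came at most [M] steps after the left branching vertex, then, cells of [d]
    determining [M] iterates, as many steps around the left cycle would also lead to the label [N],
    at a second time. The right end is symmetric, with the inverse map. *)
Lemma bar_depth (h g : K -> K) n N (c : K -> nat * nat) n3 N3 d rho i j b (M : nat) : cancel h g -> cancel g h ->
  dumbbell h n N c -> dumbbell h n3 N3 d -> (forall x, rho (d x) = c x) ->
  (j < n3)%N -> comp_class N N3 rho j i 0 b ->
  (forall k x y, (k <= M)%N -> d x = d y -> c (iter k h x) = c (iter k h y)) ->
  (forall k x y, (k <= M)%N -> d x = d y -> c (iter k g x) = c (iter k g y)) ->
  N3%:Z + M%:Z <= N%:Z - b <= 3 * N3%:Z - M%:Z.
Proof.
move=> hg gh [N0 _ _] dd rd jn cl sh sg; have [N30 _ [dE dS]] := dd.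
have bar t : clock N (t + b) = N -> t = N%:Z - b by move=> /(clock_bar N0); lia.
have cN : clock N (N%:Z - b + b) = N by rewrite subrK (clock_id N0); lia.
have same t u : clock N3 t = clock N3 u -> clock N (t + b) = N -> u = N%:Z - b.
  by move=> tu tN; apply: bar; have := cl t; rewrite tu cl => -[->].
have t1 : N3%:Z <= N%:Z - b.
  rewrite leNgt; apply/negP => lt.
  have e := @clockDM N3 N30 (N%:Z - b - N3%:Z) 1; rewrite mul1r subrK in e.
  by have := same _ _ (e lt) cN; lia.
have t2 : N%:Z - b < 3 * N3%:Z.
  rewrite ltNge; apply/negP => lt.
  have e := @clockBM N3 N30 (N%:Z - b) 1; rewrite mul1r in e.
  by have := same _ _ (esym (e _)) cN; lia.
have cell t x : d x = (j, clock N3 t) -> c x = (i, clock N (t + b)).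
  by rewrite -rd => ->; exact: cl.
apply/andP; split; rewrite leNgt; apply/negP => lt.
(* Both paths start at the last vertex of the left cycle, which [clock N3] visits at times -1 and
   [N3 - 1]; [v] enters the bar and [w] goes around. *)
- pose r := `|(N%:Z - b - N3%:Z + 1)%R|%N.
  have [x [xw _]] := dumbbell_cell (-1 + r%:Z) dd jn.
  suff : c x = (i, N) by rewrite (cell _ _ xw) => -[/bar]; lia.
  apply: (path_transport (f := h) (E := uedge n3 N3) (c := d)
    (P := fun x => c x = (i, N)) (M := M) _ _
    (v := fun k => (j, clock N3 (N3%:Z - 1 + k%:Z)))
    (w := fun k => (j, clock N3 (-1 + k%:Z))) (r := r)) => //.
  + by move=> k y z kM yz; rewrite (sh k y z).
  + by rewrite /r; lia.
  + have := @clockDM N3 N30 (-1) 1; rewrite mul1r !addr0 => <-; last by lia.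
    by congr (_, clock _ _); lia.
  + move=> k; have -> : N3%:Z - 1 + k.+1%:Z = N3%:Z - 1 + k%:Z + 1 by lia.
    exact: uedge_clock.
  + move=> k; have -> : -1 + k.+1%:Z = -1 + k%:Z + 1 by lia.
    exact: uedge_clock.
  + by move=> y /cell ->; rewrite -[in RHS]cN; congr (_, clock _ _); rewrite /r; lia.
- pose r := `|(3 * N3%:Z - (N%:Z - b))%R|%N.
  have [x [xw _]] := dumbbell_cell (4 * N3%:Z - r%:Z) dd jn.
  suff : c x = (i, N) by rewrite (cell _ _ xw) => -[/bar]; lia.
  apply: (path_transport (f := g) (E := fun v w => uedge n3 N3 w v) (c := d)
    (P := fun x => c x = (i, N)) (M := M) _ _
    (v := fun k => (j, clock N3 (3 * N3%:Z - k%:Z)))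
    (w := fun k => (j, clock N3 (4 * N3%:Z - k%:Z))) (r := r)) => //.
  + by move=> v w /dS[y [yw hy]]; exists (h y); rewrite hg.
  + by move=> k y z kM yz; rewrite (sg k y z).
  + by rewrite /r; lia.
  + have := @clockBM N3 N30 (3 * N3%:Z) 1; rewrite mul1r !subr0 => <-; last by lia.
    by congr (_, clock _ _); lia.
  + move=> k; have -> : 3 * N3%:Z - k%:Z = 3 * N3%:Z - k.+1%:Z + 1 by lia.
    exact: uedge_clock.
  + move=> k; have -> : 4 * N3%:Z - k%:Z = 4 * N3%:Z - k.+1%:Z + 1 by lia.
    exact: uedge_clock.
  + by move=> y /cell ->; rewrite -[in RHS]cN; congr (_, clock _ _); rewrite /r; lia.
Qed.

(** For winding classes only the residue of [a] modulo [N] matters, and the admissible window has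
    length at least [N]. For crossings [a] must be [b3 - b2], and the depth [4 * N2] exceeds any
    possible crossing time of the short dumbbell. *)
Lemma class_offset N N2 N3 s (b2 b3 : int) : (0 < N)%N -> (4 * N2 + N <= N3)%N ->
  (s = 0%N -> 0 <= N%:Z - b2 <= 4 * N2%:Z /\
     N3%:Z + 4 * N2%:Z <= N%:Z - b3 <= 3 * N3%:Z - 4 * N2%:Z) ->
  exists2 a : int, 3 * N2%:Z - 3 * N3%:Z <= a <= N2%:Z - N3%:Z &
    forall t, line N s (t + a + b2) = line N s (t + b3).
Proof.
move=> N0 NN; have [->|s0] := posnP s => H.
  have [//|H1 H2] := H; exists (b3 - b2); first by lia.
  by move=> t /=; congr clock; lia.
pose a0 := N2%:Z - N3%:Z - (b3 - b2).
have m1 : 0 <= (a0 %% N%:Z)%Z by rewrite modz_ge0//; lia.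
have m2 : (a0 %% N%:Z)%Z < N%:Z by rewrite ltz_pmod//; lia.
exists (N2%:Z - N3%:Z - (a0 %% N%:Z)%Z); first by lia.
move=> t; apply: line_congr => //.
have e := divz_eq a0 N%:Z.
have -> : t + (N2%:Z - N3%:Z - (a0 %% N%:Z)%Z) + b2 = (a0 %/ N%:Z)%Z * N%:Z + (t + b3).
  by move: e; rewrite {1}/a0; lia.
by rewrite modzMDl.
Qed.

Definition stage (h h' : K -> K) (n N : nat) (c c' : K -> nat * nat) :=
  [/\ dumbbell h n N c, loops h n N c, dumbbell h' n N c' & loops h' n N c'].

(** The delicate point is that every component of [d] must be used. The points [P (i, s) j] lie in
    distinct components of [d3] of class [(i, s)]; the component of [P (i, s) j] is reserved for [j]
    whenever [j] has that class, and every other component goes to any [j] of its own class. *)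
Lemma stage_refine (h h' : K -> K) n N c c' (e : R) : no_isolated K -> uhomeo h' ->
  rich h -> rich h' -> stage h h' n N c c' -> 0 < e ->
  uhomeo h -> K -> exists n2 N2 d d', [/\ stage h h' n2 N2 d d',
    forall x y, d x = d' y -> c x = c' y & finer_than e d].
Proof.
move=> pK [g' [uh' ug' hg' gh']] rh rh' [dc lc dc' lc'] e0 [g [uh ug hg gh]] x0.
have [N0 [dl dl0 dlP] _] := dc; have [_ lc'0 _] := dc'.
have [dl' dl'0 dl'P] := lc'0.
have minP (n0 : nat) (f : 'I_n0 * 'I_3 -> R) : (forall k, 0 < f k) ->
    exists2 m, 0 < m & forall k, m <= f k.
  move=> f0; exists (\big[Num.min/1]_k f k); last by move=> k; exact: bigmin_le.
  by apply: lt_bigmin.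
(* One point per class suffices here: it shows that [d] has a component of each class. *)
have [p1 p1P] := choice (fun k : 'I_n * 'I_3 =>
  class_points 0 pK rh dc lc (ltn_ord k.1) (ltn_ord k.2)).
have [e1 e1P] := choice p1P.
have [m1 m10 m1P] := minP n e1 (fun k => (e1P k).1).
have [n2 [N2 [d [dd ld _ md]]]] := rh (Num.min e (Num.min dl m1)) 1%N
  ltac:(by rewrite !lt_min e0 dl0 m10) isT.
have dlt x y : d x = d y -> [/\ mdist x y < e, mdist x y < dl & mdist x y < m1].
  by move=> /md; rewrite !lt_min => /and3P.
have [N20 ld0 _] := dd.
have [rho rd] : exists rho : nat * nat -> nat * nat, forall x, rho (d x) = c x.
  by apply: factor_fun (0%N, 0%N) _ => x y /dlt[_ /dlP].
have clS j : (j < n2)%N -> exists i s b, [/\ (i < n)%N, (s < 3)%N & comp_class N N2 rho j i s b].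
  exact: classify_comp dc dd rd j.
have has_class i s : (i < n)%N -> (s < 3)%N -> exists j b,
    (j < n2)%N /\ comp_class N N2 rho j i s b.
  move=> i_n s3; pose k : 'I_n * 'I_3 := (Ordinal i_n, Ordinal s3).
  have md1 : finer_than (e1 k) d.
    by move=> x y /dlt[_ _ xy]; exact: lt_le_trans xy (m1P k).
  have [H _] := (e1P k).2 _ _ _ _ dd md1 rd.
  have [jn _] := dumbbell_lt (p1 k 0%N) dd.
  have [i' [s' [b [_ s'3 cl']]]] := clS _ jn.
  have [ii ss] := H 0%N isT _ _ _ s'3 cl'; rewrite /= in ii ss.
  by exists (d (p1 k 0%N)).1, b; split => //; rewrite -ii -ss.
have [p2 p2P] := choice (fun k : 'I_n * 'I_3 =>
  class_points n2 pK rh' dc' lc' (ltn_ord k.1) (ltn_ord k.2)).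
have [e2 e2P] := choice p2P.
have [m2 m20 m2P] := minP n e2 (fun k => (e2P k).1).
pose M := (4 * N2)%N.
have [r3 r30 r3P] := loc_const_iter M uh' lc'0.
have [r4 r40 r4P] := loc_const_iter M ug' lc'0.
(* Divisibility by this number gives both [N2 %| N3] and the lower bound [4 * N2 + N <= N3]. *)
have [n3 [N3 [d3 [dd3 ld3 N23 md3]]]] := rh' (Num.min dl' (Num.min m2 (Num.min r3 r4)))
  (N2 * (5 + N))%N ltac:(by rewrite !lt_min dl'0 m20 r30) ltac:(by lia).
have d3P x y : d3 x = d3 y -> [/\ mdist x y < dl', mdist x y < m2, mdist x y < r3 & mdist x y < r4].
  by move=> /md3; rewrite !lt_min => /and4P.
have [N30 ld30 _] := dd3.
have N3N : (4 * N2 + N <= N3)%N.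
  by have := dvdn_leq N30 N23; nia.
have [rho' rd'] : exists rho : nat * nat -> nat * nat, forall x, rho (d3 x) = c' x.
  by apply: factor_fun (0%N, 0%N) _ => x y /d3P[/dl'P].
pose good (k : nat * nat) (p : nat -> K) :=
    (forall q, (q <= n2)%N -> forall i' s' b, (s' < 3)%N ->
       comp_class N N3 rho' (d3 (p q)).1 i' s' b -> i' = k.1 /\ s' = k.2) /\
    (forall q r, (q <= n2)%N -> (r <= n2)%N -> (d3 (p q)).1 = (d3 (p r)).1 -> q = r).
have ex (k : nat * nat) : exists p, (k.1 < n)%N -> (k.2 < 3)%N -> good k p.
  case: k => i s /=.
  have [i_n|ni] := boolP (i < n)%N; last by exists (fun=> x0).
  have [s3|ns] := boolP (s < 3)%N; last by exists (fun=> x0).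
  exists (p2 (Ordinal i_n, Ordinal s3)) => _ _.
  apply: (e2P (Ordinal i_n, Ordinal s3)).2 dd3 _ rd' => x y /d3P[_ xy _ _].
  exact: lt_le_trans xy (m2P _).
have [P PP] := choice ex.
have asg (j3 : nat) : exists ja : nat * int, (j3 < n3)%N ->
   [/\ (ja.1 < n2)%N, 3 * N2%:Z - 3 * N3%:Z <= ja.2 <= N2%:Z - N3%:Z,
     forall t, rho (ja.1, clock N2 (t + ja.2)) = rho' (j3, clock N3 t) &
     forall j i s b, (j < n2)%N -> (i < n)%N -> (s < 3)%N -> comp_class N N2 rho j i s b ->
       (d3 (P (i, s) j)).1 = j3 -> j = ja.1].
  have [j3n|] := boolP (j3 < n3)%N; last by exists (0%N, 0).
  have [i [s [b3 [i_n s3 cl3]]]] := classify_comp dc' dd3 rd' j3n.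
  have [j [b2 [jn cl2 jP]]] : exists j b2, [/\ (j < n2)%N, comp_class N N2 rho j i s b2 &
      forall j' i' s' b', (j' < n2)%N -> (i' < n)%N -> (s' < 3)%N ->
        comp_class N N2 rho j' i' s' b' -> (d3 (P (i', s') j')).1 = j3 -> j' = j].
    have same j' i' s' : (j' < n2)%N -> (i' < n)%N -> (s' < 3)%N ->
        (d3 (P (i', s') j')).1 = j3 -> i = i' /\ s = s'.
      move=> j'n i'n s'3 e'; have [H _] := PP (i', s') i'n s'3.
      by apply: (H j' (ltnW j'n) i s b3 s3); rewrite e'.
    have [[j [b2 [jn cl2 jj3]]]|nj] := pselect (exists j b2,
        [/\ (j < n2)%N, comp_class N N2 rho j i s b2 & (d3 (P (i, s) j)).1 = j3]).
      exists j, b2; split => // j' i' s' b' j'n i'n s'3 _ e'.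
      have [ii ss] := same _ _ _ j'n i'n s'3 e'; rewrite -ii -ss in e'.
      have [_ H] := PP (i, s) i_n s3; apply: H; [exact: ltnW|exact: ltnW|].
      by rewrite e' jj3.
    have [j [b2 [jn cl2]]] := has_class i s i_n s3.
    exists j, b2; split => // j' i' s' b' j'n i'n s'3 cl' e'; case: nj.
    have [ii ss] := same _ _ _ j'n i'n s'3 e'.
    by exists j', b'; rewrite ii ss.
  have [|a aR aE] := @class_offset N N2 N3 s b2 b3 N0 N3N.
    move=> s0; rewrite s0 in cl2 cl3; split.
      have sat f k x y : (k <= 0)%N -> d x = d y -> c (iter k f x) = c (iter k f y).
        by rewrite leqn0 => /eqP -> /dlt[_ /dlP].
      have := bar_depth hg gh dc dd rd jn cl2 (sat h) (sat g); lia.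
    have sat' k x y : (k <= M)%N -> d3 x = d3 y ->
        c' (iter k h' x) = c' (iter k h' y) /\ c' (iter k g' x) = c' (iter k g' y).
      rewrite -ltnS => kM /d3P[_ _ /r3P xy3 /r4P xy4].
      by split; [have := congr1 (@^~ (Ordinal kM)) xy3|have := congr1 (@^~ (Ordinal kM)) xy4].
    have := bar_depth hg' gh' dc' dd3 rd' j3n cl3
      (fun k x y kM xy => (sat' k x y kM xy).1) (fun k x y kM xy => (sat' k x y kM xy).2).
    by rewrite /M; lia.
  exists (j, a) => _; split => //= t.
  by rewrite cl2 cl3 aE.
have [fa faP] := choice asg.
pose d' y := ((fa (d3 y).1).1, clock N2 ((d3 y).2%:Z + (fa (d3 y).1).2)).
have fsurj j : (j < n2)%N -> exists2 j3, (j3 < n3)%N & (fa j3).1 = j.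
  move=> jn; have [i [s [b [i_n s3 cl]]]] := clS j jn.
  have [j3n _] := dumbbell_lt (P (i, s) j) dd3.
  exists (d3 (P (i, s) j)).1 => //.
  by have [_ _ _ H] := faP _ j3n; rewrite -(H _ _ _ _ jn i_n s3 cl erefl).
have N2N3 : (N2 %| N3)%N by apply: dvdn_trans N23; exact: dvdn_mulr.
have N2lt : (N2 < N3)%N by lia.
have [d3E d3S] : exact_label h' (uedge n3 N3) d3 by have [] := dd3.
exists n2, N2, d, d'; split => [|x y xy|x y /dlt[]//]; last first.
  rewrite -rd xy /d'; have [yn y4] := dumbbell_lt y dd3.
  have [_ _ -> _] := faP _ yn.
  by rewrite (clock_id N30) ?absz_nat -?surjective_pairing ?rd'//; lia.
split => //.
  split => //; first by apply: loc_const_factor ld30 _ => x y; rewrite /d' => ->.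
  split=> [x|[j v2] [j' w2] [/= jn -> vw]].
    have [xn e1' xe] := d3E x; have [f1 f2 _ _] := faP _ xn.
    by split; rewrite /d' /= ?e1'//; exact: (cover_edge N20 N2N3 N2lt f2 xe).
  have [j3 j3n fj] := fsurj j jn; have [_ f2 _ _] := faP _ j3n.
  have [t [u [tu tv uw]]] := cover_surj N20 N2N3 N2lt f2 vw.
  have [x [xt xu]] := d3S (j3, t) (j3, u) (And3 j3n erefl tu).
  by exists x; rewrite /d' xt xu /= fj tv uw.
move=> j jn right; have [j3 j3n fj] := fsurj j jn; have [_ f2 _ _] := faP _ j3n.
have [U [lU Uh Ux Uc]] := ld3 j3 j3n right.
exists U; split => // x /Uc[xj xs]; rewrite /d' /= xj fj; split => //.
move: xs; rewrite /on_side; case: right {Uc} => h3.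
  by rewrite clock_right//; [rewrite leq_addr|lia].
by rewrite clock_left//; [exact: phase_lt|lia].
Qed.

End refinement.

(** * Conjugacy *)

Section conjugacy.
Context {R : realType} {K : metricType R}.

Lemma base_stage (h : K -> K) : rich h -> K ->
  exists c, dumbbell h 1 1 c /\ loops h 1 1 c.
Proof.
move=> rh x0; have [n [N [d [dd ld _ _]]]] := rh 1 1%N ltr01 isT.
have [n0 _] := dumbbell_lt x0 dd; have [N0 ld0 [dE dS]] := dd.
(* The dumbbell with [N = 1] is a quotient of every other: [g] collapses the left cycle to 0 and
   everything from [N.+2] on to 3. *)
pose g (t : nat) := minn 3 (t.+1 - N).
exists (fun x => (0%N, g (d x).2)); split; last first.
  move=> [|//] _ right; have [U [lU Uh Ux Uc]] := ld _ n0 right.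
  by exists U; split => // x /Uc[_]; rewrite /on_side /g; case: right {Uc} => h1 /=;
    split => //; lia.
split => //; first by apply: loc_const_factor ld0 _ => x y ->.
split=> [x|[j v] [j' w] [/= j0 -> vw]].
  by have [_ _ xE] := dE x; split => //=; move: xE; rewrite /dedge /g; lia.
have real t u : dedge N t u -> g t = v -> g u = w ->
    exists x, (0%N, g (d x).2) = (j, v) /\ (0%N, g (d (h x)).2) = (j, w).
  move=> tu gt gu; have [x [xt xu]] := dS (0%N, t) (0%N, u) (And3 (leq_ltn_trans (leq0n _) n0) erefl tu).
  by exists x; rewrite xt xu /= gt gu; have -> : j = 0%N by lia.
have : [\/ v = 0 /\ w = 0, (v = 0 /\ w = 1) \/ (v = 1 /\ w = 2), v = 2 /\ w = 3 | v = 3 /\ w = 3]%N.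
  have [e|ne] := eqVneq v 0%N; last first.
    by have [e|ne'] := eqVneq v 1%N; [apply: Or42|have [e|ne''] := eqVneq v 2%N;
      [apply: Or43|apply: Or44]]; move: vw; rewrite /dedge; lia.
  by have [e'|ne'] := eqVneq w 0%N; [apply: Or41|apply: Or42]; move: vw; rewrite /dedge; lia.
case=> [[v0 w0]|[[v0 w0]|[v0 w0]]|[v0 w0]|[v0 w0]].
- by apply: (real N.-1 0%N); rewrite /dedge /g; lia.
- by apply: (real N.-1 N); rewrite /dedge /g; lia.
- by apply: (real N N.+1); rewrite /dedge /g; lia.
- by apply: (real N.+1 N.+2); rewrite /dedge /g; lia.
- by apply: (real (4 * N).-1 (3 * N)%N); rewrite /dedge /g; lia.
Qed.

Lemma stage_same_image (h h' : K -> K) n N c c' : stage h h' n N c c' -> same_image c c'.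
Proof.
move=> [[_ _ [cE cS]] _ [_ _ [c'E c'S]] _].
by split=> x; [have [y []] := c'S _ _ (cE x)|have [y []] := cS _ _ (c'E x)]; exists y.
Qed.

Lemma stage_sym (h h' : K -> K) n N c c' : stage h h' n N c c' -> stage h' h n N c' c.
Proof. by case. Qed.

Lemma rich_conjugate (h h' : K -> K) : seqcompact [set: K] -> zero_dim K ->
  no_isolated K -> uhomeo h -> uhomeo h' -> rich h -> rich h' -> K ->
  exists2 u, uhomeo u & forall x, h' (u x) = u (h x).
Proof.
move=> cK zK pK uh uh' rh rh' x0.
have [c0 [dc0 lc0]] := base_stage rh x0; have [c0' [dc0' lc0']] := base_stage rh' x0.
pose S c c' := exists n N, stage h h' n N c c'.
have [|c c' [n [N st]]|c c' e [n [N st]] e0|c c' e [n [N st]] e0|] :=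
  @back_and_forth R K cK _ S c0 c0'.
- by exists 1%N, 1%N.
- have [[_ lc _] _ [_ lc' _] _] := st; split => //; exact: stage_same_image st.
- have [n2 [N2 [d [d' [st' dc fd]]]]] := stage_refine pK uh' rh rh' st e0 uh x0.
  by exists d, d'; split => //; exists n2, N2.
- have [n2 [N2 [d [d' [st' dc fd]]]]] := stage_refine pK uh rh' rh (stage_sym st) e0 uh' x0.
  exists d', d; split => //; first by exists n2, N2; exact: stage_sym.
  by move=> x y /esym/dc/esym.
move=> u [uu [c [c' [_ _ Sc cu fin]]]]; exists u => // x.
apply/eqP; apply: contraT; rewrite -mdist_gt0; set e := mdist _ _ => e0.
have [g' [/ucontinuous_on_mcontinuous ch' _ _ _]] := uh'.
have [r r0 rP] := ch' (u x) I (e / 2) ltac:(by lra).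
have [|n [_ fn]] := fin (Num.min r (e / 2)); first by rewrite lt_min r0; lra.
have [n1 [N1 [[_ _ [cE _]] _ [_ _ [_ c'S]] _]]] := Sc n.
(* Exactness of the shared graph gives a [y] near [u x] whose image is near [u (h x)]; continuity of
   [h'] at [u x] then compares the two. *)
have [y [yx hyx]] := c'S _ _ (cE x).
have /fn : c' n y = c' n (u x) by rewrite yx cu.
have /fn : c' n (h' y) = c' n (u (h x)) by rewrite hyx cu.
rewrite !lt_min => /andP[_ d1] /andP[d2 _].
rewrite metric_sym in d2; have d3 := rP y I d2.
by have := metric_triangle (h' (u x)) (h' y) (u (h x)); rewrite -/e; lra.
Qed.

End conjugacy.

(** * Richness of closed relations *)

(* Labels ((i, s), t): component [i] of the coarse dumbbell is refined by two crossing
   components [s = 0, 1], whence perfectness, and by components [s = 2] and [s = 3]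
   winding around its left and right cycles, which are the loops. *)
Definition coarse (N : nat) (v : nat * nat * nat) : nat * nat :=
  (v.1.1, line N v.1.2.-1 v.2%:Z).

Definition fine_edge (n N : nat) (v w : nat * nat * nat) : Prop :=
  [/\ (v.1.1 < n)%N, (v.1.2 < 4)%N, w.1 = v.1 & dedge N v.2 w.2].

Lemma dedge_lt N a b : dedge N a b -> (a < 4 * N)%N.
Proof. by rewrite /dedge; lia. Qed.

Lemma dedge_ex N a : (0 < N)%N -> (a < 4 * N)%N -> exists b, dedge N a b.
Proof.
move=> N0 aN; exists (clock N (a%:Z + 1)).
by have := clock_edge N0 a%:Z; rewrite (clock_id N0); [|lia].
Qed.

Lemma dedge_line N s a b : (0 < N)%N -> dedge N a b ->
  dedge N (line N s a%:Z) (line N s b%:Z).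
Proof.
move=> N0 ab; have [t [_ ta tb]] := dedge_clock N0 ab.
have clid u : clock N (clock N u)%:Z = clock N u.
  by rewrite (clock_id N0) ?absz_nat//; have := clock_lt N0 u; lia.
case: s => [|[|s]] /=; rewrite -ta -tb ?clid; first exact: clock_edge.
  rewrite !clock_phase//; have := phaseS N0 t.
  by move: (phase _ _) (phase _ _) => p q; rewrite /dedge; lia.
rewrite !clock_phase//; have := phaseS N0 t.
by move: (phase _ _) (phase _ _) => p q; rewrite /dedge; lia.
Qed.

Lemma fine_edge_coarse n N v w : (0 < N)%N -> fine_edge n N v w ->
  uedge n N (coarse N v) (coarse N w).
Proof.
move=> N0 [vn v4 wv vw]; rewrite /coarse wv; split => //=.
exact: dedge_line.
Qed.

Section relations.
Context {R : realType}.

Definition dom {V : metricType R} (F : set (V * V)) : set V := fst @` F.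

(** The slack [r] leaves room for perturbations. One index [m] governs both the divisor [m.+1] and
    the mesh. *)
Definition rich_at {V : metricType R} (m : nat) (F : set (V * V)) :=
  exists n N (c : V -> nat * nat * nat) (r : R),
  [/\ [/\ (0 < N)%N, (m.+1 %| N)%N & 0 < r],
     forall x y, dom F x -> dom F y -> mdist x y < r -> c x = c y,
     forall x y, F (x, y) -> fine_edge n N (c x) (c y),
     forall v w, fine_edge n N v w -> exists x y, [/\ F (x, y), c x = v & c y = w] &
     forall x y, dom F x -> dom F y -> coarse N (c x) = coarse N (c y) ->
       mdist x y + r <= invS m].

Definition functional_at {V : metricType R} (m : nat) (F : set (V * V)) :=
  exists2 r : R, 0 < r & forall x y x' y', F (x, y) -> F (x', y') ->
    mdist x x' < r -> mdist y y' + r <= invS m.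

Definition inv_rel {V : metricType R} (F : set (V * V)) : set (V * V) :=
  [set p | F (p.2, p.1)].

Definition hclose {V : metricType R} (e : R) (F G : set (V * V)) :=
  (forall p, F p -> exists2 q, G q & mdist p.1 q.1 < e /\ mdist p.2 q.2 < e) /\
  (forall q, G q -> exists2 p, F p & mdist p.1 q.1 < e /\ mdist p.2 q.2 < e).

Definition self_rel {V : metricType R} (F : set (V * V)) :=
  forall x y, F (x, y) -> dom F y.

Section one_space.
Context {V : metricType R}.
Implicit Types F G : set (V * V).

(** The labels of [F] are pulled back along a map [f] displacing points by less than [r / 4]. Their
    constancy at scale [r] makes the choice of [f] immaterial, and two displacements consume only
    half of the slack. *)
Lemma rich_at_open m F : rich_at m F -> exists2 e : R, 0 < e &
  forall G, hclose e F G -> self_rel F -> self_rel G -> rich_at m G.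
Proof.
move=> [n [N [c [r [[N0 mN r0] cr cE cS cm]]]]].
exists (r / 4); first by lra.
move=> G [FG GF] sF sG.
have domG x : dom G x -> exists2 y, dom F y & mdist y x < r / 4.
  move=> [[a b] /= /GF[[a' b'] Fa [/= d1 _]] <-]; exists a' => //; by exists (a', b').
have [f fP] : exists f : V -> V, forall x, dom G x -> dom F (f x) /\ mdist (f x) x < r / 4.
  have ex x : exists y, dom G x -> dom F y /\ mdist y x < r / 4.
    by have [/domG[y]|] := pselect (dom G x); [exists y|exists x].
  by have [f fP] := choice ex; exists f.
have near x y : dom G x -> dom F y -> mdist y x < r / 4 -> c (f x) = c y.
  move=> /fP[Ff fx] Fy yx; apply: cr => //.
  by have := metric_triangle (f x) x y; rewrite [mdist x y]metric_sym; lra.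
exists n, N, (c \o f), (r / 4); split.
- by split => //; lra.
- move=> x y Gx Gy xy /=; have [Fx fx] := fP x Gx; have [Fy fy] := fP y Gy.
  apply: cr => //; have := metric_triangle (f x) x (f y); have := metric_triangle x y (f y).
  by rewrite [mdist y (f y)]metric_sym; lra.
- move=> x y Gxy /=; have [[a b] Fab [/= d1 d2]] := GF _ Gxy.
  rewrite (near x a) ?(near y b)//; [exact: cE|exact: sG Gxy|exact: sF Fab|by exists (x, y)|
    by exists (a, b)].
- move=> v w /cS[a [b [Fab <- <-]]]; have [[x y] Gxy [/= d1 d2]] := FG _ Fab.
  exists x, y; split => //=; apply: near => //;
    [by exists (x, y)|by exists (a, b)|exact: sG Gxy|exact: sF Fab].
- move=> x y Gx Gy /=; have [Fx fx] := fP x Gx; have [Fy fy] := fP y Gy => /cm h.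
  have {}h := h Fx Fy; have := metric_triangle x (f x) y; have := metric_triangle (f x) (f y) y.
  by rewrite [mdist x (f x)]metric_sym; lra.
Qed.

Lemma functional_at_open m F : functional_at m F -> exists2 e : R, 0 < e &
  forall G, hclose e F G -> functional_at m G.
Proof.
move=> [r r0 rP]; exists (r / 4); first by lra.
move=> G [_ GF]; exists (r / 4); first by lra.
move=> x y x' y' /GF[[a b] Fab [/= d1 d2]] /GF[[a' b'] Fab' [/= d1' d2']] xx'.
have /(rP _ _ _ _ Fab Fab') : mdist a a' < r.
  have := metric_triangle a x a'; have := metric_triangle x x' a'.
  by rewrite [mdist x' a']metric_sym; lra.
have := metric_triangle y b y'; have := metric_triangle b b' y'.
by rewrite [mdist y b]metric_sym; lra.
Qed.

Lemma hclose_inv e F G : hclose e F G -> hclose e (inv_rel F) (inv_rel G).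
Proof.
by move=> [FG GF]; split=> -[x y] /=; [move=> /FG|move=> /GF];
  move=> [[a b] /= Gab [d1 d2]]; exists (b, a).
Qed.

(** The crossing components [s = 0] and [s = 1] have the same coarse image, so the small coarse cell
    of [x] contains points with two different labels, not both equal to [x]. *)
Lemma rich_at_perfect F : (forall m, rich_at m F) -> self_rel F ->
  forall x, dom F x -> forall e : R, 0 < e -> exists y, [/\ dom F y, y != x & mdist x y < e].
Proof.
move=> rF sF x Fx e /invS_small[m me].
have [n [N [c [r [[N0 mN r0] cr cE cS cm]]]]] := rF m.
have [[x' y] /= Fxy xx'] := Fx; rewrite /= in xx'; subst x'.
have [xn x4 _ xe] := cE _ _ Fxy.
have tN := dedge_lt (dedge_line (c x).1.2.-1 N0 xe).
set t := line _ _ _ in tN.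
have [u tu] := dedge_ex N0 tN.
have pt s : (s < 2)%N -> exists z, [/\ dom F z, c z = ((c x).1.1, s, t) & mdist x z < e].
  move=> s2; have [|z [w [Fzw zE _]]] := cS ((c x).1.1, s, t) ((c x).1.1, s, u).
    by split => //=; lia.
  exists z; split => //; first by exists (z, w).
  apply: le_lt_trans me; have Fz : dom F z by exists (z, w).
  have : coarse N (c x) = coarse N (c z).
    rewrite zE /coarse /= -/t; congr pair.
    by case: s s2 {zE} => [|[|]]//= _; rewrite (clock_id N0) ?absz_nat//; lia.
  by move=> /cm h; have := h Fx Fz; lra.
have [z0 [Fz0 z0E d0]] := pt 0%N isT; have [z1 [Fz1 z1E d1]] := pt 1%N isT.
have [z0x|z0x] := eqVneq z0 x; last by exists z0.
by exists z1; split => //; apply/eqP => z1x; move: z1E; rewrite z1x -z0x z0E => -[].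
Qed.

Lemma rich_at_zero_dim F : (forall m, rich_at m F) -> forall e : R, 0 < e ->
  exists T (c : V -> T),
   (exists2 d : R, 0 < d & forall x y, dom F x -> dom F y -> mdist x y < d -> c x = c y) /\
   forall x y, dom F x -> dom F y -> c x = c y -> mdist x y < e.
Proof.
move=> rF e /invS_small[m me].
have [n [N [c [r [[N0 mN r0] cr cE cS cm]]]]] := rF m.
exists (nat * nat)%type, (coarse N \o c); split.
  by exists r => // x y Fx Fy /(cr _ _ Fx Fy) /= ->.
by move=> x y Fx Fy /(cm _ _ Fx Fy); lra.
Qed.

End one_space.

(** Two scales are kept apart in order to cover isometries, with [k = m], and homeomorphisms, where
    a finer [k] absorbs the modulus of continuity. *)
Lemma rich_at_pull {V W : metricType R} (F : set (V * V)) (G : set (W * W))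
    (psi : W -> V) (k m : nat) : psi @` (dom G) = dom F -> self_rel F ->
  (forall x y, dom G x -> dom G y -> G (x, y) <-> F (psi x, psi y)) -> self_rel G ->
  (m.+1 %| k.+1)%N ->
  (forall r : R, 0 < r -> exists2 r' : R, 0 < r' & forall x y, dom G x -> dom G y ->
     (mdist x y < r' -> mdist (psi x) (psi y) < r) /\
     (mdist (psi x) (psi y) + r <= invS k -> mdist x y + r' <= invS m)) ->
  rich_at k F -> rich_at m G.
Proof.
move=> psiE sF GF sG mk H [n [N [c [r [[N0 kN r0] cr cE cS cm]]]]].
have [r' r'0 rP] := H r r0.
have psiD x : dom G x -> dom F (psi x) by move=> Gx; rewrite -psiE; exists x.
have domG1 x y : G (x, y) -> dom G x by move=> Gxy; exists (x, y).
exists n, N, (c \o psi), r'; split.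
- by split => //; exact: dvdn_trans kN.
- by move=> x y Gx Gy xy; apply: cr; [exact: psiD|exact: psiD|exact: (rP x y Gx Gy).1].
- move=> x y Gxy; have Gx := domG1 _ _ Gxy; have Gy := sG _ _ Gxy.
  by apply: cE; apply/GF.
- move=> v w /cS[a [b [Fab av bw]]].
  have : dom F a by exists (a, b).
  rewrite -psiE => -[x Gx xa]; have := sF _ _ Fab; rewrite -psiE => -[y Gy yb].
  by exists x, y; split => /=; [apply/GF => //; rewrite xa yb|rewrite xa|rewrite yb].
- move=> x y Gx Gy /cm h; apply: (rP x y Gx Gy).2; apply: h; exact: psiD.
Qed.

Lemma rich_transfer {V W : metricType R} (F : set (V * V)) (G : set (W * W))
    (psi : W -> V) (phi : V -> W) : psi @` (dom G) = dom F -> self_rel F ->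
  (forall x y, dom G x -> dom G y -> G (x, y) <-> F (psi x, psi y)) -> self_rel G ->
  ucontinuous_on (dom G) psi -> ucontinuous_on (dom F) phi ->
  (forall x, dom G x -> phi (psi x) = x) ->
  (forall m, rich_at m F) -> forall m, rich_at m G.
Proof.
move=> psiE sF GF sG upsi uphi phiK rF m.
have psiD x : dom G x -> dom F (psi x) by move=> Gx; rewrite -psiE; exists x.
have [|d d0 dP] := uphi (invS m / 2); first by have := @invS_gt0 R m; lra.
have [k0 k0d] := invS_small d0.
(* The product keeps [m.+1] as a divisor while refining the mesh to that of [k0]. *)
pose k := (m.+1 * k0.+1).-1.
have k1 : k.+1 = (m.+1 * k0.+1)%N by rewrite /k; lia.
apply: (@rich_at_pull _ _ F G psi k m) => //; first by rewrite k1 dvdn_mulr.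
move=> r r0; have [d' d'0 d'P] := upsi r r0.
have m0 := @invS_gt0 R m.
exists (Num.min d' (invS m / 2)); first by rewrite lt_min d'0; lra.
have kk0 : invS k <= invS k0 :> R by apply: invS_le; rewrite /k; nia.
move=> x y Gx Gy; split; first by rewrite lt_min => /andP[/(d'P _ _ Gx Gy)].
move=> h; have : mdist x y < invS m / 2.
  rewrite -(phiK x Gx) -(phiK y Gy); apply: dP; [exact: psiD|exact: psiD|lra].
have : Num.min d' (invS m / 2) <= invS m / 2 by rewrite ge_min lexx orbT.
by lra.
Qed.

Definition graph_of {K : metricType R} (h : K -> K) : set (K * K) :=
  [set p | p.2 = h p.1].

Lemma dom_graph_of {K : metricType R} (h : K -> K) : dom (graph_of h) = setT.
Proof. by apply/seteqP; split=> // x _; exists (x, h x). Qed.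

Lemma rich_graph {K : metricType R} (h : K -> K) :
  (forall m, rich_at m (graph_of h)) -> rich h.
Proof.
move=> rF e m e0 m0; have [k0 k0e] := invS_small e0.
pose k := (m * k0.+1).-1.
have k1 : k.+1 = (m * k0.+1)%N by rewrite /k; nia.
have kk0 : invS k <= invS k0 :> R by apply: invS_le; rewrite /k; nia.
have [n [N [c [r [[N0 kN r0] cr cE cS cm]]]]] := rF k.
rewrite dom_graph_of in cr cm.
have mN : (m %| N)%N by apply: dvdn_trans kN; rewrite k1 dvdn_mulr.
exists n, N, (coarse N \o c); split => //; last first.
- by move=> x y /(cm _ _ I I); lra.
(* The refining components that wind around one cycle are themselves the invariant clopen sets. *)
- move=> i i_n right; exists (fun x => (c x).1 == (i, if right then 3 else 2)%N).
  split.
  + by exists r => // x y /(cr _ _ I I) ->.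
  + by move=> x; have [_ _ ->] := cE x (h x) erefl.
  + have [u cu] := @dedge_ex N 0 N0 ltac:(by lia).
    have [|x [y [_ xE _]]] := cS (i, if right then 3 else 2, 0)%N (i, if right then 3 else 2, u)%N.
      by split => //=; case: right.
    by exists x; rewrite xE.
  + move=> x /eqP; rewrite /coarse /=; case: (c x) => v t /= ->; split => //=.
    by case: right => /=; [exact: leq_addr|exact: phase_lt].
- split => //; first by apply: loc_const_comp; exists r => // x y; exact: cr.
  split=> [x|[i a] [i' b] [/= i_n -> ab]]; first exact: fine_edge_coarse (cE _ _ erefl).
  have [|x [y [/= xy xE yE]]] := cS (i, 0, a)%N (i, 0, b)%N; first by split.
  rewrite /graph_of /= in xy; rewrite xy in yE.
  exists x; rewrite xE yE /coarse /=.
  have bN : (b < 4 * N)%N by move: ab; rewrite /dedge; lia.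
  by rewrite !(clock_id N0) ?absz_nat//; have := dedge_lt ab; lia.
Qed.

End relations.

(** * The homeomorphism group *)

Lemma set_type_nbhsP {X : topologicalType} (A : set X) (x : set_type A) (P : set (set_type A)) :
  nbhs x P <-> exists2 B, nbhs (\val x) B & \val @^-1` B `<=` P.
Proof.
split=> [[/= _ [[W oW <-] Wx WP]]|[B Bx BP]].
  by exists W => //; apply: open_nbhs_nbhs.
by apply: filterS BP _; exact: (@initial_continuous _ _ (set_val : set_type A -> X)) Bx.
Qed.

Section homeo_group_topology.
Context {R : realType} {K : metricType R}.
Implicit Types (h k : homeo_group K) (U : set (homeo_group K)).

Definition unear (e : R) h k := forall x, mdist (homeo_fun h x) (homeo_fun k x) < e.

Lemma homeo_nbhsP h U : nbhs h U <->
  exists2 e : R, 0 < e & forall k, unear e h k -> U k.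
Proof.
rewrite set_type_nbhsP; split=> [[B]|[e e0 eU]].
  rewrite uniform_nbhs => -[E [entE EB]] BU.
  move: entE; rewrite -entourage_ballE => -[e /= e0 eE].
  exists e => // k hk; apply: BU; apply: EB => x _; apply: eE => /=.
  by rewrite ballEmdist; exact: hk.
exists [set f | forall x, [set: K] x -> ball (homeo_fun h x) e (f x)].
  apply/uniform_nbhs; exists [set p | ball p.1 e p.2]; split=> [|f fh x _].
    by rewrite -entourage_ballE; exists e.
  exact: fh.
by move=> k hk; apply: eU => x; have := hk x I; rewrite ballEmdist.
Qed.

Lemma homeo_openP U : open U <->
  forall h, U h -> exists2 e : R, 0 < e & forall k, unear e h k -> U k.
Proof.
rewrite openE; split=> H h Uh; [by apply/homeo_nbhsP; exact: H|].
by apply/homeo_nbhsP; exact: H.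
Qed.

Lemma homeo_denseP U : dense U <->
  forall h (e : R), 0 < e -> exists2 k, unear e h k & U k.
Proof.
split=> [dU h e e0|H W [h Wh] /homeo_openP oW].
  have : nbhs h [set k | unear e h k] by apply/homeo_nbhsP; exists e.
  rewrite nbhsE => -[W [oW Wh] Wk].
  by have [|k [/Wk kh Uk]] := dU W _ oW; [exists h|exists k].
have [e e0 eW] := oW h Wh; have [k /eW Wk Uk] := H h e e0.
by exists k.
Qed.

Lemma mk_homeo (u : K -> K) : uhomeo u -> exists h, homeo_fun h = u.
Proof.
move=> [v [uu uv uK vK]].
have hu : @homeomorphism K K [set: K] [set: K] u.
  exists v; split => //.
  - by apply/within_mcontinuousP; exact: ucontinuous_on_mcontinuous.
  - by apply/within_mcontinuousP; exact: ucontinuous_on_mcontinuous.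
  - by split=> x _.
by exists (exist _ (u : {uniform K -> K}) (mem_set hu)).
Qed.

Hypothesis cK : seqcompact [set: K].

Lemma homeo_uhomeo h : uhomeo (homeo_fun h).
Proof.
have [v [cu cv _ _ [uK vK]]] := set_mem (valP h); exists v; split.
- by apply: seqcompact_ucontinuous => //; apply/within_mcontinuousP.
- by apply: seqcompact_ucontinuous => //; apply/within_mcontinuousP.
- by move=> x; apply: uK; rewrite inE.
- by move=> x; apply: vK; rewrite inE.
Qed.

Lemma uniform_limit (u : nat -> K -> K) (a : nat -> R) :
  (forall n, ucontinuous_on [set: K] (u n)) -> (forall e : R, 0 < e -> exists n, a n < e) ->
  (forall n m, (n <= m)%N -> forall x, mdist (u n x) (u m x) <= a n) ->
  exists2 f, ucontinuous_on [set: K] f & forall n x, mdist (u n x) (f x) <= a n.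
Proof.
move=> cu a0 ua.
have ex x : exists y, forall n, mdist (u n x) y <= a n.
  have [//|y _ yP] := @cK (fun n => u n x); exists y => n.
  apply/ler_addgt0Pr => e e0; have [m nm my] := yP e e0 n.
  by have := metric_triangle (u n x) (u m x) y; have := ua n m nm x; lra.
have [f fP] := choice ex; exists f => [e e0|//].
have [|n ne] := a0 (e / 3); first by lra.
have [|r r0 rP] := cu n (e / 3); first by lra.
exists r => // x y _ _ xy; have := rP x y I I xy.
have := metric_triangle (f x) (u n x) (f y); have := metric_triangle (u n x) (u n y) (f y).
by have := fP x n; have := fP y n; rewrite [mdist (f x) (u n x)]metric_sym; lra.
Qed.

(** A uniform limit of homeomorphisms need not be injective. The radii of the nested balls are
    therefore small enough to make the inverses converge too. *)
Lemma homeo_baire (U : nat -> set (homeo_group K)) :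
  (forall n, open (U n)) -> (forall n, dense (U n)) ->
  forall h (e : R), 0 < e -> exists2 k, unear e h k & forall n, U n k.
Proof.
move=> oU dU h0 e0 e0_gt0.
have invP h : exists g : K -> K, [/\ ucontinuous_on [set: K] g,
   cancel (homeo_fun h) g & cancel g (homeo_fun h)].
  by have [g [_ ug hg gh]] := homeo_uhomeo h; exists g.
have [inv invE] := choice invP.
have step (s : {s : homeo_group K * R | 0 < s.2} * nat) :
   exists s' : {s : homeo_group K * R | 0 < s.2} * nat,
   [/\ s'.2 = s.2.+1, (sval s'.1).2 <= invS s.2 &
    forall k, (forall x, mdist (homeo_fun (sval s'.1).1 x) (homeo_fun k x) <= (sval s'.1).2) ->
      [/\ U s.2 k, unear (sval s.1).2 (sval s.1).1 k &
       forall y, mdist (inv (sval s'.1).1 y) (inv k y) < invS s.2]].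
  case: s => -[[h r] /= r0] n.
  have [h' hh' Uh'] := (homeo_denseP _).1 (dU n) h (r / 2) ltac:(by lra).
  have [e1 e10 e1P] := (homeo_openP _).1 (oU n) h' Uh'.
  have [ui hi ih] := invE h'.
  have [e2 e20 e2P] := ui _ (@invS_gt0 R n).
  (* The bounds keep the closed ball inside the previous one, inside [U n], within the continuity
     scale of the inverse, and of radius tending to 0. *)
  pose r' := Num.min (Num.min (r / 4) (e1 / 2)) (Num.min (e2 / 2) (invS n)).
  have r'0 : 0 < r' by rewrite !lt_min invS_gt0; lra.
  have [r'1 r'2 r'3 r'4] : [/\ r' <= r / 4, r' <= e1 / 2, r' <= e2 / 2 & r' <= invS n].
    by split; rewrite !ge_min lexx ?orbT.
  exists (exist _ (h', r') r'0, n.+1); split => //= k hk; split.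
  - by apply: e1P => x; have := hk x; lra.
  - move=> x; have := hk x; have := hh' x.
    by have := metric_triangle (homeo_fun h x) (homeo_fun h' x) (homeo_fun k x); lra.
  - move=> y; have [_ ik ki] := invE k.
    rewrite -[inv k y]hi metric_sym; apply: e2P => //.
    by rewrite -{2}(ki y); have := hk (inv k y); lra.
have [f fP] := choice step.
pose st n := iter n f (exist _ (h0, e0) e0_gt0, 0%N).
have st2 n : (st n).2 = n by elim: n => //= n IH; have [-> _ _] := fP (st n); rewrite IH.
pose h n := (sval (st n).1).1; pose r n := (sval (st n).1).2.
have rS n : r n.+1 <= invS n by have [_ + _] := fP (st n); rewrite st2.
have near n k : (forall x, mdist (homeo_fun (h n.+1) x) (homeo_fun k x) <= r n.+1) ->
    [/\ U n k, unear (r n) (h n) k & forall y, mdist (inv (h n.+1) y) (inv k y) < invS n].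
  by have [_ _ H] := fP (st n) => /H; rewrite st2.
have rgt0 n : 0 < r n := svalP (st n).1.
have close n m : (n <= m)%N -> forall x, mdist (homeo_fun (h n) x) (homeo_fun (h m) x) <= r n.
  move=> nm; rewrite -(subnKC nm); move: (m - n)%N => d {nm}; elim: d n => [|d IH] n x.
    by rewrite addn0 mdistxx ltW.
  apply: ltW; have [_ H _] := near n (h (n.+1 + d)%N) (IH n.+1).
  by rewrite addnS -addSn; exact: H.
have small e : 0 < e -> exists n, r n.+1 < e.
  move=> /invS_small[n ne]; exists n; exact: le_lt_trans (rS n) ne.
have [F uF FP] : exists2 F, ucontinuous_on [set: K] F &
    forall n x, mdist (homeo_fun (h n.+1) x) (F x) <= r n.+1.
  apply: (uniform_limit (u := fun n => homeo_fun (h n.+1))) => [n|e|n m nm x].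
  - by have [v [ch _ _ _]] := homeo_uhomeo (h n.+1).
  - exact: small.
  - exact: close.
have [G uG GP] : exists2 G, ucontinuous_on [set: K] G &
    forall n y, mdist (inv (h n.+1) y) (G y) <= invS n.
  apply: (uniform_limit (u := fun n => inv (h n.+1))) => [n|e|n m nm y]; [by have [] := invE (h n.+1)|exact: invS_small|].
  by apply: ltW; have [_ _ H] := near n (h m.+1) (close n.+1 m.+1 nm); exact: H.
have eq0P (x y : K) : (forall e : R, 0 < e -> mdist x y < e) -> x = y.
  by move=> H; apply/eqP; apply: contraT; rewrite -mdist_gt0 => /H; rewrite ltxx.
have GF : cancel F G.
  move=> x; apply: eq0P => e eg0.
  have [|d d0 dP] := uG (e / 2); first by lra.
  have [n nd] : exists n, invS n < Num.min d (e / 2) :> R.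
    by apply: invS_small; rewrite lt_min d0; lra.
  move: nd; rewrite lt_min => /andP[n1 n2].
  have /(dP _ _ I I) d1 : mdist (F x) (homeo_fun (h n.+1) x) < d.
    by rewrite metric_sym; have := FP n x; have := rS n; lra.
  have := GP n (homeo_fun (h n.+1) x); have [_ -> _] := invE (h n.+1).
  have := metric_triangle (G (F x)) (G (homeo_fun (h n.+1) x)) x.
  by rewrite [mdist x (G _)]metric_sym; lra.
have FG : cancel G F.
  move=> y; apply: eq0P => e eg0.
  have [|d d0 dP] := uF (e / 2); first by lra.
  have [n nd] : exists n, invS n < Num.min d (e / 2) :> R.
    by apply: invS_small; rewrite lt_min d0; lra.
  move: nd; rewrite lt_min => /andP[n1 n2].
  have /(dP _ _ I I) d1 : mdist (G y) (inv (h n.+1) y) < d.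
    by rewrite metric_sym; have := GP n y; lra.
  have := FP n (inv (h n.+1) y); have [_ _ ->] := invE (h n.+1).
  have := metric_triangle (F (G y)) (F (inv (h n.+1) y)) y.
  by have := rS n; rewrite [mdist y (F _)]metric_sym; lra.
have [k kE] : exists k, homeo_fun k = F by apply: mk_homeo; exists G.
have nk n : forall x, mdist (homeo_fun (h n.+1) x) (homeo_fun k x) <= r n.+1 by rewrite kE.
exists k; first by have [_ H _] := near 0%N k (nk 0%N).
by move=> n; have [] := near n k (nk n).
Qed.

End homeo_group_topology.

(** * The special homeomorphism *)

Section periodic_walk.
Variables (X : finType) (E : X -> X -> Prop) (s p : X -> X).
Hypotheses (Es : forall x, E x (s x)) (Ep : forall x, E (p x) x).
Variables (m : nat) (a b : X).
Hypothesis ab : E a b.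

Let N := ((#|X|)`! * m.+1)%N.

(* The edge [a -> b] sits in the middle of the bar; by periodicity of iterates the ends
   of the walk close up into cycles of length N. *)
Definition periodic_walk (t : nat) : X :=
  if (t < 2 * N)%N then iter (2 * N - t.+1) p a else iter (t - 2 * N) s b.

Lemma periodic_walk_edge t u : dedge N t u -> E (periodic_walk t) (periodic_walk u).
Proof.
have N0 : (0 < N)%N by rewrite muln_gt0 fact_gt0.
have pN x : iter (2 * N) p x = iter N p x.
  by rewrite mul2n -addnn; exact: iter_fact_period.
have sN x : iter (2 * N) s x = iter N s x.
  by rewrite mul2n -addnn; exact: iter_fact_period.
rewrite /periodic_walk => -[[-> tN]|[[tN ->]|[tN ->]]].
- have [t1|t1] := ltnP t.+1 (2 * N).
    rewrite ltnW//; have -> : (2 * N - t.+1 = (2 * N - t.+2).+1)%N by lia.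
    exact: Ep.
  have [t2|t2] := ltnP t (2 * N).
    by have -> : (2 * N - t.+1 = 0)%N; [lia|have -> : (t.+1 - 2 * N = 0)%N; [lia|]].
  by rewrite subSn//; exact: Es.
- rewrite !ifT; [|lia|lia].
  have -> : (2 * N - t.+1 = N)%N by lia.
  by rewrite -pN; have {1}-> : (2 * N = (2 * N - 1).+1)%N; [lia|exact: Ep].
- rewrite !ifF; [|lia|lia].
  have -> : (3 * N - 2 * N = N)%N by lia.
  have -> : (t - 2 * N = (2 * N).-1)%N by lia.
  by rewrite -sN; have {2}-> : (2 * N = (2 * N).-1.+1)%N; [lia|exact: Es].
Qed.

Lemma periodic_walk_mid : periodic_walk (2 * N).-1 = a.
Proof.
have N0 : (0 < N)%N by rewrite muln_gt0 fact_gt0.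
by rewrite /periodic_walk ifT; [have -> : (2 * N - (2 * N).-1.+1 = 0)%N by lia|lia].
Qed.

End periodic_walk.

Section generic_homeo.
Context {R : realType} {K : metricType R}.
Hypotheses (cK : seqcompact [set: K]) (zK : zero_dim K) (pK : no_isolated K).

(** Each edge of the transition graph of [h] on a fine partition is put in the middle of the bar of
    its own dumbbells by [periodic_walk]. Splitting the cells along these dumbbells and realizing
    their edges gives a map that moves cells only as [h] does. *)
Lemma rich_at_dense m : dense [set h : homeo_group K | rich_at m (graph_of (homeo_fun h))].
Proof.
apply/homeo_denseP => h e e0.
have [g [uh ug hg gh]] := homeo_uhomeo cK h.
have [|d d0 dP] := uh (e / 2); first by lra.
have im0 := @invS_gt0 R m.
pose e1 := Num.min d (Num.min (e / 2) (invS m / 2)).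
have [|T [r [lr mr]]] := zK (e := e1); first by rewrite !lt_min d0; lra.
have mrP x y : r x = r y -> [/\ mdist x y < d, mdist x y < e / 2 & mdist x y < invS m / 2].
  by move=> /mr; rewrite !lt_min => /and3P.
have [X [p [ps pE]]] := finite_label cK lr.
have lp : loc_const p by apply: loc_const_factor lr _ => x y xy; apply pE.
pose G i j := exists x, p x = i /\ p (homeo_fun h x) = j.
have [s sP] : exists s : X -> X, forall i, G i (s i).
  have ex i : exists j, G i j by have [x xi] := ps i; exists (p (homeo_fun h x)), x.
  by have [s sP] := choice ex; exists s.
have [q qP] : exists q : X -> X, forall j, G (q j) j.
  have ex j : exists i, G i j by have [x xj] := ps j; exists (p (g x)), (g x); rewrite gh.
  by have [q qP] := choice ex; exists q.
pose N := ((#|X|)`! * m.+1)%N.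
have N0 : (0 < N)%N by rewrite muln_gt0 fact_gt0.
pose J := {ij : X * X | `[< G ij.1 ij.2 >]}.
pose L := ((J * 'I_4) * 'I_(4 * N))%type.
(* Kinds 0 and 1 traverse the walk, kinds 2 and 3 wind around its ends; [lam] thus factors through
   the coarse position, which gives the mesh bound. *)
pose tau (v : L) := line N (v.1.2 : nat).-1 (v.2 : nat)%:Z.
pose lam (v : L) := periodic_walk s q m (val v.1.1).1 (val v.1.1).2 (tau v).
have lamE (v w : L) : w.1 = v.1 -> dedge N v.2 w.2 -> G (lam v) (lam w).
  move=> vw d_; rewrite /lam /tau vw; apply: periodic_walk_edge => //.
    exact: (asboolW (valP v.1.1)).
  exact: dedge_line.
pose E (v w : L) := w.1 = v.1 /\ dedge N v.2 w.2.
have [c [lc cl cs]] : exists c : K -> L,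
    [/\ loc_const c, forall x, lam (c x) = p x & forall i, exists x, c x = i].
  apply: split_label => // x.
  have Gx : `[< G (p x) (p (homeo_fun h x)) >] by apply/asboolP; exists x.
  have mid : ((2 * N).-1 < 4 * N)%N by lia.
  exists (exist _ (p x, p (homeo_fun h x)) Gx, ord0, Ordinal mid).
  rewrite /lam /tau /= (clock_id N0) ?absz_nat; last by lia.
  exact: periodic_walk_mid.
have E1 v : exists w, E v w.
  have [u tu] := dedge_ex N0 (ltn_ord v.2).
  have uN : (u < 4 * N)%N by move: tu; rewrite /dedge; lia.
  by exists (v.1, Ordinal uN).
have E2 w : exists v, E v w.
  have [u tu] : exists u, dedge N u w.2.
    have wN := ltn_ord w.2; have := clock_edge N0 ((w.2 : nat)%:Z - 1).
    by rewrite subrK (clock_id N0 (t := (w.2 : nat)%:Z)) ?absz_nat; [eexists; eassumption|lia].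
  by exists (w.1, Ordinal (dedge_lt tu)).
have [k [uk kE kS]] := realize_relation cK zK pK lc cs E1 E2.
have [k' k'E] := mk_homeo uk.
exists k'.
  move=> x; rewrite k'E; have [e1' e2'] := kE x.
  (* The new map sends [x] to a cell into which [h] sends some [y] of the cell of [x]. *)
  have [y [yx yk]] := lamE _ _ e1' e2'; rewrite !cl in yx yk.
  have [yx1 _ _] := mrP _ _ ((pE _ _).1 yx); have [_ yk2 _] := mrP _ _ ((pE _ _).1 yk).
  have := dP y x I I yx1; have := metric_triangle (homeo_fun h x) (homeo_fun h y) (k x).
  by rewrite [mdist (homeo_fun h x) (homeo_fun h y)]metric_sym; lra.
rewrite /= k'E.
have [r0 r00 r0P] := lc.
exists #|{: J}|, N, (fun x => ((fin_index (c x).1.1, (c x).1.2 : nat), (c x).2 : nat)),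
  (Num.min r0 (invS m / 2)).
have r1 : Num.min r0 (invS m / 2) <= r0 by rewrite ge_min lexx.
have r2 : Num.min r0 (invS m / 2) <= invS m / 2 by rewrite ge_min lexx orbT.
split.
- by split; [|exact: dvdn_mull|rewrite lt_min r00; lra].
- by move=> x y _ _ xy; rewrite (r0P x y)//; lra.
- move=> x y; rewrite /graph_of /= => ->; have [e1' e2'] := kE x.
  by split => //=; rewrite ?e1'//; exact: ltn_ord.
- move=> [[i s'] t] [is' u] [/= iJ s4 -> tu].
  have uN : (u < 4 * N)%N by move: tu; rewrite /dedge; lia.
  pose v1 := (enum_val (Ordinal iJ), Ordinal s4).
  have [|x [xv xw]] := kS (v1, Ordinal (dedge_lt tu)) (v1, Ordinal uN); first by split.
  exists x, (k x); split => //; first by rewrite xv /= /fin_index enum_valK.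
  by rewrite xw /= /fin_index enum_valK.
- move=> x y _ _ [/fin_index_inj j_ t_].
  have : lam (c x) = lam (c y) by rewrite /lam /tau j_ t_.
  by rewrite !cl => /pE/mrP[_ _]; lra.
Qed.

Lemma uhomeo_inv (u : K -> K) : uhomeo u -> exists v, [/\ uhomeo v, cancel u v & cancel v u].
Proof. by move=> [v [uu uv uK vK]]; exists v; split => //; exists u. Qed.

Lemma self_graph_of (h : K -> K) : self_rel (graph_of h).
Proof. by move=> x y _; rewrite dom_graph_of. Qed.

Lemma rich_conj (h k u : homeo_group K) :
  homeo_fun k \o homeo_fun u = homeo_fun u \o homeo_fun h ->
  (forall m, rich_at m (graph_of (homeo_fun h))) ->
  forall m, rich_at m (graph_of (homeo_fun k)).
Proof.
move=> ku; have [v [uu uv uK vK]] := homeo_uhomeo cK u.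
apply: (rich_transfer (psi := v) (phi := homeo_fun u)).
- rewrite !dom_graph_of; apply/seteqP; split=> // x _.
  by exists (homeo_fun u x) => //; rewrite uK.
- exact: self_graph_of.
- move=> x y _ _; rewrite /graph_of /=; have := congr1 (@^~ (v x)) ku.
  rewrite /= vK => kx; split=> [->|]; first by rewrite kx uK.
  by rewrite kx => <-; rewrite vK.
- exact: self_graph_of.
- by rewrite dom_graph_of.
- by rewrite dom_graph_of.
- by move=> x _; rewrite vK.
Qed.

Lemma rich_at_homeo_open m : open [set h : homeo_group K | rich_at m (graph_of (homeo_fun h))].
Proof.
apply/homeo_openP => h /rich_at_open[e e0 eP]; exists e => // k hk.
apply: eP; [|exact: self_graph_of|exact: self_graph_of].
split=> -[x y]; rewrite /graph_of /= => ->.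
  by exists (x, homeo_fun k x) => //=; rewrite mdistxx; split => //; exact: hk.
by exists (x, homeo_fun h x) => //=; rewrite mdistxx; split => //; exact: hk.
Qed.

(** Rich maps form a single class, dense and Gdelta by Baire. Conversely a dense Gdelta class meets
    the generic set of rich maps, and richness passes along conjugacy. *)
Lemma specialP (h : homeo_group K) : K ->
  special h <-> forall m, rich_at m (graph_of (homeo_fun h)).
Proof.
move=> x0; split=> [[dh [U oU hU]]|rh].
  have dU n : dense (U n).
    apply/homeo_denseP => k e e0; have [k' kk' k'h] := (homeo_denseP _).1 dh k e e0.
    by exists k' => //; move: k'h; rewrite hU => /(_ n I).
  (* Interleaving the two countable families yields a map common to both by one application of
     Baire. *)
  pose W n := if odd n then U n./2
    else [set k : homeo_group K | rich_at n./2 (graph_of (homeo_fun k))].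
  have [n|n|k _ Wk] := @homeo_baire _ _ cK W _ _ h 1 ltr01.
  - by rewrite /W; case: ifP => _; [exact: oU|exact: rich_at_homeo_open].
  - by rewrite /W; case: ifP => _; [exact: dU|exact: rich_at_dense].
  have [u ku] : conj_class h k.
    rewrite hU => n _; have := Wk n.*2.+1.
    by rewrite /W /= odd_double /= uphalf_double.
  have rk m : rich_at m (graph_of (homeo_fun k)).
    by have := Wk m.*2; rewrite /W odd_double doubleK.
  have [v [uv uK vK]] := uhomeo_inv (homeo_uhomeo cK u).
  have [v' v'E] := mk_homeo uv.
  apply: (@rich_conj k h v') rk; apply: funext => x; rewrite v'E /=.
  by have := congr1 (@^~ (v x)) ku; rewrite /= vK => ->; rewrite uK.
have E : conj_class h = [set k | forall m, rich_at m (graph_of (homeo_fun k))].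
  apply/seteqP; split=> [k [u ku]|k rk] /=; first exact: rich_conj ku rh.
  have [u uu hu] := rich_conjugate cK zK pK (homeo_uhomeo cK h) (homeo_uhomeo cK k)
    (rich_graph rh) (rich_graph rk) x0.
  by have [u' u'E] := mk_homeo uu; exists u'; rewrite u'E; apply: funext => x; exact: hu.
split.
  rewrite E; apply/homeo_denseP => k e e0.
  by have [k' kk' rk'] := homeo_baire cK rich_at_homeo_open rich_at_dense k e0; exists k'.
exists (fun m => [set k | rich_at m (graph_of (homeo_fun k))]); first exact: rich_at_homeo_open.
by rewrite E; apply/seteqP; split=> k H m; [move=> _; exact: H|exact: H m I].
Qed.

End generic_homeo.

(** * Isometry classes of dynamical systems *)

Local Open Scope quotient_scope.

(** A separate alias of [set_type A], so that its topology comes from the restricted metric rather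
    than from the inclusion. *)
Definition metric_sub {R : realType} {V : metricType R} (A : set V) : Type := set_type A.

Section metric_sub.
Context {R : realType} {V : metricType R} (A : set V).

HB.instance Definition _ := Choice.on (metric_sub A).

Definition sub_val (x : metric_sub A) : V := \val x.

Definition sub_dist (x y : metric_sub A) : R := mdist (sub_val x) (sub_val y).

Let sub_distxx x : sub_dist x x = 0. Proof. exact: mdistxx. Qed.

Let sub_dist_eq0 x y : sub_dist x y = 0 -> x = y.
Proof. by move=> /mdist_positivity /val_inj. Qed.

Let sub_dist_sym x y : sub_dist x y = sub_dist y x. Proof. exact: metric_sym. Qed.

Let sub_dist_triangle y x z : sub_dist x z <= sub_dist x y + sub_dist y z.
Proof. exact: metric_triangle. Qed.

HB.instance Definition _ := @isMetric.Build R (metric_sub A)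
  sub_dist sub_distxx sub_dist_eq0 sub_dist_sym sub_dist_triangle.

Lemma sub_valP (x : metric_sub A) : A (sub_val x).
Proof. exact: set_mem (valP x). Qed.

Lemma sub_val_inj : injective sub_val. Proof. exact: val_inj. Qed.

Lemma sub_ex x : A x -> exists y : metric_sub A, sub_val y = x.
Proof. by move=> Ax; exists (exist _ x (mem_set Ax)). Qed.

Lemma mdist_sub (x y : metric_sub A) : mdist x y = mdist (sub_val x) (sub_val y).
Proof. by []. Qed.

Lemma compact_metric_sub : compact A -> compact [set: metric_sub A].
Proof.
move=> cA F FF _; have [|p [Ap cp]] := cA (sub_val @ F) _.
  exact: (@filterS _ F _ setT _ (fun x _ => sub_valP x) filterT).
have [q qp] := sub_ex Ap; exists q; split => // B U FB /nbhs_mdistP[e e0 eU].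
have [||y [[b Bb <-]]] := cp (sub_val @` B) (ball p e).
- by apply: (@filterS _ F _ B) FB => x Bx /=; exists x.
- exact: nbhsx_ballx.
by rewrite ballEmdist /= -qp => qb; exists b; split => //; exact: eU.
Qed.

Lemma cantor_metric_sub : compact A -> A !=set0 ->
  (forall x, A x -> forall e : R, 0 < e -> exists y, [/\ A y, y != x & mdist x y < e]) ->
  (forall e : R, 0 < e -> exists T (c : V -> T),
     (exists2 d : R, 0 < d & forall x y, A x -> A y -> mdist x y < d -> c x = c y) /\
     forall x y, A x -> A y -> c x = c y -> mdist x y < e) ->
  [/\ cantor_set [set: metric_sub A], seqcompact [set: metric_sub A],
     zero_dim (metric_sub A) & no_isolated (metric_sub A)].
Proof.
move=> cA [a Aa] pA zA.
have cK := compact_metric_sub cA.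
have pK : no_isolated (metric_sub A).
  move=> x e e0; have [y [Ay yx xy]] := pA _ (sub_valP x) e e0.
  have [z zy] := sub_ex Ay; exists z; last by rewrite mdist_sub zy.
  by apply: contra_neq yx => <-.
have zK : zero_dim (metric_sub A).
  move=> e e0; have [T [c [[d d0 cd] cm]]] := zA e e0.
  exists T, (c \o sub_val); split; first exists d => //.
    by move=> x y; apply: cd; exact: sub_valP.
  by move=> x y; apply: cm; exact: sub_valP.
split => //; last exact: compact_seqcompact.
apply: cantor_set_intro => //; first by have [z _] := sub_ex Aa; exists z.
  by move=> x _ e e0; have [y yx xy] := pK x e e0; exists y.
move=> e e0; have [T [c [[d d0 cd] cm]]] := zK e e0; exists T, c; split.
  by exists d => // x y _ _; exact: cd.
by move=> x y _ _; exact: cm.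
Qed.

End metric_sub.

(** * Dynamical systems and the Gdelta property *)

Section dynamical_systems.
Context {R : realType} {V : metricType R}.
Implicit Types f g : DS V.

Lemma graph_compact f : compact (graph f).
Proof. by have [] := set_mem (valP (\val f)). Qed.

Lemma graph_neq0 f : graph f !=set0.
Proof. by have [] := set_mem (valP (\val f)). Qed.

Lemma graph_proj f : fst @` graph f = snd @` graph f.
Proof. exact: set_mem (valP f). Qed.

Lemma M_compact f : compact (M f).
Proof.
apply: continuous_compact; last exact: graph_compact.
by apply: continuous_subspaceT => x; exact: cvg_fst.
Qed.

Lemma self_rel_graph f : self_rel (graph f).
Proof. by move=> x y fxy; rewrite /dom graph_proj; exists (x, y). Qed.

Lemma graph_pred f y : M f y -> exists x, graph f (x, y).
Proof. by rewrite /M graph_proj => -[[x z] fxz /= <-]; exists x. Qed.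

Lemma mk_DS (F : set (V * V)) : compact F -> F !=set0 -> fst @` F = snd @` F ->
  exists f : DS V, graph f = F.
Proof.
move=> cF F0 F12; have FK : [set A : set (V * V) | A !=set0 /\ compact A] F by [].
have FD : [set f : compacts (V * V)%type | fst @` (\val f : set (V * V)) = snd @` (\val f : set (V * V))]
   (SigSub (mem_set FK)) by [].
by exists (SigSub (mem_set FD)).
Qed.

Definition good_at m (F : set (V * V)) :=
  [/\ rich_at m F, functional_at m F & functional_at m (inv_rel F)].

Lemma functional_at_ex (F : set (V * V)) : (forall m, functional_at m F) ->
  exists2 u : V -> V, forall x y, dom F x -> F (x, y) <-> y = u x & ucontinuous_on (dom F) u.
Proof.
move=> fF.
have uniq x y y' : F (x, y) -> F (x, y') -> y = y'.
  move=> xy xy'; apply/eqP; apply: contraT; rewrite -mdist_gt0 => /invS_small[m md].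
  have [r r0 rP] := fF m; have := rP _ _ _ _ xy xy'; rewrite mdistxx => /(_ r0); lra.
have ex x : exists y, dom F x -> F (x, y).
  have [[[a b] Fab /= <-]|nx] := pselect (dom F x); first by exists b.
  by exists x.
have [u uP] := choice ex; exists u.
  move=> x y Fx; split=> [Fxy|->]; last exact: uP.
  exact: uniq Fxy (uP x Fx).
move=> e /invS_small[m me]; have [r r0 rP] := fF m; exists r => // x y Fx Fy xy.
by have := rP _ _ _ _ (uP x Fx) (uP y Fy) xy; lra.
Qed.

Lemma functional_at_ucont (F : set (V * V)) (u : V -> V) : ucontinuous_on (dom F) u ->
  (forall x y, F (x, y) -> y = u x) -> forall m, functional_at m F.
Proof.
move=> cu Fu m; have m0 := @invS_gt0 R m.
have [|r r0 rP] := cu (invS m / 2); first by lra.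
have h1 : Num.min r (invS m / 2) <= r by rewrite ge_min lexx.
have h2 : Num.min r (invS m / 2) <= invS m / 2 by rewrite ge_min lexx orbT.
exists (Num.min r (invS m / 2)); first by rewrite lt_min r0; lra.
move=> x y x' y' Fxy Fxy' xx'.
have : mdist y y' < invS m / 2.
  by rewrite (Fu _ _ Fxy) (Fu _ _ Fxy'); apply: rP; [exists (x, y)|exists (x', y')|lra].
by lra.
Qed.

(** All scales together make the relation the graph of a homeomorphism of [M f], and [M f] with its
    own metric serves as the model Cantor space. *)
Lemma good_conj_to_special f : (forall m, good_at m (graph f)) -> conj_to_special f.
Proof.
move=> gf; have fM : dom (graph f) = M f by [].
have [|u uE uc] := @functional_at_ex (graph f); first by move=> m; have [] := gf m.
have domi : dom (inv_rel (graph f)) = M f.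
  apply/seteqP; split=> [_ [[x y] /= fyx <-]|x /graph_pred[y fyx]].
    exact: self_rel_graph fyx.
  by exists (x, y).
have [|v vE vc] := @functional_at_ex (inv_rel (graph f)); first by move=> m; have [] := gf m.
rewrite domi in vE vc; rewrite fM in uE uc.
have rf m : rich_at m (graph f) by have [] := gf m.
have uM x : M f x -> M f (u x).
  by move=> fx; apply: (@self_rel_graph f x); apply/uE.
have vM x : M f x -> M f (v x).
  by move=> fx; have /= fvx : inv_rel (graph f) (x, v x) by [apply/vE]; exists (v x, x).
have vu x : M f x -> v (u x) = x.
  by move=> fx; apply/esym; apply/(vE (u x)); [exact: uM|apply/uE].
have uv x : M f x -> u (v x) = x.
  by move=> fx; apply/esym; apply/uE; [exact: vM|apply/(vE x (v x) fx)].
have M0 : M f !=set0 by have [[x y] fxy] := graph_neq0 f; exists x; exists (x, y).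
have pM := rich_at_perfect rf (@self_rel_graph f); rewrite fM in pM.
have zM := rich_at_zero_dim rf; rewrite fM in zM.
have cM := @M_compact f.
split; first exact: cantor_set_intro.
exists u; split.
- exists v; split => //.
  + by apply/within_mcontinuousP; exact: ucontinuous_on_mcontinuous.
  + by apply/within_mcontinuousP; exact: ucontinuous_on_mcontinuous.
  + by split=> x; rewrite inE; [exact: vu|exact: uv].
- apply/seteqP; split=> -[x y] /=; last by move=> [fx ->]; apply/uE.
  by move=> fxy; have fx : M f x by [exists (x, y)]; split => //; apply/uE.
have [cK sK zK pK] := cantor_metric_sub cM M0 pM zM.
have [x0 fx0] := M0; have [k0 k0E] := sub_ex fx0.
have [phi phiE] : exists phi : V -> metric_sub (M f), forall x, M f x -> sub_val (phi x) = x.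
  have ex x : exists k : metric_sub (M f), M f x -> sub_val k = x.
    by have [/sub_ex[k kx]|nx] := pselect (M f x); [exists k|exists k0].
  by have [phi phiE] := choice ex; exists phi.
have phiK k : phi (sub_val k) = k by apply: sub_val_inj; rewrite phiE//; exact: sub_valP.
pose h (k : metric_sub (M f)) := phi (u (sub_val k)).
pose g (k : metric_sub (M f)) := phi (v (sub_val k)).
have hE k : sub_val (h k) = u (sub_val k) by rewrite phiE//; apply: uM; exact: sub_valP.
have gE k : sub_val (g k) = v (sub_val k) by rewrite phiE//; apply: vM; exact: sub_valP.
have uh : uhomeo h.
  exists g; split.
  - move=> e /uc[r r0 rP]; exists r => // x y _ _ xy; rewrite mdist_sub !hE.
    by apply: rP => //; exact: sub_valP.
  - move=> e /vc[r r0 rP]; exists r => // x y _ _ xy; rewrite mdist_sub !gE.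
    by apply: rP => //; exact: sub_valP.
  - by move=> k; apply: sub_val_inj; rewrite gE hE vu//; exact: sub_valP.
  - by move=> k; apply: sub_val_inj; rewrite hE gE uv//; exact: sub_valP.
have [h' h'E] := mk_homeo uh.
exists (metric_sub (M f)), h', phi; split => //.
- apply/(specialP sK zK pK _ k0); rewrite h'E.
  apply: (rich_transfer (psi := @sub_val _ _ (M f)) (phi := phi)) rf.
  + rewrite dom_graph_of fM; apply/seteqP; split=> [_ [k _ <-]|x fx]; first exact: sub_valP.
    by exists (phi x) => //; exact: phiE.
  + exact: self_rel_graph.
  + move=> k l _ _; rewrite /graph_of /= uE; last exact: sub_valP.
    by rewrite -hE; split=> [->//|/sub_val_inj].
  + exact: self_graph_of.
  + by move=> e e0; exists e.
  + by rewrite fM => e e0; exists e => // x y fx fy; rewrite mdist_sub !phiE.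
  + by move=> k _; exact: phiK.
- exists (@sub_val _ _ (M f)); split => //.
  + apply/within_mcontinuousP => x fx e e0; exists e => // y fy xy.
    by rewrite mdist_sub !phiE.
  + by apply/within_mcontinuousP => x _ e e0; exists e.
  + by move=> k _; exact: sub_valP.
  + by split=> x; rewrite inE => ?; [exact: phiE|exact: phiK].
- by move=> x fx; rewrite h'E /h phiE.
Qed.

Lemma cantor_set_elim (K : metricType R) : cantor_set [set: K] ->
  [/\ seqcompact [set: K], zero_dim K, no_isolated K & exists x : K, True].
Proof.
move=> [[x _] cK /perfect_metricP[_ pK] tK]; have sK := compact_seqcompact cK.
split; [exact: sK|exact: totally_disconnected_zero_dim| |by exists x].
by move=> y e e0; have [z [_ zy yz]] := pK y I e e0; exists z.
Qed.

(** Richness at all scales is a topological property, so it transfers from any model [K] along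
    [phi]. *)
Lemma conj_to_special_good f : conj_to_special f -> forall m, good_at m (graph f).
Proof.
move=> [_ [u [[v [cu cv uM vM [uK vK]]] fE [K [h [phi [cK sh hphi hu]]]]]]].
have [sK zK pK [k0 _]] := cantor_set_elim cK.
have sM := compact_seqcompact (@M_compact f).
have uc : ucontinuous_on (M f) u.
  by apply: seqcompact_ucontinuous => //; apply/within_mcontinuousP.
have vc : ucontinuous_on (M f) v.
  by apply: seqcompact_ucontinuous => //; apply/within_mcontinuousP.
have domi : dom (inv_rel (graph f)) = M f.
  apply/seteqP; split=> [_ [[x y] /= fyx <-]|x /graph_pred[y fyx]].
    exact: self_rel_graph fyx.
  by exists (x, y).
have rh := (specialP sK zK pK h k0).1 sh.
have [psi [cphi cpsi phiK0 psiM [phiK psiK]]] := hphi.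
move=> m; split; last 2 first.
- apply: (@functional_at_ucont _ u) => // x y; rewrite fE => -[_ /=]//.
- apply: (@functional_at_ucont _ v); first by rewrite domi.
  by move=> x y; rewrite /inv_rel /= fE => -[/= fy ->]; rewrite uK ?inE.
apply: (rich_transfer (psi := phi) (phi := psi)) rh _.
- rewrite dom_graph_of; apply/seteqP; split=> // k _.
  by exists (psi k); [exact: psiM|rewrite psiK ?inE].
- exact: self_graph_of.
- move=> x y fx fy; rewrite /graph_of /= hu// fE /=; split=> [[_ ->]//|e].
  split => //; have := congr1 psi e; rewrite !phiK ?inE//; exact: uM.
- exact: self_rel_graph.
- by apply: seqcompact_ucontinuous => //; apply/within_mcontinuousP.
- rewrite dom_graph_of.
  by apply: seqcompact_ucontinuous => //; apply/within_mcontinuousP.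
- by move=> x fx; rewrite phiK ?inE.
Qed.

Lemma DS_nbhsP f (U : set (DS V)) : nbhs f U <->
  exists2 e : R, 0 < e & forall g, mdist (\val f) (\val g) < e -> U g.
Proof.
rewrite set_type_nbhsP; split=> [[B /nbhs_mdistP[e e0 eB] BU]|[e e0 eU]].
  by exists e => // g fg; apply: BU; exact: eB.
exists [set C | mdist (\val f) C < e]; first by apply/nbhs_mdistP; exists e.
by move=> g /= fg; exact: eU.
Qed.

Lemma mdist_hclose f g (e : R) : mdist (\val f) (\val g) < e ->
  hclose e (graph f) (graph g).
Proof.
have half (f' g' : DS V) : hausdorff_dist (graph f') (graph g') < e ->
    forall p, graph f' p -> exists2 q, graph g' q & mdist p.1 q.1 < e /\ mdist p.2 q.2 < e.
  move=> fg p fp; have [|q gq] := @dist_to_lt _ _ (graph g') p e (graph_neq0 g').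
    exact: le_lt_trans (dist_to_hausdorff (@graph_compact f') (graph_neq0 g') fp) fg.
  rewrite {1}/mdist /= /prod_dist gt_max => /andP[d1 d2].
  by exists q.
move=> fg; split=> [|q gq]; first exact: half.
have [|p fp [d1 d2]] := half g f _ q gq; first by rewrite hausdorff_dist_sym.
by exists p => //; rewrite metric_sym [mdist p.2 _]metric_sym.
Qed.

Lemma hclose_mdist f g (e : R) : hclose e (graph f) (graph g) -> mdist (\val f) (\val g) <= e.
Proof.
move=> [fg gf]; apply: hausdorff_dist_le; [exact: graph_neq0|exact: graph_neq0| |].
  move=> p /fg[q gq [d1 d2]]; apply: le_trans (dist_to_le p gq) _.
  by rewrite /mdist /= /prod_dist ge_max !ltW.
move=> q /gf[p fp [d1 d2]]; apply: le_trans (dist_to_le q fp) _.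
by rewrite metric_sym /mdist /= /prod_dist ge_max !ltW.
Qed.

Lemma good_at_open m : open [set f : DS V | good_at m (graph f)].
Proof.
rewrite openE => f [rf ff fi]; apply/DS_nbhsP.
have [e1 e10 P1] := rich_at_open rf; have [e2 e20 P2] := functional_at_open ff.
have [e3 e30 P3] := functional_at_open fi.
exists (Num.min e1 (Num.min e2 e3)); first by rewrite !lt_min e10 e20.
move=> g; rewrite !lt_min => /and3P[/mdist_hclose fg1 /mdist_hclose fg2 /mdist_hclose fg3].
split; [by apply: P1 => //; exact: self_rel_graph|exact: P2|].
by apply: P3; exact: hclose_inv.
Qed.

Lemma good_at_iso m f g : iso_conj f g -> good_at m (graph f) -> good_at m (graph g).
Proof.
rewrite iso_conj_sym => /asboolP[psi [[psiE psid] gf]] [rf ff fi].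
have psiM x : M g x -> M f (psi x) by move=> gx; rewrite -psiE; exists x.
have gM x y : graph g (x, y) -> M g x /\ M g y.
  by move=> gxy; split; [exists (x, y)|exact: self_rel_graph gxy].
split.
- apply: (rich_at_pull (psi := psi) (k := m)) rf => //; [exact: self_rel_graph|exact: self_rel_graph|].
  by move=> r r0; exists r => // x y gx gy; rewrite psid.
- have [r r0 rP] := ff; exists r => // x y x' y' gxy gxy' xx'.
  have [gx gy] := gM _ _ gxy; have [gx' gy'] := gM _ _ gxy'.
  by rewrite -(psid y y')//; apply: (rP (psi x) _ (psi x')); [apply/gf|apply/gf|rewrite psid].
- have [r r0 rP] := fi; exists r => // x y x' y' gxy gxy' xx'.
  have [gy gx] := gM _ _ gxy; have [gy' gx'] := gM _ _ gxy'.
  by rewrite -(psid y y')//; apply: (rP (psi x) _ (psi x')); rewrite /inv_rel /=;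
    [apply/gf|apply/gf|rewrite psid].
Qed.

(** Each scale is saturated for isometric conjugacy, so its image has an open preimage, and one
    representative of a class in the intersection is good at every scale. *)
Lemma DS_Iso_SH_Gdelta : Gdelta (DS_Iso_SH V).
Proof.
exists (fun m => [set \pi_(DS_Iso V) f | f in [set f : DS V | good_at m (graph f)]]).
  move=> m; rewrite /open /= /quotient_open.
  rewrite (_ : _ @^-1` _ = [set f : DS V | good_at m (graph f)]); first exact: good_at_open.
  apply/seteqP; split=> [f [g gg] /eqmodP fg|f gf]; last by exists f.
  exact: good_at_iso gg.
apply/seteqP; split=> [_ [f /conj_to_special_good sf <-] m _|q qm].
  by exists f => //; exact: sf.
have [f ff fq] := qm 0%N I; exists f => //; apply: good_conj_to_special => m.
have [g gg] := qm m I; rewrite -fq => /eqmodP gf; exact: good_at_iso gg.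
Qed.

End dynamical_systems.

(** * Cantor subsets *)

Section cantor_subsets.
Context {R : realType} {V : metricType R}.

Definition metric_cantor (A : set V) :=
  [/\ compact A, A !=set0,
   forall x, A x -> forall e : R, 0 < e -> exists y, [/\ A y, y != x & mdist x y < e] &
   forall e : R, 0 < e -> exists T (c : V -> T),
     (exists2 d : R, 0 < d & forall x y, A x -> A y -> mdist x y < d -> c x = c y) /\
     forall x y, A x -> A y -> c x = c y -> mdist x y < e].

Lemma metric_cantorU (A B : set V) (s : R) : 0 < s ->
  (forall a b, A a -> B b -> s <= mdist a b) ->
  metric_cantor A -> metric_cantor B -> metric_cantor (A `|` B).
Proof.
move=> s0 AB [cA A0 pA zA] [cB B0 pB zB]; split.
- exact: compactU.
- by have [a Aa] := A0; exists a; left.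
- move=> x [Ax|Bx] e e0.
    by have [y [Ay yx xy]] := pA x Ax e e0; exists y; split => //; left.
  by have [y [Ay yx xy]] := pB x Bx e e0; exists y; split => //; right.
- move=> e e0; have [T1 [c1 [[d1 d10 cd1] cm1]]] := zA e e0.
  have [T2 [c2 [[d2 d20 cd2] cm2]]] := zB e e0.
  have dis x : A x -> ~ B x.
    by move=> Ax Bx; have := AB x x Ax Bx; rewrite mdistxx; lra.
  exists (T1 + T2)%type, (fun x => if pselect (A x) then inl (c1 x) else inr (c2 x)).
  split.
    exists (Num.min s (Num.min d1 d2)); first by rewrite !lt_min s0 d10.
    move=> x y ABx ABy; rewrite !lt_min => /and3P[xys xy1 xy2].
    case: pselect => [Ax|nAx]; case: pselect => [Ay|nAy].
    + by rewrite (cd1 x y).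
    + by case: ABy => // By; exfalso; have := AB x y Ax By; lra.
    + by case: ABx => // Bx; exfalso; have := AB y x Ay Bx; rewrite metric_sym; lra.
    + by rewrite (cd2 x y)//; [case: ABx|case: ABy].
  move=> x y ABx ABy; case: pselect => [Ax|nAx]; case: pselect => [Ay|nAy] // -[xy].
    exact: cm1.
  by apply: cm2 => //; [case: ABx|case: ABy].
Qed.

Variable dc : V -> V -> R.
Hypotheses (dcM : is_metric dc) (dcC : compatible_metric dc) (dcK : complete_metric dc).
Hypothesis pV : no_isolated V.

Lemma compatible_small (x : V) (e : R) : 0 < e ->
  exists2 r : R, 0 < r & forall z, mdist x z < r -> dc x z < e.
Proof.
move=> e0; have : nbhs x [set z | dc x z < e] by apply/dcC; exists e.
by move=> /nbhs_mdistP[r r0 rP]; exists r.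
Qed.

Lemma cauchy_mdist_limit (u : nat -> V) : (forall n m, (n <= m)%N -> dc (u n.+1) (u m.+1) < invS n) ->
  exists l, forall e : R, 0 < e -> exists N, forall n, (N <= n)%N -> mdist (u n) l < e.
Proof.
have [_ _ dsym dtri] := dcM.
move=> H; have [|l ul] := dcK (u := u).
  move=> e e0; have [|n ne] := @invS_small R (e / 2); first by lra.
  exists n.+1 => -[|p] [|q]// np nq.
  have := H n p np; have := H n q nq; have := dtri (u p.+1) (u n.+1) (u q.+1).
  by rewrite [dc (u p.+1) (u n.+1)]dsym; lra.
exists l => e e0; have := ul (ball l e) (nbhsx_ballx _ _ e0).
by move=> [N _ NP]; exists N => n /NP /=; rewrite ballEmdist /= metric_sym.
Qed.

(* A binary tree of nested balls: a ball (y, r) has two disjoint children around y and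
   a nearby point, small for both the given and the complete metric. *)
Lemma cantor_near (x0 : V) (r0 : R) : 0 < r0 ->
  exists A, metric_cantor A /\ forall a, A a -> mdist x0 a < r0.
Proof.
move=> r00; pose node := {p : V * R | 0 < p.2}.
have step (pn : node * nat) : exists q : node,
  let: (y, r, y', r') := ((sval pn.1).1, (sval pn.1).2, (sval q).1, (sval q).2) in
  [/\ [/\ r' <= invS pn.2, mdist y y' + r' <= r & r' <= r], 4 * r' <= mdist y y',
     forall z, mdist y z <= r' -> dc y z < invS pn.2 &
     forall z, mdist y' z <= r' -> dc y' z < invS pn.2].
  case: pn => -[[y r] /= rgt0] n.
  have [|y' y'y yy'] := pV y (e := r / 2); first by lra.
  have D0 : 0 < mdist y y' by rewrite mdist_gt0 eq_sym.
  have [s s0 sP] := compatible_small y (@invS_gt0 R n).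
  have [s' s'0 s'P] := compatible_small y' (@invS_gt0 R n).
  (* A quarter of the distance leaves a gap [2 * r'] between the children, [r / 2] keeps them in the
     parent, and halving [s] and [s'] allows closed balls. *)
  pose r' := Num.min (Num.min (invS n) (mdist y y' / 4)) (Num.min (r / 2) (Num.min (s / 2) (s' / 2))).
  have r'0 : 0 < r' by rewrite !lt_min invS_gt0; lra.
  have [[h1 h2 h3] [h4 h5]] : [/\ r' <= invS n, r' <= mdist y y' / 4 & r' <= r / 2] /\
     (r' <= s / 2 /\ r' <= s' / 2) by do ![split]; rewrite !ge_min lexx ?orbT.
  exists (exist _ (y', r') r'0) => /=; split => [| |z yz|z yz]; [by split; lra|by lra| |].
    by apply: sP; lra.
  by apply: s'P; lra.
have [nx nxP] := choice step.
(* The digit [true] moves to the nearby point and [false] keeps the centre; both take the new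
   radius. *)
pose nd (s : nat -> bool) (n : nat) : node := iteri n (fun i p =>
  if s i then nx (p, i) else exist _ ((sval p).1, (sval (nx (p, i))).2) (svalP (nx (p, i))))
  (exist _ (x0, r0 / 2) (ltac:(simpl; lra) : 0 < (x0, r0 / 2).2)).
pose y s n := (sval (nd s n)).1; pose r s n := (sval (nd s n)).2.
have ndE s t n : (forall i, (i < n)%N -> s i = t i) -> nd s n = nd t n.
  elim: n => // n IH st; rewrite /nd /= -/(nd s n) -/(nd t n) (IH _) ?(st n)// => i i_n.
  by apply: st; exact: ltnW.
have rgt0 s n : 0 < r s n := svalP (nd s n).
have nest s n : [/\ mdist (y s n) (y s n.+1) + r s n.+1 <= r s n, r s n.+1 <= invS n &
    forall z, mdist (y s n.+1) z <= r s n.+1 -> dc (y s n.+1) z < invS n].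
  have := nxP (nd s n, n); rewrite /y /r /nd /= -/(nd s n).
  case: (nx (nd s n, n)) => -[y' r'] /= r'0 [[h1 h2 h3] h4 h5 h6].
  by case: (s n) => /=; rewrite ?mdistxx ?add0r.
have nested s n m : (n <= m)%N -> mdist (y s n) (y s m) + r s m <= r s n.
  move=> nm; rewrite -(subnKC nm); elim: (m - n)%N => [|k IH].
    by rewrite addn0 mdistxx add0r.
  have [h _ _] := nest s (n + k)%N; rewrite addnS.
  by have := metric_triangle (y s n) (y s (n + k)%N) (y s (n + k).+1); lra.
have lim s : exists l, forall e : R, 0 < e -> exists N, forall n, (N <= n)%N -> mdist (y s n) l < e.
  apply: cauchy_mdist_limit => n m nm; have [_ _] := nest s n; apply.
  by have := nested s n.+1 m.+1 nm; have := rgt0 s m.+1; lra.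
have [E EP] := choice lim.
have Er s n : mdist (y s n) (E s) <= r s n.
  apply/ler_addgt0Pr => e e0; have [N NP] := EP s e e0.
  have := NP _ (leq_maxl N n); have := nested s n _ (leq_maxr N n).
  have := metric_triangle (y s n) (y s (maxn N n)) (E s).
  by have := rgt0 s (maxn N n); lra.
have Enear s t n : (forall i, (i <= n)%N -> s i = t i) -> mdist (E s) (E t) <= 2 * invS n.
  move=> st; have e : nd s n.+1 = nd t n.+1 by apply: ndE => i; rewrite ltnS; exact: st.
  have := Er s n.+1; have := Er t n.+1; rewrite /y /r -e -/(y s n.+1) -/(r s n.+1).
  have [_ h _] := nest s n; have := metric_triangle (E s) (y s n.+1) (E t).
  by rewrite [mdist (E s) (y _ _)]metric_sym; lra.
have rdec s n m : (n <= m)%N -> r s m <= r s n.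
  by move=> /(nested s); have := mdist_ge0 (y s n) (y s m); lra.
(* At the first digit where they differ, the two branches leave a common node for disjoint
   children. *)
have Esep s t n : (exists2 i, (i < n)%N & s i != t i) -> 2 * r s n <= mdist (E s) (E t).
  move=> [i0 i0n sti0]; have ex : exists i, s i != t i by exists i0.
  case: (ex_minnP ex) => i sti imin.
  have i_n : (i < n)%N by apply: leq_ltn_trans i0n; exact: imin.
  have e : nd s i = nd t i.
    apply: ndE => j ji; apply/eqP; apply: contraT => stj.
    by have := imin j stj; lia.
  suff : 2 * r s i.+1 <= mdist (E s) (E t) by have := rdec s _ _ i_n; lra.
  have := Er s i.+1; have := Er t i.+1; have := nxP (nd s i, i).
  rewrite /y /r /nd /= -/(nd s i) -/(nd t i) -e.
  move: (sval (nd s i)).1 => v.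
  case: (nx (nd s i, i)) => -[y' r'] /= r'0.
  have := metric_triangle v (E s) y'; have := metric_triangle (E s) (E t) y'.
  have := metric_triangle v (E t) y'; have := metric_triangle (E t) (E s) y'.
  have := metric_sym (E s) (E t); have := metric_sym (E s) y'; have := metric_sym (E t) y'.
  by case: (s i) sti; case: (t i) => //= _ e1 e2 e3 h1 h2 h3 h4 [_ h5 _ _]; lra.
exists [set E s | s in [set: nat -> bool]]; split; last first.
  by move=> _ [s _ <-]; have := Er s 0%N; rewrite /y /r /=; lra.
have cE : continuous (E : cantor_space -> V).
  move=> s U /nbhs_mdistP[e e0 eU]; have [|n ne] := @invS_small R (e / 2); first by lra.
  have pre k : nbhs s [set t : cantor_space | forall i, (i < k)%N -> s i = t i].
    elim: k => [|k IH]; first by apply: filterS filterT => t _ i.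
    have hk : nbhs s [set t : cantor_space | s k = t k].
      have := @proj_continuous nat (fun=> bool) k s [set b | s k = b]; apply.
      by apply: open_nbhs_nbhs; split => //; exact: discrete_open.
    apply: filterS (filterI IH hk) => t [h1 h2] i; rewrite ltnS leq_eqVlt.
    by move=> /orP[/eqP ->//|]; exact: h1.
  apply: filterS (pre n.+1) => t st /=; apply: eU.
  by have := Enear s t n (fun i h => st i h); lra.
have cA : compact [set E s | s in [set: nat -> bool]].
  apply: (@continuous_compact cantor_space V E setT); last exact: cantor_space_compact.
  exact: continuous_subspaceT.
split => //.
- by exists (E (fun=> true)), (fun=> true).
- move=> _ [s _ <-] e e0; have [|n ne] := @invS_small R (e / 2); first by lra.
  pose t i := if i == n.+1 then ~~ s i else s i.
  exists (E t); split; first by exists t.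
    rewrite eq_sym -mdist_gt0; apply: lt_le_trans (Esep s t n.+2 _).
      by have := rgt0 s n.+2; lra.
    by exists n.+1 => //; rewrite /t eqxx; case: (s _).
  have : mdist (E s) (E t) <= 2 * invS n.
    by apply: Enear => i i_n; rewrite /t; case: eqP => // ii; move: i_n; rewrite ii ltnn.
  by lra.
- move=> e e0; have [|n ne] := @invS_small R (e / 2); first by lra.
  have Einj s t : E s = E t -> forall i, s i = t i.
    move=> st i; apply/eqP; apply: contraT => sti.
    have : 2 * r s i.+1 <= mdist (E s) (E t) by apply: Esep; exists i.
    by rewrite st mdistxx; have := rgt0 s i.+1; lra.
  (* Since [E] is injective, the first digits can be read off from a point of the set; elsewhere the
     values of [c] are arbitrary. *)
  have [c cP] : exists c : V -> nat -> bool, forall s, forall i, (i <= n)%N -> c (E s) i = s i.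
    have ex v : exists t : nat -> bool, forall s, E s = v -> forall i, s i = t i.
      have [[s sv]|ns] := pselect (exists s, E s = v); last by exists (fun=> true) => s sv; case: ns; exists s.
      by exists s => t; rewrite -sv => /Einj.
    by have [c cP] := choice ex; exists c => s i _; rewrite -(cP _ s).
  exists (nat -> bool), (fun v i => (i <= n)%N && c v i); split; last first.
    move=> _ _ [s _ <-] [t _ <-] st; suff : mdist (E s) (E t) <= 2 * invS n by lra.
    apply: Enear => i i_n; have := congr1 (@^~ i) st; by rewrite i_n /= !cP.
  apply: (seqcompact_unif (Q := fun v w => (fun i => (i <= n)%N && c v i) = (fun i => (i <= n)%N && c w i))).
    exact: compact_seqcompact.
  move=> _ [s _ <-]; exists (2 * r s n.+1); first by have := rgt0 s n.+1; lra.
  have H t : mdist (E s) (E t) < 2 * r s n.+1 -> forall i, (i <= n)%N -> s i = t i.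
    move=> st i i_n; apply/eqP; apply: contraT => sti.
    have : 2 * r s n.+1 <= mdist (E s) (E t) by apply: Esep; exists i.
    by lra.
  move=> _ _ [t _ <-] [t' _ <-] /H st /H st'; apply: funext => i.
  by case: leqP => //= i_n; rewrite !cP// -st// -st'.
Qed.

End cantor_subsets.

(** * Density *)

Section density.
Context {R : realType} {V : metricType R}.
Hypotheses (V_polish : polish R V) (pV : no_isolated V).

Lemma finite_cantor (I : finType) (x : I -> V) (i0 : I) (e : R) : injective x -> 0 < e ->
  exists (A : set V) (q : V -> I), [/\ metric_cantor A,
    forall a, A a -> mdist (x (q a)) a < e, forall i, exists2 a, A a & q a = i &
    exists2 d : R, 0 < d & forall a b, A a -> A b -> mdist a b < d -> q a = q b].
Proof.
move=> xinj e0; have [_ [dc [dcM dcC dcK]]] := V_polish.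
pose D (ij : I * I) : R := if ij.1 == ij.2 then 1 else mdist (x ij.1) (x ij.2).
pose m := \big[Num.min/1]_ij D ij.
have m0 : 0 < m.
  apply: lt_bigmin => // -[i j] _; rewrite /D /=.
  by case: eqVneq => // ij; rewrite mdist_gt0; apply: contra_neq ij; exact: xinj.
have mD i j : i != j -> m <= mdist (x i) (x j).
  move=> ij; have : m <= D (i, j) by exact: bigmin_le.
  by rewrite /D /= (negbTE ij).
(* Points within [m / 3] of distinct centres are at least [m / 3] apart. *)
pose s := Num.min e (m / 3).
have s0 : 0 < s by rewrite lt_min e0; lra.
have se : s <= e by rewrite ge_min lexx.
have sm : s <= m / 3 by rewrite ge_min lexx orbT.
have [A [cA Ax xA]] : exists A, [/\ metric_cantor A,
    forall a, A a -> exists2 i, i \in i0 :: enum I & mdist (x i) a < s &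
    forall i, i \in i0 :: enum I -> exists2 a, A a & mdist (x i) a < s].
  (* Listing [i0] first makes the base case a single Cantor set instead of an empty union. *)
  elim: (enum I) => [|i l [A [cA Ax xA]]].
    have [A [cA Ax]] := cantor_near dcM dcC dcK pV (x i0) s0.
    exists A; split => // [a /Ax xa|i].
      by exists i0; rewrite ?mem_head.
    rewrite inE => /eqP ->; have [_ [a Aa] _ _] := cA.
    by exists a => //; exact: Ax.
  have [il|il] := boolP (i \in i0 :: l).
    have E j : (j \in [:: i0, i & l]) = (j \in i0 :: l).
      by move: il; rewrite !inE; case: (eqVneq j i) => // -> /orP[->|->] //; rewrite !orbT.
    by exists A; split => // [a /Ax[j jl xa]|j]; [exists j; rewrite ?E|rewrite E; exact: xA].
  have [B [cB Bx]] := cantor_near dcM dcC dcK pV (x i) s0.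
  exists (A `|` B); split.
  - apply: (metric_cantorU s0) => // a b /Ax[j jl ja] /Bx ib.
    have ij : i != j by apply: contraNneq il => ->.
    have := mD i j ij; have := metric_triangle (x i) b (x j); have := metric_triangle b a (x j).
    by rewrite [mdist b a]metric_sym [mdist a (x j)]metric_sym; lra.
  - move=> a [/Ax[j jl ja]|/Bx ia].
      by exists j => //; move: jl; rewrite !inE => /orP[->|->]; rewrite ?orbT.
    by exists i; rewrite ?inE ?eqxx ?orbT.
  - move=> j; rewrite !inE orbCA => /orP[/eqP ->|jl].
      by have [_ [b Bb] _ _] := cB; exists b; [right|exact: Bx].
    by have [|a Aa ja] := xA j; [rewrite inE|exists a => //; left].
have [q qP] : exists q : V -> I, forall a, A a -> mdist (x (q a)) a < s.
  have ex a : exists i, A a -> mdist (x i) a < s.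
    by have [/Ax[i _ ia]|na] := pselect (A a); [exists i|exists i0].
  by have [q qP] := choice ex; exists q.
have qE a i (d : R) : A a -> mdist (x i) a < m - s -> q a = i.
  move=> Aa ia; apply/eqP; apply: contraT => /mD; have := qP a Aa.
  by have := metric_triangle (x (q a)) a (x i); rewrite [mdist a (x i)]metric_sym; lra.
exists A, q; split => // [a /qP|i|]; first by lra.
  have [|a Aa ia] := xA i; first by rewrite inE mem_enum orbT.
  by exists a => //; apply: qE => //; lra.
exists s => // a b Aa Ab ab; apply/esym; apply: qE => //.
have := metric_triangle (x (q a)) a b; have := qP a Aa; lra.
Qed.

Lemma conj_to_special_dense (f0 : DS V) (e : R) : 0 < e ->
  exists2 f : DS V, conj_to_special f & mdist (\val f0) (\val f) < e.
Proof.
(* At most three errors of size [eta] add up: from [f0] to the net, from the net to the Cantor set,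
   and from [g] to the rich map near it. *)
move=> e0; pose eta := e / 8; have eta0 : 0 < eta by rewrite /eta; lra.
have [l [lM Ml]] := seqcompact_net (compact_seqcompact (@M_compact _ _ f0)) eta0.
pose I0 := seq_sub l.
have net y : M f0 y -> exists i : I0, mdist y (val i) < eta.
  by move=> /Ml[z zl yz]; exists (SeqSub zl).
have [[a0 b0] fab0] := graph_neq0 f0.
have [i0 _] := net a0 (ex_intro2 _ _ (a0, b0) fab0 erefl).
have [A [q [cA qA qs [dl dl0 dlP]]]] := finite_cantor i0 (x := val : I0 -> V) val_inj eta0.
pose E (i j : I0) := exists a b, [/\ graph f0 (a, b), mdist a (val i) < eta & mdist b (val j) < eta].
have E1 i : exists j, E i j.
  have [[a b] fab /= ai] := lM _ (ssvalP i).
  have [j bj] := net b (self_rel_graph fab).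
  by exists j, a, b; split => //; rewrite ai mdistxx.
have E2 j : exists i, E i j.
  have [a fab] := graph_pred (lM _ (ssvalP j)).
  have [i ai] := net a (ex_intro2 _ _ (a, _) fab erefl).
  by exists i, a, (ssval j); split => //; rewrite mdistxx.
have [cptA A0 pA zA] := cA.
have [cK sK zK pK] := cantor_metric_sub cptA A0 pA zA.
pose p (k : metric_sub A) := q (sub_val k).
have lp : loc_const p by exists dl => // x y; apply: dlP; exact: sub_valP.
have ps i : exists k, p k = i.
  by have [a Aa qa] := qs i; have [k ka] := sub_ex Aa; exists k; rewrite /p ka.
have [g [ug gE gS]] := realize_relation sK zK pK lp ps E1 E2.
have [g' g'E] := mk_homeo ug.
have [k gk rk] := homeo_baire sK (@rich_at_homeo_open _ _) (rich_at_dense sK zK pK) g' eta0.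
rewrite /unear g'E in gk.
pose h := homeo_fun k.
have [h' [uh uh' hh' h'h]] := homeo_uhomeo sK k.
pose F := [set (sub_val z, sub_val (h z)) | z in [set: metric_sub A]].
have cF : compact F.
  apply: continuous_compact; last exact: compact_metric_sub.
  apply: continuous_subspaceT; apply/mcontinuousTP.
  move=> z _ r r0; have [r1 r10 r1P] := uh r r0.
  exists (Num.min r r1); first by rewrite lt_min r0.
  move=> y _; rewrite lt_min => /andP[y1 y2].
  by rewrite {1}/mdist /= /prod_dist gt_max /= -!mdist_sub y1; exact: r1P.
have F1 : fst @` F = A.
  apply/seteqP; split=> [_ [_ [z _ <-] <-]|a /sub_ex[z <-]]; first exact: sub_valP.
  by exists (sub_val z, sub_val (h z)) => //; exists z.
have F2 : snd @` F = A.
  apply/seteqP; split=> [_ [_ [z _ <-] <-]|a /sub_ex[z <-]]; first exact: sub_valP.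
  exists (sub_val (h' z), sub_val z) => //; exists (h' z) => //.
  by congr (_, sub_val _); exact: h'h.
have F0 : F !=set0 by have [a /sub_ex[z _]] := A0; exists (sub_val z, sub_val (h z)), z.
have [f fF] := mk_DS cF F0 (etrans F1 (esym F2)).
have fM : M f = A by rewrite /M fF.
exists f; last first.
  suff : mdist (\val f0) (\val f) <= 3 * eta by rewrite /eta; lra.
  apply: hclose_mdist; rewrite fF; split=> [[a b] fab|_ [z _ <-]] /=.
    have [i ai] := net a (ex_intro2 _ _ (a, b) fab erefl).
    have [j bj] := net b (self_rel_graph fab).
    have [|z [zi zj]] := gS i j; first by exists a, b.
    exists (sub_val z, sub_val (h z)); first by exists z.
    have := qA _ (sub_valP z); have := qA _ (sub_valP (g z)); rewrite -/(p z) -/(p (g z)) zi zj.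
    have := gk z; rewrite mdist_sub -/h => d1 d2 d3 /=; split.
      by have := metric_triangle a (val i) (sub_val z); lra.
    have := metric_triangle b (val j) (sub_val (h z)).
    by have := metric_triangle (val j) (sub_val (g z)) (sub_val (h z)); lra.
  have [a [b [fab ai bj]]] := gE z; exists (a, b) => //=.
  have := qA _ (sub_valP z); have := qA _ (sub_valP (g z)); rewrite -/(p z) -/(p (g z)).
  have := gk z; rewrite mdist_sub -/h => d1 d2 d3 /=; split.
    by have := metric_triangle a (val (p z)) (sub_val z); lra.
  have := metric_triangle b (val (p (g z))) (sub_val (h z)).
  by have := metric_triangle (val (p (g z))) (sub_val (g z)) (sub_val (h z)); lra.
have [a1 Aa1] := A0; have [k1 _] := sub_ex Aa1.
have [phi phiE] : exists phi : V -> metric_sub A, forall x, A x -> sub_val (phi x) = x.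
  have ex x : exists z : metric_sub A, A x -> sub_val z = x.
    by have [/sub_ex[z zx]|nx] := pselect (A x); [exists z|exists k1].
  by have [phi phiE] := choice ex; exists phi.
have phiK z : phi (sub_val z) = z by apply: sub_val_inj; rewrite phiE//; exact: sub_valP.
have fE x y : graph f (x, y) <-> A x /\ y = sub_val (h (phi x)).
  rewrite fF; split=> [[z _ [<- <-]]|[Ax ->]]; first by rewrite phiK; split => //; exact: sub_valP.
  by exists (phi x) => //; rewrite phiE.
have domf : dom (graph f) = A := fM.
have domi : dom (inv_rel (graph f)) = A.
  rewrite -[RHS]fM; apply/seteqP; split=> [_ [[x y] /= fyx <-]|x /graph_pred[y fyx]].
    exact: self_rel_graph fyx.
  by exists (x, y).
apply: good_conj_to_special => m; split.
- apply: (rich_transfer (psi := phi) (phi := @sub_val _ _ A)) rk _.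
  + rewrite dom_graph_of domf; apply/seteqP; split=> // z _.
    by exists (sub_val z); [exact: sub_valP|exact: phiK].
  + exact: self_graph_of.
  + rewrite domf => x y Ax Ay; rewrite fE /graph_of /=; split=> [[_ ->]|/= yE]; first by rewrite phiK.
    by split => //; rewrite -[LHS](phiE _ Ay) yE.
  + exact: self_rel_graph.
  + by rewrite domf => r r0; exists r => // x y Ax Ay; rewrite mdist_sub !phiE.
  + by rewrite dom_graph_of => r r0; exists r.
  + by rewrite domf; exact: phiE.
- apply: (@functional_at_ucont _ _ _ (fun x => sub_val (h (phi x)))); last by move=> x y /fE[].
  rewrite domf => r /uh[r1 r10 r1P]; exists r1 => // x y Ax Ay xy.
  by rewrite -mdist_sub; apply: r1P => //; rewrite mdist_sub !phiE.
- apply: (@functional_at_ucont _ _ _ (fun x => sub_val (h' (phi x)))); last first.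
    by move=> x y; rewrite /inv_rel /= => /fE[Ay ->]; rewrite phiK hh' phiE.
  rewrite domi => r /uh'[r1 r10 r1P]; exists r1 => // x y Ax Ay xy.
  by rewrite -mdist_sub; apply: r1P => //; rewrite mdist_sub !phiE.
Qed.

End density.

Theorem theorem3p7 (R : realType) (V : metricType R)
    (V_polish : polish R V) (V_perfect : perfect_set [set: V])
    (V_ultrahomogeneous : ultrahomogeneous V) :
  dense (DS_Iso_SH V) /\ Gdelta (DS_Iso_SH V).
Proof.
split; last exact: DS_Iso_SH_Gdelta.
have pV : no_isolated V.
  move=> x e e0; have [_ /(_ x I e e0)[y [_ yx xy]]] := (perfect_metricP _).1 V_perfect.
  by exists y.
move=> W [q Wq] oW.
(* An open set of classes is met by approximating a representative, since its preimage is open. *)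
have /DS_nbhsP[e e0 eW] : nbhs (repr q) (\pi_(DS_Iso V) @^-1` W).
  by apply: open_nbhs_nbhs; split => //=; rewrite reprK.
have [f sf qf] := conj_to_special_dense V_polish pV (repr q) e0.
by exists (\pi_(DS_Iso V) f); split; [exact: eW|exists f].
Qed.
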